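(* The Einstein/Yang-Mills equations in $3+1$ space-time dimensions with gauge group $\mathrm{SU}(2)$ admit a globally defined, smooth (nonsingular) static symmetric solution of the form described in the context, whose metric is asymptotically flat and whose total mass is finite. Precisely: there exist $\bar\lambda$ with $0<\bar\lambda<2$ and smooth real functions $w,A,T$ defined for all $r\ge 0$, with $A>0$ and $T>0$, satisfying for all $r>0$ $$r^2Aw''+\Phi w'+w(1-w^2)=0,$$ $$rA'+(2w'^2+1)A=1-\frac{(1-w^2)^2}{r^2},$$ $$2rAT'+\left(2w'^2A+\frac{\Phi}{r}\right)T=0,$$ where $\Phi(r)=r(1-A(r))-\frac{(1-w(r)^2)^2}{r}$, together with the conditions at the origin $$w(0)=1,\quad w'(0)=0,\quad w''(0)=-\bar\lambda,\quad A(0)=1,\quad T'(0)=0,$$ and such that $$\lim_{r\to\infty}(w(r),w'(r))=(-1,0),\qquad \lim_{r\to\infty}r(1-A(r))<\infty,\qquad \lim_{r\to\infty}(A(r),T(r))=(1,1).$$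
   Context: The Einstein/Yang-Mills (EYM) equations are the equations obtained by making stationary the action $\int(-R+|F|^2)\sqrt{g}\,dx$ over metrics $g_{ij}$ of signature $(-,+,+,+)$ and $\mathrm{SU}(2)$ connections, where $R$ is the scalar curvature of $g_{ij}$, $F$ is the $\mathfrak{su}(2)$-valued Yang-Mills curvature, and $|F|^2=g^{ij}g^{kl}F_{ij}F_{kl}$ is formed using the form $\langle\tau_i,\tau_j\rangle=-2\,\mathrm{tr}\,\tau_i\tau_j$ on $\mathfrak{su}(2)$. The static symmetric solutions sought have metric $$ds^2=-T^{-2}(r)\,dt^2+A^{-1}(r)\,dr^2+r^2(d\theta^2+\sin^2\theta\,d\phi^2)$$ and connection $$\alpha=w\,\tau_1\,d\theta+[\cos\theta\,\tau_3+w\sin\theta\,\tau_2]\,d\phi,$$ where $\tau_1,\tau_2,\tau_3$ are the generators of $\mathfrak{su}(2)$, with curvature $F=d\alpha+\alpha\wedge\alpha=w'\tau_1\,dr\wedge d\theta+w'\tau_2\,dr\wedge(\sin\theta\,d\phi)-(1-w^2)\tau_3\,d\theta\wedge(\sin\theta\,d\phi)$. For such metrics and connections the EYM equations reduce to the three ordinary differential equations displayed in the claim (prime denotes $d/dr$). The conditions $w(0)=1$, $w'(0)=0$, $A(0)=1$, $T'(0)=0$ are those ensuring that the solution is nonsingular at $r=0$; finite total mass means that $\lim_{r\to\infty}r(1-A(r))$ is finite; asymptotic flatness means $\lim_{r\to\infty}(A(r),T(r))=(1,1)$. The solution of the first two equations with these conditions at $r=0$ is uniquely determined by the free parameter $w''(0)=-\lambda$.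 *)

(* Defs.v *)
From Stdlib Require Import Reals.
From Coquelicot Require Import Coquelicot.

Open Scope R_scope.

Definition half_line (r : R) : Prop := 0 <= r.

(* [f'] is the derivative of [f] on [0, +oo): one-sided at 0, two-sided at
   every r > 0.  Values at negative arguments play no role. *)
Definition is_deriv_half_line (f f' : R -> R) : Prop :=
  forall r : R, 0 <= r -> D_in f f' half_line r.

(* C^infinity on the closed half line [0, +oo); [D n] is the n-th derivative. *)
Definition smooth_half_line (f : R -> R) : Prop :=
  exists D : nat -> R -> R,
    (forall r : R, 0 <= r -> D 0%nat r = f r) /\
    (forall n : nat, is_deriv_half_line (D n) (D (S n))).

Definition Phi (A w : R -> R) (r : R) : R :=
  r * (1 - A r) - (1 - w r ^ 2) ^ 2 / r.

(* Main.v *)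
Require Import Defs.
From Stdlib Require Import Reals Lra Lia Psatz IndefiniteDescription.
From Coquelicot Require Import Coquelicot.

Open Scope R_scope.

(** The solutions regular at the centre form a family indexed by
    [lambda = - w''(0)], and the required one is found by shooting in [lambda]:
    the orbit must run from [w = 1] at the centre to [w = -1] at infinity.

    Near the centre, coordinates [q, p, b] turn the equations into a system
    [q' = r k], [p' + 4 p / r = k], [b' + 3 b / r = g] whose integral form is
    solved by Picard iteration ([local_family_exists]).  Away from the centre
    the variables [l = 1 / r], [w], [P = r N w'], [N = sqrt A] and a fifth one,
    [K], tied to them by a constraint, satisfy a polynomial system that stays
    regular where [A] vanishes; so an orbit can be followed, and depends
    continuously on [lambda], even if it runs into a horizon.

    As long as [N > 0], [w' < 0] and [w > -1] the orbit is bounded a priori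
    ([apriori]), and it can leave this region in two ways only: through
    [w = -1], or through [N = 0] or [w' = 0] with [w > -1]
    ([exit_classification]).  Each way is an open condition on [lambda], and
    the two exclude each other.  A small [lambda] leaves through [w = -1]: the
    metric is then nearly flat, and in flat space the Yang-Mills energy grows
    with [r] ([near_flat_exits_low]).  The orbit with [lambda = 2] leaves the
    other way: explicit polynomial barriers, followed up to the radius where
    [(1 - w^2) / r] reaches 1.001, make [A] so small that [A] vanishes before [w]
    reaches [-1/5], unless [w'] does ([steep_persists], [trapped]).  The connectedness of [(0, 2)] leaves
    a parameter whose orbit stays in the region for ever
    ([critical_parameter]).

    For that orbit [w] decreases, hence converges, and [w' -> 0]; its limit is
    a zero of [w (1 - w^2)], and it is not 0, where the linearized equation
    oscillates ([W_limit_not_0], [W_tends_m1]).  The constraint then gives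
    [A -> 1], and the mass [r (1 - A)] is monotone and bounded ([mass_tends]).

    Back in the variable [r], smoothness for [r >= 0] follows from one
    principle: a bounded solution of [u' + a u / r = g] is one degree smoother
    than [g] ([singular_gain]).  Finally [T] is given by the integral of
    [2 w'^2 / r], which converges because [w' = O(1 / r)] ([G_tends]). *)

(** * Calculus on the real line *)

Lemma is_derive_eq (f : R -> R) (x a b : R) :
  is_derive f x a -> a = b -> is_derive f x b.
Proof. intros H <-; exact H. Qed.

Lemma dconst (c x : R) : is_derive (fun _ => c) x 0.
Proof. apply (is_derive_const (K := R_AbsRing) (V := R_NormedModule)). Qed.

Lemma did (x : R) : is_derive (fun t => t) x 1.
Proof. apply (is_derive_id (K := R_AbsRing)). Qed.

Lemma dplus (f g : R -> R) x a b : is_derive f x a -> is_derive g x b ->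
  is_derive (fun t => f t + g t) x (a + b).
Proof. intros; now apply (is_derive_plus (K := R_AbsRing) (V := R_NormedModule)). Qed.

Lemma dminus (f g : R -> R) x a b : is_derive f x a -> is_derive g x b ->
  is_derive (fun t => f t - g t) x (a - b).
Proof. intros; now apply (is_derive_minus (K := R_AbsRing) (V := R_NormedModule)). Qed.

Lemma dopp (f : R -> R) x a : is_derive f x a -> is_derive (fun t => - f t) x (- a).
Proof. intros; now apply (is_derive_opp (K := R_AbsRing) (V := R_NormedModule)). Qed.

Lemma dmult (f g : R -> R) x a b : is_derive f x a -> is_derive g x b ->
  is_derive (fun t => f t * g t) x (a * g x + f x * b).
Proof.
intros; apply (is_derive_mult (K := R_AbsRing)); try assumption.
intros; apply Rmult_comm.
Qed.

Lemma dpow (f : R -> R) n x a : is_derive f x a ->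
  is_derive (fun t => f t ^ n) x (INR n * a * f x ^ Init.Nat.pred n).
Proof. apply is_derive_pow. Qed.

Lemma ddiv (f g : R -> R) x a b : is_derive f x a -> is_derive g x b -> g x <> 0 ->
  is_derive (fun t => f t / g t) x ((a * g x - f x * b) / g x ^ 2).
Proof. apply is_derive_div. Qed.

Lemma dinv (f : R -> R) x a : is_derive f x a -> f x <> 0 ->
  is_derive (fun t => / f t) x (- a / f x ^ 2).
Proof. apply is_derive_inv. Qed.

Lemma dcomp (f g : R -> R) x a b : is_derive f (g x) a -> is_derive g x b ->
  is_derive (fun t => f (g t)) x (b * a).
Proof. intros; now apply (is_derive_comp (K := R_AbsRing) (V := R_NormedModule) f g). Qed.

Lemma dexp (f : R -> R) x a : is_derive f x a ->
  is_derive (fun t => exp (f t)) x (a * exp (f x)).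
Proof. intros H; apply dcomp; [apply is_derive_exp | exact H]. Qed.

Lemma dsqrt (f : R -> R) x a : is_derive f x a -> 0 < f x ->
  is_derive (fun t => sqrt (f t)) x (a / (2 * sqrt (f x))).
Proof. apply is_derive_sqrt. Qed.

(** Differentiates an arithmetic expression whose atoms have derivatives among
    the hypotheses; the side conditions and the comparison of the derivatives
    remain. *)
Ltac dauto :=
  match goal with
  | |- is_derive (fun _ => ?c) _ _ => apply (dconst c)
  | |- is_derive (fun t => t) _ _ => apply did
  | |- is_derive (fun t => @?f t + @?g t) _ _ => eapply (dplus f g); [dauto|dauto]
  | |- is_derive (fun t => @?f t - @?g t) _ _ => eapply (dminus f g); [dauto|dauto]
  | |- is_derive (fun t => @?f t * @?g t) _ _ => eapply (dmult f g); [dauto|dauto]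
  | |- is_derive (fun t => @?f t / @?g t) _ _ => eapply (ddiv f g); [dauto|dauto|idtac]
  | |- is_derive (fun t => @?f t ^ ?n) _ _ => eapply (dpow f n); dauto
  | |- is_derive (fun t => - @?f t) _ _ => eapply (dopp f); dauto
  | |- is_derive (fun t => / @?f t) _ _ => eapply (dinv f); [dauto|idtac]
  | |- is_derive (fun t => exp (@?f t)) _ _ => eapply (dexp f); dauto
  | |- is_derive (fun t => sqrt (@?f t)) _ _ => eapply (dsqrt f); [dauto|idtac]
  | _ => eassumption
  end.
Ltac derive_by := eapply is_derive_eq; [ dauto | cbv beta ].

Lemma exp_mono x y : x <= y -> exp x <= exp y.
Proof. intros [H| ->]; [left; now apply exp_increasing | right; reflexivity]. Qed.

Lemma continuous_eps (f : R -> R) (x : R) :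
  continuous f x <->
  (forall e, 0 < e -> exists d, 0 < d /\ forall y, Rabs (y - x) < d -> Rabs (f y - f x) < e).
Proof.
split.
- intros H e He.
  destruct (proj1 (filterlim_locally (F := locally x) f (f x)) H (mkposreal e He)) as [d Hd].
  exists d; split; [apply cond_pos|]; intros y Hy; exact (Hd y Hy).
- intros H; apply (proj2 (filterlim_locally (F := locally x) f (f x))); intros e.
  destruct (H e (cond_pos e)) as [d [Hd Hy]].
  exists (mkposreal d Hd); intros y Hb; exact (Hy y Hb).
Qed.

Lemma is_derive_cont (f : R -> R) (x l : R) : is_derive f x l -> continuous f x.
Proof. intros H; apply (ex_derive_continuous (K := R_AbsRing) (V := R_NormedModule)); exists l; exact H. Qed.

Lemma cplus (f g : R -> R) x : continuous f x -> continuous g x ->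
  continuous (fun t => f t + g t) x.
Proof. apply (continuous_plus (V := R_NormedModule)). Qed.

Lemma cmult (f g : R -> R) x : continuous f x -> continuous g x ->
  continuous (fun t => f t * g t) x.
Proof. apply (continuous_mult (K := R_AbsRing)). Qed.

Lemma copp (f : R -> R) x : continuous f x -> continuous (fun t => - f t) x.
Proof. apply (continuous_opp (V := R_NormedModule)). Qed.

Lemma cminus (f g : R -> R) x : continuous f x -> continuous g x ->
  continuous (fun t => f t - g t) x.
Proof. apply (continuous_minus (V := R_NormedModule)). Qed.

Lemma cconst (c x : R) : continuous (fun _ => c) x.
Proof. apply continuous_const. Qed.

Lemma cid (x : R) : continuous (fun t : R => t) x.
Proof. apply continuous_id. Qed.

Lemma cpow (f : R -> R) n x : continuous f x -> continuous (fun t => f t ^ n) x.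
Proof.
intros H; induction n as [|n IH]; [apply cconst | now apply cmult].
Qed.

Lemma cinv (f : R -> R) x : continuous f x -> f x <> 0 -> continuous (fun t => / f t) x.
Proof. intros Hf Hx; now apply continuous_Rinv_comp. Qed.

Lemma csqrt (f : R -> R) x : continuous f x -> continuous (fun t => sqrt (f t)) x.
Proof. intros Hf; now apply continuous_sqrt_comp. Qed.
Ltac cauto :=
  match goal with
  | |- continuous (fun _ => ?c) _ => apply (cconst c)
  | |- continuous (fun t => t) _ => apply cid
  | |- continuous (fun t => @?f t + @?g t) _ => apply (cplus f g); [cauto|cauto]
  | |- continuous (fun t => @?f t - @?g t) _ => apply (cminus f g); [cauto|cauto]
  | |- continuous (fun t => @?f t * @?g t) _ => apply (cmult f g); [cauto|cauto]
  | |- continuous (fun t => - @?f t) _ => apply (copp f); cauto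
  | |- continuous (fun t => @?f t ^ ?n) _ => apply (cpow f n); cauto
  | _ => eassumption
  end.

Lemma mean_value (f df : R -> R) (a b : R) : a < b ->
  (forall t, a < t < b -> is_derive f t (df t)) ->
  (forall t, a <= t <= b -> continuous f t) ->
  exists c, a <= c <= b /\ f b - f a = df c * (b - a).
Proof.
intros Hab Hd Hc.
destruct (MVT_gen f a b df) as [c [Hc1 Hc2]].
- rewrite Rmin_left, Rmax_right by lra; exact Hd.
- rewrite Rmin_left, Rmax_right by lra; intros; now apply continuity_pt_filterlim, Hc.
- rewrite Rmin_left, Rmax_right in Hc1 by lra; eauto.
Qed.

Lemma monotone_by_derive (f df : R -> R) (a b : R) : a <= b ->
  (forall t, a < t < b -> is_derive f t (df t)) ->
  (forall t, a <= t <= b -> continuous f t) ->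
  (forall t, a < t < b -> 0 <= df t) -> f a <= f b.
Proof.
intros Hab Hd Hc Hp.
destruct (Req_dec a b) as [<-|Hne]; [lra|].
(* [df] may be negative at the end points, which the mean value may hit *)
pose (dg := fun t => if Rlt_dec a t then (if Rlt_dec t b then df t else 0) else 0).
destruct (mean_value f dg a b) as [c [Hc1 Hc2]]; [lra| |assumption|].
- intros t Ht; unfold dg; destruct (Rlt_dec a t); [|lra]; destruct (Rlt_dec t b); [|lra].
  now apply Hd.
- assert (0 <= dg c).
  { unfold dg; destruct (Rlt_dec a c); [|lra]; destruct (Rlt_dec c b); [|lra].
    apply Hp; lra. }
  nra.
Qed.

Lemma strict_monotone_by_derive (f df : R -> R) (a b : R) : a < b ->
  (forall t, a < t < b -> is_derive f t (df t)) ->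
  (forall t, a <= t <= b -> continuous f t) ->
  (forall t, a < t < b -> 0 < df t) -> f a < f b.
Proof.
intros Hab Hd Hc Hp.
pose (dg := fun t => if Rlt_dec a t then (if Rlt_dec t b then df t else 1) else 1).
destruct (mean_value f dg a b) as [c [Hc1 Hc2]]; [lra| |assumption|].
- intros t Ht; unfold dg; destruct (Rlt_dec a t); [|lra]; destruct (Rlt_dec t b); [|lra].
  now apply Hd.
- assert (0 < dg c).
  { unfold dg; destruct (Rlt_dec a c); [|lra]; destruct (Rlt_dec c b); [|lra].
    apply Hp; lra. }
  nra.
Qed.

Lemma slope_le_by_derive (f df : R -> R) (a b K : R) : a <= b ->
  (forall t, a < t < b -> is_derive f t (df t)) ->
  (forall t, a <= t <= b -> continuous f t) ->
  (forall t, a < t < b -> df t <= K) -> f b - f a <= K * (b - a).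
Proof.
intros Hab Hd Hc Hp.
assert (H : K * a - f a <= K * b - f b); [|lra].
apply (monotone_by_derive (fun t => K * t - f t) (fun t => K - df t)); try assumption.
- intros t Ht; specialize (Hd t Ht); derive_by; lra.
- intros t Ht; specialize (Hc t Ht); cauto.
- intros t Ht; specialize (Hp t Ht); lra.
Qed.

(** Continuous induction: finitely many continuous functions that start
    positive stay positive if none of them can be the first to vanish. *)
Lemma first_exit (n : nat) (f : nat -> R -> R) (s : R) : 0 <= s ->
  (forall i t, (i < n)%nat -> 0 <= t <= s -> continuous (f i) t) ->
  (forall i, (i < n)%nat -> 0 < f i 0) ->
  (forall t, 0 < t <= s ->
     (forall i u, (i < n)%nat -> 0 <= u < t -> 0 < f i u) ->
     (forall i, (i < n)%nat -> 0 <= f i t) ->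
     forall i, (i < n)%nat -> f i t <> 0) ->
  forall i t, (i < n)%nat -> 0 <= t <= s -> 0 < f i t.
Proof.
intros Hs Hc H0 Hstep.
pose (G := fun t => 0 <= t <= s /\ forall i u, (i < n)%nat -> 0 <= u <= t -> 0 < f i u).
destruct (completeness G) as [m [Hub Hlub]].
- exists s; intros t [Ht _]; lra.
- exists 0; split; [lra|]; intros i u Hi Hu; replace u with 0 by lra; now apply H0.
- assert (Hm0 : 0 <= m).
  { apply Hub; split; [lra|]; intros i u Hi Hu; replace u with 0 by lra; now apply H0. }
  assert (Hms : m <= s) by (apply Hlub; intros t [Ht _]; lra).
  assert (Hbelow : forall i u, (i < n)%nat -> 0 <= u < m -> 0 < f i u).
  { intros i u Hi Hu. destruct (Rlt_dec 0 (f i u)) as [|Hn]; [assumption|exfalso].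
    assert (m <= u); [|lra].
    apply Hlub; intros t [Ht1 Ht2]; destruct (Rle_dec t u); [assumption|exfalso].
    apply Hn, Ht2; [assumption|lra]. }
  assert (Hat : forall i, (i < n)%nat -> 0 < f i m).
  { destruct (Req_dec m 0) as [->|Hm]; [assumption|].
    assert (Hge : forall i, (i < n)%nat -> 0 <= f i m).
    { intros i Hi; destruct (Rle_dec 0 (f i m)) as [|Hn]; [assumption|exfalso].
      destruct (proj1 (continuous_eps (f i) m) (Hc i m Hi (conj Hm0 Hms)) (- f i m)) as [d [Hd Hy]]; [lra|].
      pose (u := Rmax (m / 2) (m - d / 2)).
      assert (Hu1 : m / 2 <= u) by apply Rmax_l.
      assert (Hu2 : m - d / 2 <= u) by apply Rmax_r.
      assert (Hu3 : u < m) by (apply Rmax_lub_lt; lra).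
      specialize (Hbelow i u Hi ltac:(lra)).
      specialize (Hy u ltac:(apply Rabs_def1; lra)).
      apply Rabs_def2 in Hy; lra. }
    intros i Hi; specialize (Hstep m ltac:(lra) Hbelow Hge i Hi).
    specialize (Hge i Hi); lra. }
  destruct (Req_dec m s) as [->|Hne].
  { intros i t Hi Ht; destruct (Req_dec t s) as [->|]; [now apply Hat|].
    apply Hbelow; [assumption|lra]. }
  exfalso.
  assert (Hd : exists d, 0 < d /\ forall i u, (i < n)%nat -> m <= u <= m + d -> 0 < f i u).
  { clear - Hat Hc Hm0 Hms.
    assert (H : forall k, (k <= n)%nat -> exists d, 0 < d /\
              forall i u, (i < k)%nat -> m <= u <= m + d -> 0 < f i u).
    { induction k as [|k IH]; intros Hk.
      - exists 1; split; [lra|]; intros; lia.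
      - destruct IH as [d [Hd IH]]; [lia|].
        destruct (proj1 (continuous_eps (f k) m) (Hc k m ltac:(lia) (conj Hm0 Hms)) (f k m)) as [d2 [Hd2 Hy]];
          [apply Hat; lia|].
        exists (Rmin d (d2 / 2)); split; [apply Rmin_pos; lra|].
        intros i u Hi Hu.
        assert (Rmin d (d2 / 2) <= d) by apply Rmin_l.
        assert (Rmin d (d2 / 2) <= d2 / 2) by apply Rmin_r.
        destruct (Nat.eq_dec i k) as [->|].
        + specialize (Hy u ltac:(apply Rabs_def1; lra)); apply Rabs_def2 in Hy; lra.
        + apply IH; [lia|lra]. }
    apply H; lia. }
  destruct Hd as [d [Hd Hp]].
  assert (Rmin (m + d) s <= m); [|assert (m < Rmin (m + d) s) by (apply Rmin_glb_lt; lra); lra].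
  apply Hub; split.
  + split; [apply Rmin_glb; lra | apply Rmin_r].
  + intros i u Hi Hu; destruct (Rlt_dec u m); [apply Hbelow; [assumption|lra]|].
    apply Hp; [assumption|]; assert (Rmin (m + d) s <= m + d) by apply Rmin_l; lra.
Qed.

Lemma stays_above (f : R -> R) (a b : R) : a <= b ->
  (forall t, a <= t <= b -> continuous f t) -> 0 < f a ->
  (forall t, a < t <= b -> (forall u, a <= u < t -> 0 < f u) -> f t = 0 -> False) ->
  forall t, a <= t <= b -> 0 < f t.
Proof.
intros Hab Hc H0 Hstep t Ht; replace t with (a + (t - a)) by ring.
apply (first_exit 1 (fun _ u => f (a + u)) (b - a)) with (i := O); [lra| | | |lia|lra].
- intros _ u _ Hu; apply (continuous_comp (fun u => a + u) f); [cauto | apply Hc; lra].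
- intros _ _; now rewrite Rplus_0_r.
- intros u Hu Hp _ _ _ Hz; apply (Hstep (a + u)); [lra| |assumption].
  intros v Hv; replace v with (a + (v - a)) by ring; apply (Hp O); [lia|lra].
Qed.

Lemma first_hit (f : R -> R) (c s : R) : 0 <= s ->
  (forall t, 0 <= t <= s -> continuous f t) -> c < f 0 -> f s <= c ->
  exists t, 0 < t <= s /\ f t = c /\ forall u, 0 <= u < t -> c < f u.
Proof.
intros Hs Hc H0 Hfs.
destruct (Classical_Prop.classic
  (exists t, 0 < t <= s /\ f t = c /\ forall u, 0 <= u < t -> c < f u)) as [|Hn]; [assumption|exfalso].
assert (H : 0 < f s - c); [|lra].
apply (first_exit 1 (fun _ t => f t - c) s Hs) with (i := O); [| | |lia|lra].
- intros _ t _ Ht; specialize (Hc t Ht); cauto.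
- intros _ _; lra.
- intros t Ht Hp _ _ _ H; apply Hn; exists t; repeat split; try lra.
  intros u Hu; specialize (Hp O u ltac:(lia) Hu); lra.
Qed.
(** A function that was positive just before a zero cannot be increasing there. *)
Lemma derive_at_zero_after (f : R -> R) (a t l : R) : a < t ->
  (forall u, a <= u < t -> 0 < f u) -> f t = 0 -> is_derive f t l -> l <= 0.
Proof.
intros Ht Hp H0 Hd; apply is_derive_Reals in Hd.
destruct (Rle_dec l 0) as [|Hl]; [assumption|exfalso].
destruct (Hd l ltac:(lra)) as [d Hy].
assert (Hd0 := cond_pos d).
assert (L1 := Rmin_l ((t - a) / 2) (d / 2)); assert (L2 := Rmin_r ((t - a) / 2) (d / 2)).
assert (L3 : 0 < Rmin ((t - a) / 2) (d / 2)) by (apply Rmin_pos; lra).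
pose (h := - Rmin ((t - a) / 2) (d / 2)).
specialize (Hy h ltac:(unfold h; lra) ltac:(unfold h; apply Rabs_def1; lra)).
apply Rabs_def2 in Hy; rewrite H0 in Hy.
specialize (Hp (t + h) ltac:(unfold h; lra)).
assert ((f (t + h) - 0) / h < 0); [|lra].
unfold Rdiv; rewrite Rminus_0_r.
assert (/ h < 0) by (apply Rinv_lt_0_compat; unfold h; lra); nra.
Qed.

Lemma derive_at_first_zero (f : R -> R) (t l : R) : 0 < t ->
  (forall u, 0 <= u < t -> 0 < f u) -> f t = 0 -> is_derive f t l -> l <= 0.
Proof. apply derive_at_zero_after. Qed.

(** * Picard iteration for systems with a regular singular point *)

(** The solution of [t u' + a u = t g] that is bounded at [0]; for [a = 0] it
    is the primitive of [g]. *)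
Definition avg_int (a : nat) (g : R -> R) (t : R) : R :=
  RInt (fun s => s ^ a * g s) 0 t / t ^ a.

Lemma ex_RInt_cont (f : R -> R) (a b : R) : (forall s, continuous f s) -> ex_RInt f a b.
Proof. intros H; apply (ex_RInt_continuous (V := R_CompleteNormedModule)); auto. Qed.

Lemma avg_int_0 a g : avg_int a g 0 = 0.
Proof.
unfold avg_int; rewrite (RInt_point (V := R_CompleteNormedModule)).
unfold zero; simpl; unfold Rdiv; ring.
Qed.

Lemma avg_int_opp a (g : R -> R) (t : R) : (forall s, continuous g s) ->
  avg_int a g (- t) = - avg_int a (fun s => g (- s)) t.
Proof.
intros Hg; unfold avg_int.
destruct (Req_dec t 0) as [->|Ht].
{ rewrite Ropp_0, !(RInt_point (V := R_CompleteNormedModule)).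
  unfold zero; simpl; unfold Rdiv; ring. }
assert (H : RInt (fun s => s ^ a * g s) 0 (- t)
            = - ((-1) ^ a * RInt (fun s => s ^ a * g (- s)) 0 t)).
{ apply (is_RInt_unique (V := R_CompleteNormedModule)).
  assert (H1 : is_RInt (fun s => s ^ a * g (- s)) (- 0) (- (- t))
                 (RInt (fun s => s ^ a * g (- s)) 0 t)).
  { rewrite Ropp_0, Ropp_involutive.
    apply (RInt_correct (V := R_CompleteNormedModule)), ex_RInt_cont.
    intros s; apply cmult; [apply cpow, cid|].
    apply (continuous_comp (fun s => - s) g); [apply copp, cid | apply Hg]. }
  apply (is_RInt_comp_opp (V := R_NormedModule)) in H1.
  apply (is_RInt_scal (V := R_NormedModule) _ _ _ ((-1) ^ a)) in H1.
  apply (is_RInt_opp (V := R_NormedModule)) in H1.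
  eapply (is_RInt_ext (V := R_NormedModule)); [|exact H1].
  intros x _; unfold scal, opp; simpl; unfold mult; simpl.
  rewrite Ropp_involutive.
  replace ((- x) ^ a) with ((-1) ^ a * x ^ a) by (rewrite <- Rpow_mult_distr; f_equal; ring).
  assert ((-1) ^ a * (-1) ^ a = 1).
  { rewrite <- Rpow_mult_distr; replace (-1 * -1) with 1 by ring; apply pow1. }
  transitivity (((-1) ^ a * (-1) ^ a) * (x ^ a * g x)); [ring | rewrite H; ring]. }
rewrite H.
replace ((- t) ^ a) with ((-1) ^ a * t ^ a) by (rewrite <- Rpow_mult_distr; f_equal; ring).
field; split; apply pow_nonzero; lra.
Qed.

(** The kernel [(s / t)^a] is at most one. *)
Lemma avg_int_bound_pos a (g h : R -> R) (t : R) : 0 <= t ->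
  (forall s, continuous g s) -> (forall s, continuous h s) ->
  (forall s, 0 <= s <= t -> Rabs (g s) <= h s) ->
  Rabs (avg_int a g t) <= RInt h 0 t.
Proof.
intros Ht Hg Hh Hb.
destruct (Req_dec t 0) as [->|Hne].
{ rewrite avg_int_0, (RInt_point (V := R_CompleteNormedModule)), Rabs_R0.
  unfold zero; simpl; lra. }
assert (Hc : forall s, continuous (fun s => s ^ a * g s) s).
{ intros s; apply cmult; [apply cpow, cid | apply Hg]. }
assert (Hpos : 0 < t ^ a) by (apply pow_lt; lra).
unfold avg_int, Rdiv; rewrite Rabs_mult, (Rabs_pos_eq (/ t ^ a));
  [|left; now apply Rinv_0_lt_compat].
apply (Rmult_le_reg_r (t ^ a)); [assumption|].
replace (Rabs (RInt (fun s => s ^ a * g s) 0 t) * / t ^ a * t ^ a)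
  with (Rabs (RInt (fun s => s ^ a * g s) 0 t)) by (field; lra).
eapply Rle_trans; [apply abs_RInt_le; [assumption | now apply ex_RInt_cont]|].
replace (RInt h 0 t * t ^ a) with (RInt (fun s => t ^ a * h s) 0 t).
2:{ rewrite (RInt_scal (V := R_CompleteNormedModule)); [|now apply ex_RInt_cont].
    unfold scal; simpl; unfold mult; simpl; ring. }
apply RInt_le; [assumption| | |].
- apply ex_RInt_cont; intros s.
  apply (continuous_comp (fun s => s ^ a * g s) Rabs); [apply Hc | apply continuous_Rabs].
- apply ex_RInt_cont; intros s; apply cmult; [apply cconst | apply Hh].
- intros s Hs; rewrite Rabs_mult, (Rabs_pos_eq (s ^ a)) by (apply pow_le; lra).
  apply Rmult_le_compat; [apply pow_le; lra | apply Rabs_pos | apply pow_incr; lra |].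
  apply Hb; lra.
Qed.

Lemma avg_int_bound a (g h : R -> R) (t : R) :
  (forall s, continuous g s) -> (forall s, continuous h s) ->
  (forall s, Rabs s <= Rabs t -> Rabs (g s) <= h (Rabs s)) ->
  Rabs (avg_int a g t) <= RInt h 0 (Rabs t).
Proof.
intros Hg Hh Hb.
destruct (Rle_dec 0 t) as [Ht|Ht].
- rewrite (Rabs_pos_eq t Ht); apply avg_int_bound_pos; try assumption.
  intros s Hs; rewrite <- (Rabs_pos_eq s) at 2 by lra; apply Hb.
  rewrite !Rabs_pos_eq; lra.
- replace t with (- (- t)) at 1 by ring; rewrite avg_int_opp, Rabs_Ropp by assumption.
  rewrite (Rabs_left t) by lra.
  apply avg_int_bound_pos; [lra| |assumption|].
  + intros s; apply (continuous_comp (fun s => - s) g); [apply copp, cid | apply Hg].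
  + intros s Hs; replace (h s) with (h (Rabs (- s))).
    2:{ f_equal; rewrite Rabs_Ropp; apply Rabs_pos_eq; lra. }
    apply Hb; rewrite Rabs_Ropp, (Rabs_pos_eq s), (Rabs_left t); lra.
Qed.

Lemma avg_int_bound_const a (g : R -> R) (B t : R) :
  (forall s, continuous g s) -> (forall s, Rabs (g s) <= B) ->
  Rabs (avg_int a g t) <= B * Rabs t.
Proof.
intros Hg Hb; eapply Rle_trans.
- apply (avg_int_bound a g (fun _ => B)); [assumption | intros; apply cconst | intros; apply Hb].
- rewrite (RInt_const (V := R_CompleteNormedModule)).
  unfold scal; simpl; unfold mult; simpl; lra.
Qed.

Lemma avg_int_bound_exp a (g : R -> R) (e c t : R) : 0 < c -> 0 <= e ->
  (forall s, continuous g s) ->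
  (forall s, Rabs s <= Rabs t -> Rabs (g s) <= e * exp (c * Rabs s)) ->
  Rabs (avg_int a g t) <= e / c * exp (c * Rabs t).
Proof.
intros Hc He Hg Hb.
assert (Hder : forall s, is_derive (fun s => e / c * exp (c * s)) s (e * exp (c * s))).
{ intros s; derive_by; field; lra. }
eapply Rle_trans.
- apply (avg_int_bound a g (fun s => e * exp (c * s))); [assumption| |assumption].
  intros s; apply (is_derive_cont _ _ (e * (c * exp (c * s)))); derive_by; ring.
- rewrite (is_RInt_unique (V := R_CompleteNormedModule) _ _ _
     (minus (e / c * exp (c * Rabs t)) (e / c * exp (c * 0)))).
  + unfold minus, plus, opp; simpl.
    assert (0 <= e / c * exp (c * 0)); [|lra].
    apply Rmult_le_pos; [apply Rdiv_le_0_compat; lra | left; apply exp_pos].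
  + apply (is_RInt_derive (V := R_CompleteNormedModule) (fun s => e / c * exp (c * s))).
    * intros s _; apply Hder.
    * intros s _; apply (is_derive_cont _ _ (e * (c * exp (c * s)))); derive_by; ring.
Qed.

Lemma avg_int_minus a (g1 g2 : R -> R) (t : R) : (forall s, continuous g1 s) -> (forall s, continuous g2 s) ->
  avg_int a g1 t - avg_int a g2 t = avg_int a (fun s => g1 s - g2 s) t.
Proof.
intros H1 H2.
assert (E1 : ex_RInt (fun s => s ^ a * g1 s) 0 t).
{ apply ex_RInt_cont; intros s; apply cmult; [apply cpow, cid | apply H1]. }
assert (E2 : ex_RInt (fun s => s ^ a * g2 s) 0 t).
{ apply ex_RInt_cont; intros s; apply cmult; [apply cpow, cid | apply H2]. }
assert (H : RInt (fun s => s ^ a * (g1 s - g2 s)) 0 t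
            = RInt (fun s => s ^ a * g1 s) 0 t - RInt (fun s => s ^ a * g2 s) 0 t).
{ etransitivity; [|exact (RInt_minus (V := R_CompleteNormedModule) _ _ 0 t E1 E2)].
  apply (RInt_ext (V := R_CompleteNormedModule)); intros x _.
  unfold minus, plus, opp; simpl; ring. }
unfold avg_int; rewrite H; unfold Rdiv; ring.
Qed.

Lemma avg_int_ext a (g1 g2 : R -> R) (t : R) : 0 <= t -> (forall s, 0 <= s <= t -> g1 s = g2 s) ->
  avg_int a g1 t = avg_int a g2 t.
Proof.
intros Ht H; unfold avg_int; f_equal.
apply (RInt_ext (V := R_CompleteNormedModule)); intros x Hx.
rewrite Rmin_left, Rmax_right in Hx by lra; now rewrite H by lra.
Qed.

Lemma RInt_derive_cont (f : R -> R) (t : R) : (forall s, continuous f s) ->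
  is_derive (fun u : R => RInt f 0 u : R) t (f t).
Proof.
intros Hf; apply (is_derive_RInt (V := R_NormedModule) f (fun t => RInt f 0 t) 0); [|apply Hf].
apply filter_forall; intros b.
now apply (RInt_correct (V := R_CompleteNormedModule)), ex_RInt_cont.
Qed.

Lemma avg_int_derive a (g : R -> R) (t : R) : (forall s, continuous g s) -> t <> 0 ->
  is_derive (avg_int a g) t (g t - INR a * avg_int a g t / t).
Proof.
intros Hg Ht.
assert (H := RInt_derive_cont (fun s => s ^ a * g s) t
  (fun s => cmult _ _ s (cpow _ a s (cid s)) (Hg s))).
assert (Hp : t ^ a <> 0) by now apply pow_nonzero.
eapply is_derive_eq; [apply (ddiv (fun t => RInt (fun s => s ^ a * g s) 0 t) (fun t => t ^ a));
  [exact H | apply dpow, did | exact Hp]|].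
unfold avg_int; cbv beta.
destruct a as [|a].
- simpl; field; exact Ht.
- simpl Init.Nat.pred; rewrite <- (tech_pow_Rmult t a).
  assert (t ^ a <> 0) by now apply pow_nonzero.
  field; split; assumption.
Qed.

Lemma avg_int_derive_0 (g : R -> R) (t : R) : (forall s, continuous g s) ->
  is_derive (avg_int 0 g) t (g t).
Proof.
intros Hg.
apply (is_derive_ext (fun t => RInt g 0 t)).
- intros u; unfold avg_int; simpl; rewrite Rdiv_1_r.
  apply (RInt_ext (V := R_CompleteNormedModule)); intros x _; symmetry; apply Rmult_1_l.
- now apply RInt_derive_cont.
Qed.

Lemma avg_int_continuous a (g : R -> R) (B t : R) : (forall s, continuous g s) -> (forall s, Rabs (g s) <= B) ->
  continuous (avg_int a g) t.
Proof.
intros Hg HB.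
destruct (Req_dec t 0) as [->|Ht].
- apply continuous_eps; intros e He.
  assert (HB0 : 0 <= B) by (eapply Rle_trans; [apply Rabs_pos | apply (HB 0)]).
  exists (e / (B + 1)); split; [apply Rdiv_lt_0_compat; lra|]; intros y Hy.
  rewrite avg_int_0, Rminus_0_r; rewrite Rminus_0_r in Hy.
  eapply Rle_lt_trans; [now apply avg_int_bound_const|].
  apply Rlt_div_r in Hy; [|lra].
  assert (0 <= Rabs y) by apply Rabs_pos; nra.
- eapply is_derive_cont, avg_int_derive; assumption.
Qed.

Lemma uniform_delta (n : nat) (P : nat -> R -> Prop) :
  (forall i d d', (i < n)%nat -> P i d -> 0 < d' <= d -> P i d') ->
  (forall i, (i < n)%nat -> exists d, 0 < d /\ P i d) ->
  exists d, 0 < d /\ forall i, (i < n)%nat -> P i d.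
Proof.
intros Hm H.
assert (forall k, (k <= n)%nat -> exists d, 0 < d /\ forall i, (i < k)%nat -> P i d) as Hk.
{ induction k as [|k IH]; intros Hk; [exists 1; split; [lra|lia]|].
  destruct IH as [d [Hd IH]]; [lia|]; destruct (H k ltac:(lia)) as [d' [Hd' Hp]].
  assert (0 < Rmin d d') by (apply Rmin_pos; lra).
  exists (Rmin d d'); split; [assumption|]; intros i Hi.
  destruct (Nat.eq_dec i k) as [->|].
  - apply Hm with d'; [lia|assumption|split; [assumption|apply Rmin_r]].
  - apply Hm with d; [lia|apply IH; lia|split; [assumption|apply Rmin_l]]. }
now apply Hk.
Qed.

Lemma x_le_exp x : x <= exp x.
Proof. generalize (exp_ineq1_le x); lra. Qed.

Section Picard.

Variables (n : nat) (a : nat -> nat) (F : nat -> (nat -> R) -> R) (L B : R).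
Hypothesis L_pos : 0 < L.
Hypothesis F_lipschitz : forall i x y d, (i < n)%nat -> 0 <= d ->
  (forall j, (j < n)%nat -> Rabs (x j - y j) <= d) -> Rabs (F i x - F i y) <= L * d.
Hypothesis F_bounded : forall i x, (i < n)%nat -> Rabs (F i x) <= B.

Definition curve_continuous (x : nat -> R -> R) : Prop :=
  forall i t, (i < n)%nat -> continuous (x i) t.

Definition integral_op (c : nat -> R) (x : nat -> R -> R) (i : nat) (t : R) : R :=
  c i + avg_int (a i) (fun s => F i (fun j => x j s)) t.

Lemma field_along_continuous x i : curve_continuous x -> (i < n)%nat ->
  forall s, continuous (fun s => F i (fun j => x j s)) s.
Proof.
intros Hx Hi s; apply continuous_eps; intros e He.
destruct (uniform_delta n (fun j d => forall y, Rabs (y - s) < d -> Rabs (x j y - x j s) <= e / (2 * L)))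
  as [d [Hd H]].
- intros j d d' _ Hp Hd y Hy; apply Hp; lra.
- intros j Hj; destruct (proj1 (continuous_eps (x j) s) (Hx j s Hj) (e / (2 * L))) as [d [Hd H]].
  { apply Rdiv_lt_0_compat; lra. }
  exists d; split; [assumption|]; intros y Hy; left; now apply H.
- exists d; split; [assumption|]; intros y Hy.
  apply Rle_lt_trans with (L * (e / (2 * L))).
  + apply F_lipschitz; [assumption|apply Rdiv_le_0_compat; lra|].
    intros j Hj; apply H; assumption.
  + replace (L * (e / (2 * L))) with (e / 2) by (field; lra); lra.
Qed.

Lemma integral_op_continuous c x : curve_continuous x -> curve_continuous (integral_op c x).
Proof.
intros Hx i t Hi; unfold integral_op; apply cplus; [apply cconst|].
apply avg_int_continuous with B; [now apply field_along_continuous|].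
intros; now apply F_bounded.
Qed.

(** The exponential weight makes the integral operator a contraction of
    factor one half on arbitrarily long time intervals. *)
Lemma integral_op_contracts c c' x y d e i t : (i < n)%nat -> 0 <= e ->
  curve_continuous x -> curve_continuous y ->
  Rabs (c i - c' i) <= d ->
  (forall j s, (j < n)%nat -> Rabs s <= Rabs t -> Rabs (x j s - y j s) <= e * exp (2 * L * Rabs s)) ->
  Rabs (integral_op c x i t - integral_op c' y i t) <= d + e / 2 * exp (2 * L * Rabs t).
Proof.
intros Hi He Hx Hy Hc H; unfold integral_op.
match goal with |- Rabs ?l <= _ => replace l with ((c i - c' i) +
  (avg_int (a i) (fun s => F i (fun j => x j s)) t - avg_int (a i) (fun s => F i (fun j => y j s)) t)) by ring end.
eapply Rle_trans; [apply Rabs_triang|]; apply Rplus_le_compat; [assumption|].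
rewrite avg_int_minus by (now apply field_along_continuous).
replace (e / 2) with (L * e / (2 * L)) by (field; lra).
apply avg_int_bound_exp; [lra|nra| |].
- intros s; apply cminus; now apply field_along_continuous.
- intros s Hs; rewrite Rmult_assoc; apply F_lipschitz; [assumption| |].
  + apply Rmult_le_pos; [assumption|left; apply exp_pos].
  + intros j Hj; now apply H.
Qed.

Lemma integral_op_near_start c x i t : (i < n)%nat -> curve_continuous x ->
  Rabs (integral_op c x i t - c i) <= B * Rabs t.
Proof.
intros Hi Hx; unfold integral_op.
match goal with |- Rabs ?l <= _ => replace l with (avg_int (a i) (fun s => F i (fun j => x j s)) t) by ring end.
apply avg_int_bound_const; [now apply field_along_continuous|].
intros; now apply F_bounded.
Qed.

Fixpoint picard_iter (c : nat -> R) (k : nat) : nat -> R -> R :=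
  match k with
  | O => fun i _ => c i
  | S k => integral_op c (picard_iter c k)
  end.

Lemma picard_iter_continuous c k : curve_continuous (picard_iter c k).
Proof.
induction k as [|k IH]; [intros i t _; apply cconst | now apply integral_op_continuous].
Qed.

Lemma linear_le_weight t : 0 <= B -> B * Rabs t <= B / (2 * L) * exp (2 * L * Rabs t).
Proof.
intros HB; assert (H := x_le_exp (2 * L * Rabs t)).
replace (B * Rabs t) with (B / (2 * L) * (2 * L * Rabs t)) by (field; lra).
apply Rmult_le_compat_l; [apply Rdiv_le_0_compat; lra|assumption].
Qed.

Lemma field_bound_nonneg i : (i < n)%nat -> 0 <= B.
Proof. intros Hi; eapply Rle_trans; [apply Rabs_pos | apply (F_bounded i (fun _ => 0) Hi)]. Qed.

Lemma picard_iter_attracts c x T k i t : (i < n)%nat -> curve_continuous x ->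
  Rabs t <= T ->
  (forall j s, (j < n)%nat -> Rabs s <= T ->
     Rabs (x j s - picard_iter c k j s) <= B / (2 * L) * (/ 2) ^ k * exp (2 * L * Rabs s)) ->
  Rabs (integral_op c x i t - picard_iter c (S k) i t) <= B / (2 * L) * (/ 2) ^ S k * exp (2 * L * Rabs t).
Proof.
intros Hi Hx Ht IH; assert (HB := field_bound_nonneg i Hi).
eapply Rle_trans.
- simpl; apply (integral_op_contracts c c x (picard_iter c k) 0 (B / (2 * L) * (/ 2) ^ k));
    try assumption.
  + apply Rmult_le_pos; [apply Rdiv_le_0_compat; lra | apply pow_le; lra].
  + apply picard_iter_continuous.
  + rewrite Rminus_diag, Rabs_R0; lra.
  + intros j s Hj Hs; apply IH; [assumption | lra].
- simpl; right; field; lra.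
Qed.

Lemma picard_iter_cauchy c m k i t : (i < n)%nat ->
  Rabs (picard_iter c (k + m) i t - picard_iter c k i t) <= B / (2 * L) * (/ 2) ^ k * exp (2 * L * Rabs t).
Proof.
revert i t; induction k as [|k IH]; intros i t Hi.
- assert (HB := field_bound_nonneg i Hi).
  simpl; rewrite Rmult_1_r; eapply Rle_trans; [|now apply linear_le_weight].
  destruct m as [|m]; simpl.
  + rewrite Rminus_diag, Rabs_R0; apply Rmult_le_pos; [assumption|apply Rabs_pos].
  + apply integral_op_near_start; [assumption | apply picard_iter_continuous].
- apply (picard_iter_attracts c (picard_iter c (k + m)) (Rabs t)); [assumption| |lra|].
  + apply picard_iter_continuous.
  + intros; now apply IH.
Qed.

Definition flow (c : nat -> R) (i : nat) (t : R) : R :=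
  real (Lim_seq (fun k => picard_iter c k i t)).

Lemma geom_small C e : 0 < e -> exists k, C * (/ 2) ^ k < e.
Proof.
intros He.
assert (H : is_lim_seq (fun k => C * (/ 2) ^ k) (C * 0)).
{ apply (is_lim_seq_scal_l (fun k => (/ 2) ^ k) C 0), is_lim_seq_geom.
  rewrite Rabs_pos_eq; lra. }
apply is_lim_seq_spec in H; destruct (H (mkposreal e He)) as [N HN].
exists N; specialize (HN N (Nat.le_refl N)); simpl in HN.
apply Rabs_def2 in HN; lra.
Qed.

Lemma picard_iter_converges c i t : (i < n)%nat ->
  is_lim_seq (fun k => picard_iter c k i t) (flow c i t).
Proof.
intros Hi; apply Lim_seq_correct', ex_lim_seq_cauchy_corr; intros e.
destruct (geom_small (2 * (B / (2 * L) * exp (2 * L * Rabs t))) e (cond_pos e)) as [k Hk].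
exists k; intros p q Hp Hq.
assert (H1 := picard_iter_cauchy c (p - k) k i t Hi).
assert (H2 := picard_iter_cauchy c (q - k) k i t Hi).
replace (k + (p - k))%nat with p in H1 by lia.
replace (k + (q - k))%nat with q in H2 by lia.
eapply Rle_lt_trans; [|exact Hk].
replace (picard_iter c p i t - picard_iter c q i t) with
  ((picard_iter c p i t - picard_iter c k i t) - (picard_iter c q i t - picard_iter c k i t)) by ring.
eapply Rle_trans; [apply Rabs_triang|]; rewrite Rabs_Ropp; lra.
Qed.

Lemma lim_dist_le (u : nat -> R) (l x e : R) : is_lim_seq u l ->
  (exists N, forall m, (N <= m)%nat -> Rabs (u m - x) <= e) -> Rabs (l - x) <= e.
Proof.
intros Hu [N H].
apply (is_lim_seq_incr_n u N) in Hu.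
assert (H1 : Rbar_le (Rabs (l - x)) e); [|exact H1].
apply (is_lim_seq_le (fun m => Rabs (u (m + N)%nat - x)) (fun _ => e)).
- intros m; apply H; lia.
- apply (is_lim_seq_abs (fun m => u (m + N)%nat - x) (l - x)).
  exact (is_lim_seq_minus' (fun m => u (m + N)%nat) (fun _ => x) l x Hu (is_lim_seq_const x)).
- apply is_lim_seq_const.
Qed.

Lemma flow_approx c k i t : (i < n)%nat ->
  Rabs (flow c i t - picard_iter c k i t) <= B / (2 * L) * (/ 2) ^ k * exp (2 * L * Rabs t).
Proof.
intros Hi; apply lim_dist_le with (fun m => picard_iter c m i t); [now apply picard_iter_converges|].
exists k; intros m Hm; replace m with (k + (m - k))%nat by lia; now apply picard_iter_cauchy.
Qed.

Lemma flow_continuous c : curve_continuous (flow c).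
Proof.
intros i t Hi; apply continuous_eps; intros e He.
destruct (geom_small (B / (2 * L) * exp (2 * L * (Rabs t + 1))) (e / 3)) as [k Hk]; [lra|].
destruct (proj1 (continuous_eps _ t) (picard_iter_continuous c k i t Hi) (e / 3)) as [d [Hd H]]; [lra|].
assert (HB := field_bound_nonneg i Hi).
assert (Hc : forall s, Rabs s <= Rabs t + 1 -> Rabs (flow c i s - picard_iter c k i s) < e / 3).
{ intros s Hs; eapply Rle_lt_trans; [now apply flow_approx|eapply Rle_lt_trans; [|exact Hk]].
  rewrite !Rmult_assoc; apply Rmult_le_compat_l; [apply Rdiv_le_0_compat; lra|].
  rewrite Rmult_comm; apply Rmult_le_compat_r; [apply pow_le; lra|].
  apply exp_mono; nra. }
exists (Rmin d 1); split; [apply Rmin_pos; lra|]; intros y Hy.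
assert (Hm1 := Rmin_l d 1); assert (Hm2 := Rmin_r d 1).
assert (H1 := Hc t ltac:(lra)).
assert (H2 : Rabs (flow c i y - picard_iter c k i y) < e / 3).
{ apply Hc; generalize (Rabs_triang_inv y t); lra. }
specialize (H y ltac:(lra)).
apply Rabs_def2 in H1, H2, H; apply Rabs_def1; lra.
Qed.

Lemma flow_fixed c i t : (i < n)%nat -> flow c i t = integral_op c (flow c) i t.
Proof.
intros Hi; apply Rminus_diag_uniq.
destruct (Req_dec (flow c i t - integral_op c (flow c) i t) 0) as [|Hne]; [assumption|exfalso].
assert (Hp := Rabs_pos_lt _ Hne).
destruct (geom_small (2 * (B / (2 * L) * exp (2 * L * Rabs t))) _ Hp) as [k Hk].
assert (HB := field_bound_nonneg i Hi).
assert (H1 := flow_approx c (S k) i t Hi).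
assert (H2 : Rabs (integral_op c (flow c) i t - picard_iter c (S k) i t)
             <= B / (2 * L) * (/ 2) ^ S k * exp (2 * L * Rabs t)).
{ apply picard_iter_attracts with (Rabs t); [assumption | apply flow_continuous | lra |].
  intros; now apply flow_approx. }
assert (H3 : 0 <= B / (2 * L) * (/ 2) ^ k * exp (2 * L * Rabs t)).
{ repeat apply Rmult_le_pos; try (left; apply exp_pos); try (apply pow_le; lra);
  try lra; left; apply Rinv_0_lt_compat; lra. }
simpl pow in H1, H2.
replace (flow c i t - integral_op c (flow c) i t) with
 ((flow c i t - picard_iter c (S k) i t) - (integral_op c (flow c) i t - picard_iter c (S k) i t)) in Hk by ring.
assert (H4 := Rabs_triang (flow c i t - picard_iter c (S k) i t)
               (- (integral_op c (flow c) i t - picard_iter c (S k) i t))).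
rewrite Rabs_Ropp in H4; unfold Rminus at 1 in Hk; lra.
Qed.

(** A fixed point on a shorter interval is within the Picard error of every
    iterate, hence of their limit. *)
Lemma flow_unique c x T : curve_continuous x ->
  (forall i t, (i < n)%nat -> 0 <= t <= T -> x i t = integral_op c x i t) ->
  forall i t, (i < n)%nat -> 0 <= t <= T -> x i t = flow c i t.
Proof.
intros Hx Heq i t Hi Ht.
assert (Hk : forall k i t, (i < n)%nat -> 0 <= t <= T ->
  Rabs (x i t - picard_iter c k i t) <= B / (2 * L) * (/ 2) ^ k * exp (2 * L * Rabs t)).
{ clear i t Hi Ht; induction k as [|k IH]; intros i t Hi Ht.
  - simpl; rewrite Rmult_1_r, Heq by assumption.
    eapply Rle_trans; [now apply integral_op_near_start|].
    now apply linear_le_weight, field_bound_nonneg with i.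
  - assert (HB := field_bound_nonneg i Hi).
    rewrite Heq by assumption; simpl picard_iter; unfold integral_op.
    match goal with |- Rabs ?l <= _ => replace l with (avg_int (a i) (fun s => F i (fun j => x j s)) t -
      avg_int (a i) (fun s => F i (fun j => picard_iter c k j s)) t) by ring end.
    rewrite avg_int_minus by (apply field_along_continuous; try assumption; apply picard_iter_continuous).
    replace (B / (2 * L) * (/ 2) ^ S k) with (L * (B / (2 * L) * (/ 2) ^ k) / (2 * L))
      by (simpl; field; lra).
    assert (He : 0 <= B / (2 * L) * (/ 2) ^ k).
    { apply Rmult_le_pos; [apply Rdiv_le_0_compat; lra | apply pow_le; lra]. }
    replace (L * (B / (2 * L) * (/ 2) ^ k) / (2 * L) * exp (2 * L * Rabs t)) with
     (L * (B / (2 * L) * (/ 2) ^ k) / (2 * L) * exp (2 * L * t)) by (rewrite (Rabs_pos_eq t) by lra; reflexivity).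
    set (e := B / (2 * L) * (/ 2) ^ k) in *.
    eapply Rle_trans; [apply (avg_int_bound_pos _ _ (fun s => L * e * exp (2 * L * s))); [lra| | |]|].
    + intros s; apply cminus; apply field_along_continuous; try assumption; apply picard_iter_continuous.
    + intros s; apply (is_derive_cont _ _ (L * e * (2 * L * exp (2 * L * s)))); derive_by; ring.
    + intros s Hs; rewrite Rmult_assoc; apply F_lipschitz; [assumption| |].
      * apply Rmult_le_pos; [assumption | left; apply exp_pos].
      * intros j Hj; rewrite <- (Rabs_pos_eq s) at 3 by lra; apply IH; [assumption|lra].
    + rewrite (is_RInt_unique (V := R_CompleteNormedModule) _ _ _
        (minus (L * e / (2 * L) * exp (2 * L * t)) (L * e / (2 * L) * exp (2 * L * 0)))).
      * unfold minus, plus, opp; simpl.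
        assert (0 <= L * e / (2 * L) * exp (2 * L * 0)); [|lra].
        apply Rmult_le_pos; [apply Rdiv_le_0_compat; nra | left; apply exp_pos].
      * apply (is_RInt_derive (V := R_CompleteNormedModule) (fun s => L * e / (2 * L) * exp (2 * L * s))).
        -- intros s _; derive_by; field; lra.
        -- intros s _; apply (is_derive_cont _ _ (L * e * (2 * L * exp (2 * L * s)))); derive_by; ring. }
apply Rminus_diag_uniq.
destruct (Req_dec (x i t - flow c i t) 0) as [|Hne]; [assumption|exfalso].
assert (Hp := Rabs_pos_lt _ Hne).
destruct (geom_small (2 * (B / (2 * L) * exp (2 * L * Rabs t))) _ Hp) as [k Hk'].
assert (H1 := Hk k i t Hi Ht); assert (H2 := flow_approx c k i t Hi).
replace (x i t - flow c i t) with
 ((x i t - picard_iter c k i t) - (flow c i t - picard_iter c k i t)) in Hk' by ring.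
assert (H4 := Rabs_triang (x i t - picard_iter c k i t) (- (flow c i t - picard_iter c k i t))).
rewrite Rabs_Ropp in H4; unfold Rminus at 1 in Hk'; lra.
Qed.

Lemma flow_dependence c c' d i t : (i < n)%nat -> 0 <= d ->
  (forall j, (j < n)%nat -> Rabs (c j - c' j) <= d) ->
  Rabs (flow c i t - flow c' i t) <= 2 * d * exp (2 * L * Rabs t).
Proof.
intros Hi Hd Hc.
assert (Hk : forall k j s, (j < n)%nat ->
  Rabs (picard_iter c k j s - picard_iter c' k j s) <= 2 * d * exp (2 * L * Rabs s)).
{ assert (He : forall s, 1 <= exp (2 * L * Rabs s)).
  { intros s; rewrite <- exp_0; apply exp_mono; generalize (Rabs_pos s); nra. }
  induction k as [|k IH]; intros j s Hj.
  - simpl; specialize (Hc j Hj); specialize (He s); nra.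
  - simpl; eapply Rle_trans.
    + apply (integral_op_contracts c c' _ _ d (2 * d)); try assumption; try lra.
      * apply picard_iter_continuous.
      * apply picard_iter_continuous.
      * now apply Hc.
      * intros; now apply IH.
    + specialize (He s); nra. }
assert (Hl := is_lim_seq_minus' _ _ _ _ (picard_iter_converges c i t Hi) (picard_iter_converges c' i t Hi)).
rewrite <- (Rminus_0_r (flow c i t - flow c' i t)).
apply lim_dist_le with (1 := Hl); exists 0%nat; intros m _.
rewrite Rminus_0_r; now apply Hk.
Qed.

Lemma flow_near_start c i t : (i < n)%nat -> Rabs (flow c i t - c i) <= B * Rabs t.
Proof.
intros Hi; rewrite flow_fixed by assumption; apply integral_op_near_start;
  [assumption | apply flow_continuous].
Qed.

Lemma flow_0 c i : (i < n)%nat -> flow c i 0 = c i.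
Proof. intros Hi; rewrite flow_fixed by assumption; unfold integral_op; rewrite avg_int_0; ring. Qed.

Lemma flow_derive c i t : (i < n)%nat -> t <> 0 ->
  is_derive (flow c i) t
    (F i (fun j => flow c j t) - INR (a i) * (flow c i t - c i) / t).
Proof.
intros Hi Ht.
apply (is_derive_ext (fun t => c i + avg_int (a i) (fun s => F i (fun j => flow c j s)) t)).
{ intros s; symmetry; now apply flow_fixed. }
assert (H := avg_int_derive (a i) (fun s => F i (fun j => flow c j s)) t
               (field_along_continuous (flow c) i (flow_continuous c) Hi) Ht).
cbv beta in H; derive_by.
rewrite (flow_fixed c i t) by assumption; unfold integral_op; field; exact Ht.
Qed.

Lemma flow_derive_regular c i t : (i < n)%nat -> a i = O ->
  is_derive (flow c i) t (F i (fun j => flow c j t)).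
Proof.
intros Hi Ha.
apply (is_derive_ext (fun t => c i + avg_int 0 (fun s => F i (fun j => flow c j s)) t)).
{ intros s; symmetry; rewrite flow_fixed by assumption; unfold integral_op; now rewrite Ha. }
assert (H := avg_int_derive_0 (fun s => F i (fun j => flow c j s)) t
               (field_along_continuous (flow c) i (flow_continuous c) Hi)).
cbv beta in H; derive_by; ring.
Qed.

End Picard.

(** * Truncation of locally Lipschitz fields *)

Definition clamp (M x : R) : R := Rmax (- M) (Rmin M x).

Lemma clamp_bound M x : 0 <= M -> Rabs (clamp M x) <= M.
Proof.
intros HM; unfold clamp; apply Rabs_le; split; [apply Rmax_l|].
apply Rmax_lub; [lra | apply Rmin_l].
Qed.

Lemma clamp_id M x : Rabs x <= M -> clamp M x = x.
Proof.
intros H; apply Rabs_le_between in H; unfold clamp.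
rewrite Rmin_right by lra; apply Rmax_right; lra.
Qed.

Lemma clamp_lipschitz M x y : 0 <= M -> Rabs (clamp M x - clamp M y) <= Rabs (x - y).
Proof.
intros HM; unfold clamp, Rmax, Rmin.
repeat destruct Rle_dec; unfold Rabs; repeat destruct Rcase_abs; lra.
Qed.

(** The bound [B] is part of the notion because it makes the class closed under
    products. *)
Definition box_lipschitz (n : nat) (M : R) (f : (nat -> R) -> R) : Prop :=
  exists L B, 0 <= L /\ 0 <= B /\ forall x y d, 0 <= d ->
    (forall j, (j < n)%nat -> Rabs (x j) <= M /\ Rabs (y j) <= M /\ Rabs (x j - y j) <= d) ->
    Rabs (f x - f y) <= L * d /\ Rabs (f x) <= B /\ Rabs (f y) <= B.

Lemma box_lipschitz_const n M c : box_lipschitz n M (fun _ => c).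
Proof.
exists 0, (Rabs c); split; [lra|split; [apply Rabs_pos|]]; intros.
rewrite Rminus_diag, Rabs_R0; lra.
Qed.

Lemma box_lipschitz_proj n M j : 0 <= M -> (j < n)%nat -> box_lipschitz n M (fun x => x j).
Proof.
intros HM Hj; exists 1, M; split; [lra|split; [assumption|]]; intros x y d Hd H.
destruct (H j Hj) as [H1 [H2 H3]]; lra.
Qed.

Lemma box_lipschitz_plus n M f g : box_lipschitz n M f -> box_lipschitz n M g ->
  box_lipschitz n M (fun x => f x + g x).
Proof.
intros [L1 [B1 [HL1 [HB1 H1]]]] [L2 [B2 [HL2 [HB2 H2]]]].
exists (L1 + L2), (B1 + B2); split; [lra|split; [lra|]]; intros x y d Hd H.
destruct (H1 x y d Hd H) as [E1 [E2 E3]]; destruct (H2 x y d Hd H) as [G1 [G2 G3]].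
repeat split.
- replace (f x + g x - (f y + g y)) with ((f x - f y) + (g x - g y)) by ring.
  eapply Rle_trans; [apply Rabs_triang|lra].
- eapply Rle_trans; [apply Rabs_triang|lra].
- eapply Rle_trans; [apply Rabs_triang|lra].
Qed.

Lemma box_lipschitz_mult n M f g : box_lipschitz n M f -> box_lipschitz n M g ->
  box_lipschitz n M (fun x => f x * g x).
Proof.
intros [L1 [B1 [HL1 [HB1 H1]]]] [L2 [B2 [HL2 [HB2 H2]]]].
exists (L1 * B2 + B1 * L2), (B1 * B2); split; [nra|split; [nra|]]; intros x y d Hd H.
destruct (H1 x y d Hd H) as [E1 [E2 E3]]; destruct (H2 x y d Hd H) as [G1 [G2 G3]].
assert (P1 := Rabs_pos (f x - f y)); assert (P2 := Rabs_pos (f x)); assert (P3 := Rabs_pos (f y)).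
assert (P4 := Rabs_pos (g x - g y)); assert (P5 := Rabs_pos (g x)); assert (P6 := Rabs_pos (g y)).
repeat split.
- replace (f x * g x - f y * g y) with ((f x - f y) * g x + f y * (g x - g y)) by ring.
  eapply Rle_trans; [apply Rabs_triang|]; rewrite !Rabs_mult.
  assert (Rabs (f x - f y) * Rabs (g x) <= L1 * d * B2) by (apply Rmult_le_compat; lra).
  assert (Rabs (f y) * Rabs (g x - g y) <= B1 * (L2 * d)) by (apply Rmult_le_compat; lra).
  lra.
- rewrite Rabs_mult; apply Rmult_le_compat; lra.
- rewrite Rabs_mult; apply Rmult_le_compat; lra.
Qed.

Lemma box_lipschitz_opp n M f : box_lipschitz n M f -> box_lipschitz n M (fun x => - f x).
Proof.
intros [L1 [B1 [HL1 [HB1 H1]]]].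
exists L1, B1; split; [lra|split; [lra|]]; intros x y d Hd H.
destruct (H1 x y d Hd H) as [E1 [E2 E3]].
rewrite !Rabs_Ropp; replace (- f x - - f y) with (- (f x - f y)) by ring.
rewrite Rabs_Ropp; lra.
Qed.

Lemma box_lipschitz_minus n M f g : box_lipschitz n M f -> box_lipschitz n M g ->
  box_lipschitz n M (fun x => f x - g x).
Proof. intros Hf Hg; apply box_lipschitz_plus; [exact Hf | now apply box_lipschitz_opp]. Qed.

Lemma box_lipschitz_pow n M f k : box_lipschitz n M f -> box_lipschitz n M (fun x => f x ^ k).
Proof.
intros Hf; induction k as [|k IH]; [exact (box_lipschitz_const n M 1) | exact (box_lipschitz_mult n M _ _ Hf IH)].
Qed.

Lemma box_lipschitz_inv n M f : box_lipschitz n M f ->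
  box_lipschitz n M (fun x => / Rmax (/ 2) (f x)).
Proof.
intros [L1 [B1 [HL1 [HB1 H1]]]].
exists (4 * L1), 2; split; [lra|split; [lra|]]; intros x y d Hd H.
destruct (H1 x y d Hd H) as [E1 _].
assert (Hx := Rmax_l (/ 2) (f x)); assert (Hy := Rmax_l (/ 2) (f y)).
assert (E : Rabs (Rmax (/ 2) (f y) - Rmax (/ 2) (f x)) <= L1 * d).
{ eapply Rle_trans; [|exact E1]; unfold Rmax; repeat destruct Rle_dec;
  unfold Rabs; repeat destruct Rcase_abs; lra. }
set (u := Rmax (/ 2) (f x)) in *; set (v := Rmax (/ 2) (f y)) in *.
assert (Hi : forall z, / 2 <= z -> 0 < / z <= 2).
{ intros z Hz; split; [apply Rinv_0_lt_compat; lra|].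
  rewrite <- (Rinv_inv 2); apply Rinv_le_contravar; lra. }
destruct (Hi u Hx) as [U1 U2]; destruct (Hi v Hy) as [V1 V2].
repeat split.
- replace (/ u - / v) with ((v - u) * (/ u * / v)) by (field; lra).
  rewrite Rabs_mult, (Rabs_pos_eq (/ u * / v)) by nra.
  assert (0 <= / u * / v <= 4) by nra.
  assert (P := Rabs_pos (v - u)).
  assert (Rabs (v - u) * (/ u * / v) <= L1 * d * 4) by (apply Rmult_le_compat; lra).
  lra.
- rewrite Rabs_pos_eq; lra.
- rewrite Rabs_pos_eq; lra.
Qed.

Ltac box_auto :=
  match goal with
  | |- box_lipschitz _ _ (fun _ => ?c) => apply (box_lipschitz_const _ _ c)
  | |- box_lipschitz _ _ (fun x => x ?j) => apply box_lipschitz_proj; [lra|lia]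
  | |- box_lipschitz _ _ (fun x => @?f x + @?g x) => apply (box_lipschitz_plus _ _ f g); box_auto
  | |- box_lipschitz _ _ (fun x => @?f x - @?g x) => apply (box_lipschitz_minus _ _ f g); box_auto
  | |- box_lipschitz _ _ (fun x => @?f x * @?g x) => apply (box_lipschitz_mult _ _ f g); box_auto
  | |- box_lipschitz _ _ (fun x => - @?f x) => apply (box_lipschitz_opp _ _ f); box_auto
  | |- box_lipschitz _ _ (fun x => @?f x ^ ?k) => apply (box_lipschitz_pow _ _ f k); box_auto
  | |- box_lipschitz _ _ (fun x => / Rmax (/ 2) (@?f x)) => apply (box_lipschitz_inv _ _ f); box_auto
  | |- box_lipschitz _ _ (fun x => @?f x / Rmax (/ 2) (@?g x)) =>
      apply (box_lipschitz_mult _ _ f (fun x => / Rmax (/ 2) (g x)));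
      [ | apply (box_lipschitz_inv _ _ g)]; box_auto
  | |- box_lipschitz _ _ (fun x => @?f x / ?c) =>
      apply (box_lipschitz_mult _ _ f (fun _ => / c)); box_auto
  end.

(** A family of curves that solve the system with field [F], regularized at
    time [0] by the exponents [a], as long as they stay in the box of size [M].
    The last two clauses are Lipschitz dependence on the initial data and
    uniqueness, the latter in terms of the integral equation. *)
Definition truncated_solution (n : nat) (a : nat -> nat) (F : nat -> (nat -> R) -> R) (M : R)
  (Y : (nat -> R) -> nat -> R -> R) (L B : R) : Prop :=
  (forall c i (t : R), (i < n)%nat -> continuous (Y c i) t) /\
  (forall c i, (i < n)%nat -> Y c i 0 = c i) /\
  (forall c i (t : R), (i < n)%nat -> Rabs (Y c i t - c i) <= B * Rabs t) /\
  (forall c i (t : R), (i < n)%nat -> t <> 0 -> (forall j, (j < n)%nat -> Rabs (Y c j t) <= M) ->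
     is_derive (Y c i) t (F i (fun j => Y c j t) - INR (a i) * (Y c i t - c i) / t)) /\
  (forall c i (t : R), (i < n)%nat -> a i = O -> (forall j, (j < n)%nat -> Rabs (Y c j t) <= M) ->
     is_derive (Y c i) t (F i (fun j => Y c j t))) /\
  (forall c c' d i t, (i < n)%nat -> 0 <= d ->
     (forall j, (j < n)%nat -> Rabs (c j - c' j) <= d) ->
     Rabs (Y c i t - Y c' i t) <= 2 * d * exp (2 * L * Rabs t)) /\
  (forall c (x : nat -> R -> R) (T : R), (forall i t, (i < n)%nat -> continuous (x i) t) ->
     (forall i t, (i < n)%nat -> 0 <= t <= T -> Rabs (x i t) <= M) ->
     (forall i t, (i < n)%nat -> 0 <= t <= T ->
        x i t = c i + avg_int (a i) (fun s => F i (fun j => x j s)) t) ->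
     forall i t, (i < n)%nat -> 0 <= t <= T -> x i t = Y c i t).

Lemma truncated_solution_exists n a F M : 0 <= M ->
  (forall i, (i < n)%nat -> box_lipschitz n M (F i)) ->
  exists Y L B, 0 < L /\ 0 <= B /\ truncated_solution n a F M Y L B.
Proof.
intros HM HF.
assert (HU : exists L B, 0 <= L /\ 0 <= B /\ forall i, (i < n)%nat -> forall x y d, 0 <= d ->
    (forall j, (j < n)%nat -> Rabs (x j) <= M /\ Rabs (y j) <= M /\ Rabs (x j - y j) <= d) ->
    Rabs (F i x - F i y) <= L * d /\ Rabs (F i x) <= B).
{ assert (Hk : forall k, (k <= n)%nat -> exists L B, 0 <= L /\ 0 <= B /\
    forall i, (i < k)%nat -> forall x y d, 0 <= d ->
    (forall j, (j < n)%nat -> Rabs (x j) <= M /\ Rabs (y j) <= M /\ Rabs (x j - y j) <= d) ->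
    Rabs (F i x - F i y) <= L * d /\ Rabs (F i x) <= B).
  { induction k as [|k IH]; intros Hk; [exists 0, 0; repeat split; try lra; lia|].
    destruct IH as [L1 [B1 [HL1 [HB1 H1]]]]; [lia|].
    destruct (HF k ltac:(lia)) as [L2 [B2 [HL2 [HB2 H2]]]].
    exists (L1 + L2), (B1 + B2); split; [lra|split; [lra|]]; intros i Hi x y d Hd H.
    destruct (Nat.eq_dec i k) as [->|].
    - destruct (H2 x y d Hd H) as [E1 [E2 _]]; nra.
    - destruct (H1 i ltac:(lia) x y d Hd H); nra. }
  now apply Hk. }
destruct HU as [L0 [B [HL0 [HB HU]]]].
pose (G := fun i (x : nat -> R) => F i (fun j => clamp M (x j))).
assert (HL : 0 < L0 + 1) by lra.
assert (GL : forall i x y d, (i < n)%nat -> 0 <= d ->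
  (forall j, (j < n)%nat -> Rabs (x j - y j) <= d) -> Rabs (G i x - G i y) <= (L0 + 1) * d).
{ intros i x y d Hi Hd H; unfold G.
  destruct (HU i Hi (fun j => clamp M (x j)) (fun j => clamp M (y j)) d Hd) as [E _]; [|nra].
  intros j Hj; repeat split; try (now apply clamp_bound).
  eapply Rle_trans; [now apply clamp_lipschitz | now apply H]. }
assert (GB : forall i x, (i < n)%nat -> Rabs (G i x) <= B).
{ intros i x Hi; unfold G.
  apply (HU i Hi (fun j => clamp M (x j)) (fun j => clamp M (x j)) 0); [lra|].
  intros j Hj; repeat split; try (now apply clamp_bound).
  rewrite Rminus_diag, Rabs_R0; lra. }
assert (GF : forall i x, (i < n)%nat -> (forall j, (j < n)%nat -> Rabs (x j) <= M) -> G i x = F i x).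
{ intros i x Hi Hx; unfold G; apply Rminus_diag_uniq.
  destruct (HU i Hi (fun j => clamp M (x j)) x 0) as [E _]; [lra| |].
  - intros j Hj; rewrite clamp_id by now apply Hx.
    rewrite Rminus_diag, Rabs_R0; repeat split; try (now apply Hx); lra.
  - rewrite Rmult_0_r in E; generalize (Rabs_pos (F i (fun j => clamp M (x j)) - F i x)); intros P.
    destruct (Req_dec (F i (fun j => clamp M (x j)) - F i x) 0) as [|Hne]; [assumption|].
    apply Rabs_pos_lt in Hne; lra. }
exists (flow a G), (L0 + 1), B; split; [assumption|split; [assumption|]].
refine (conj _ (conj _ (conj _ (conj _ (conj _ (conj _ _)))))).
- intros; now apply (flow_continuous n a G (L0 + 1) B).
- intros; now apply (flow_0 n a G (L0 + 1) B).
- intros; now apply (flow_near_start n a G (L0 + 1) B).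
- intros c i t Hi Ht Hb; rewrite <- GF by assumption.
  now apply (flow_derive n a G (L0 + 1) B).
- intros c i t Hi Ha Hb; rewrite <- GF by assumption.
  now apply (flow_derive_regular n a G (L0 + 1) B).
- intros; now apply (flow_dependence n a G (L0 + 1) B).
- intros c x T Hx Hb Heq i t Hi Ht.
  apply (flow_unique n a G (L0 + 1) B HL GL GB c x T); try assumption.
  intros i' t' Hi' Ht'; unfold integral_op; rewrite Heq by assumption; f_equal.
  apply avg_int_ext; [lra|]; intros s Hs; symmetry; apply GF; [assumption|].
  intros j Hj; apply Hb; [assumption|lra].
Qed.

(** * Regular solutions near the origin *)

(** Coordinates in which the origin is a diagonal regular singular point:
    [w = 1 + r^2 v], [w' = r z], [A = 1 + r^2 a] with [q = z + v],
    [r p = z - 2 v] and [b = a + 4/9 q^2]. *)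
Definition v_of (r q p : R) : R := (q - r * p) / 3.
Definition z_of (r q p : R) : R := (2 * q + r * p) / 3.
Definition a_of (q b : R) : R := b - 4 / 9 * q ^ 2.

Definition k_num (r v z a : R) : R :=
  z * (a + (v * (2 + r ^ 2 * v)) ^ 2) + 3 * v ^ 2 + r ^ 2 * v ^ 3 - 2 * v * a.
Definition b_rhs (r q p v z a k : R) : R :=
  r * (8 / 9 * q * k - 2 / 3 * p ^ 2 - 2 * a * z ^ 2 - 4 * v ^ 3 - r ^ 2 * v ^ 4).

(** The system reads [q' = r k], [p' + 4 p / r = k], [b' + 3 b / r = g]. *)
Definition k_of (r q p b : R) : R :=
  k_num r (v_of r q p) (z_of r q p) (a_of q b) / (1 + r ^ 2 * a_of q b).
Definition g_of (r q p b : R) : R :=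
  b_rhs r q p (v_of r q p) (z_of r q p) (a_of q b) (k_of r q p b).

(** The denominator [A] is truncated at 1/2 to make the field globally defined. *)
Definition k_cut (r q p b : R) : R :=
  k_num r (v_of r q p) (z_of r q p) (a_of q b) / Rmax (/ 2) (1 + r ^ 2 * a_of q b).

(** Component 0 is the radius itself, which makes the system autonomous. *)
Definition local_field (i : nat) (x : nat -> R) : R :=
  match i with
  | O => 1
  | 1%nat => x 0%nat * k_cut (x 0%nat) (x 1%nat) (x 2%nat) (x 3%nat)
  | 2%nat => k_cut (x 0%nat) (x 1%nat) (x 2%nat) (x 3%nat)
  | _ => b_rhs (x 0%nat) (x 1%nat) (x 2%nat)
           (v_of (x 0%nat) (x 1%nat) (x 2%nat)) (z_of (x 0%nat) (x 1%nat) (x 2%nat))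
           (a_of (x 1%nat) (x 3%nat)) (k_cut (x 0%nat) (x 1%nat) (x 2%nat) (x 3%nat))
  end.

Definition local_exponent (i : nat) : nat :=
  match i with 2%nat => 4 | 3%nat => 3 | _ => 0 end%nat.

Lemma local_field_lipschitz M i : 0 <= M -> (i < 4)%nat -> box_lipschitz 4 M (local_field i).
Proof.
intros HM Hi.
destruct i as [|[|[|[|i]]]]; [| | | |lia]; unfold local_field, b_rhs, k_cut, k_num, v_of, z_of, a_of;
  box_auto.
Qed.

Record local_solution (lam eps : R) (q p b : R -> R) : Prop := {
  ls_q0 : q 0 = - 3 * lam / 2;
  ls_p0 : p 0 = 0;
  ls_b0 : b 0 = 0;
  ls_q_cont : forall r, continuous q r;
  ls_p_cont : forall r, continuous p r;
  ls_b_cont : forall r, continuous b r;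
  ls_q_bound : forall r, 0 <= r <= eps -> Rabs (q r) <= 4;
  ls_p_bound : forall r, 0 <= r <= eps -> Rabs (p r) <= 1;
  ls_b_bound : forall r, 0 <= r <= eps -> Rabs (b r) <= 1;
  ls_q_derive : forall r, 0 < r <= eps -> is_derive q r (r * k_of r (q r) (p r) (b r));
  ls_p_derive : forall r, 0 < r <= eps -> is_derive p r (k_of r (q r) (p r) (b r) - 4 * p r / r);
  ls_b_derive : forall r, 0 < r <= eps -> is_derive b r (g_of r (q r) (p r) (b r) - 3 * b r / r) }.

Lemma a_of_bound q b : Rabs q <= 4 -> Rabs b <= 1 -> -9 <= a_of q b <= 1.
Proof.
intros Hq Hb; apply Rabs_le_between in Hq, Hb; unfold a_of.
assert (0 <= q ^ 2 <= 16) by (split; nra); lra.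
Qed.

Lemma A_bound r q b : 0 <= r <= / 10 -> Rabs q <= 4 -> Rabs b <= 1 ->
  9 / 10 <= 1 + r ^ 2 * a_of q b <= 101 / 100.
Proof.
intros Hr Hq Hb; assert (H := a_of_bound q b Hq Hb).
assert (0 <= r ^ 2 <= / 100) by (split; nra); nra.
Qed.

(** On a short interval the solutions of the truncated system stay where the
    truncation is inactive; for parameter 0 uniqueness gives the zero solution. *)
Lemma local_solutions_exist : exists eps C (q p b : R -> R -> R),
  0 < eps <= / 10 /\ 0 <= C /\
  (forall lam, 0 <= lam <= 2 -> local_solution lam eps (q lam) (p lam) (b lam)) /\
  (forall lam lam' r, 0 <= r <= eps ->
     Rabs (q lam r - q lam' r) <= C * Rabs (lam - lam') /\
     Rabs (p lam r - p lam' r) <= C * Rabs (lam - lam') /\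
     Rabs (b lam r - b lam' r) <= C * Rabs (lam - lam')) /\
  (forall r, 0 <= r <= eps -> q 0 r = 0 /\ p 0 r = 0 /\ b 0 r = 0).
Proof.
destruct (truncated_solution_exists 4 local_exponent local_field 4 ltac:(lra))
  as [Y [L [B [HL [HB [Hc [H0 [Hn [Hd [Hr [Hdep Hu]]]]]]]]]]].
{ intros i Hi; apply local_field_lipschitz; [lra|assumption]. }
pose (c := fun (lam : R) (i : nat) => match i with 1%nat => - 3 * lam / 2 | _ => 0 end).
pose (eps := Rmin (/ 10) (/ (B + 1))).
assert (He : 0 < eps) by (apply Rmin_pos; [lra|apply Rinv_0_lt_compat; lra]).
assert (He1 : eps <= / 10) by apply Rmin_l.
assert (He2 : B * eps <= 1).
{ assert (eps <= / (B + 1)) by apply Rmin_r.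
  apply Rle_trans with ((B + 1) * / (B + 1)); [|right; field; lra]; nra. }
assert (Hnear : forall lam i r, (i < 4)%nat -> 0 <= r <= eps -> Rabs (Y (c lam) i r - c lam i) <= 1).
{ intros lam i r Hi Hr'; eapply Rle_trans; [now apply Hn|]; rewrite Rabs_pos_eq; nra. }
assert (Hbox : forall lam i r, 0 <= lam <= 2 -> (i < 4)%nat -> 0 <= r <= eps ->
  Rabs (Y (c lam) i r) <= match i with 1%nat => 4 | _ => 1 end).
{ intros lam i r Hl Hi Hr'; specialize (Hnear lam i r Hi Hr').
  apply Rabs_le_between in Hnear; apply Rabs_le.
  destruct i as [|[|[|[|i]]]]; unfold c in *; try lra; lia. }
assert (Hbox4 : forall lam r, 0 <= lam <= 2 -> 0 <= r <= eps ->
  forall j, (j < 4)%nat -> Rabs (Y (c lam) j r) <= 4).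
{ intros lam r Hl Hr' j Hj; specialize (Hbox lam j r Hl Hj Hr').
  destruct j as [|[|[|[|j]]]]; try lra; lia. }
assert (Hid : forall lam r, 0 <= lam <= 2 -> 0 <= r <= eps -> Y (c lam) 0%nat r = r).
{ intros lam r Hl Hr'; destruct (Req_dec r 0) as [->|Hne]; [rewrite H0; [reflexivity|lia]|].
  destruct (mean_value (Y (c lam) 0%nat) (fun _ => 1) 0 r) as [x [_ Hx]]; [lra| | |].
  - intros t Ht; apply (Hr (c lam) 0%nat t); [lia|reflexivity|]; apply Hbox4; lra.
  - intros t Ht; apply Hc; lia.
  - rewrite H0 in Hx by lia; unfold c in Hx at 2; lra. }
assert (Hcut : forall lam r, 0 <= lam <= 2 -> 0 <= r <= eps ->
  k_cut r (Y (c lam) 1%nat r) (Y (c lam) 2%nat r) (Y (c lam) 3%nat r)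
  = k_of r (Y (c lam) 1%nat r) (Y (c lam) 2%nat r) (Y (c lam) 3%nat r)).
{ intros lam r Hl Hr'; unfold k_cut, k_of; f_equal; apply Rmax_right.
  assert (H1 := Hbox lam 1%nat r Hl ltac:(lia) Hr').
  assert (H3 := Hbox lam 3%nat r Hl ltac:(lia) Hr').
  destruct (A_bound r _ _ ltac:(lra) H1 H3); lra. }
exists eps, (3 * exp (2 * L * eps)), (fun lam => Y (c lam) 1%nat), (fun lam => Y (c lam) 2%nat),
  (fun lam => Y (c lam) 3%nat).
split; [lra|]; split; [generalize (exp_pos (2 * L * eps)); lra|]; split; [|split].
- intros lam Hl; split.
  + rewrite H0; [reflexivity|lia].
  + rewrite H0; [reflexivity|lia].
  + rewrite H0; [reflexivity|lia].
  + intros; apply Hc; lia.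
  + intros; apply Hc; lia.
  + intros; apply Hc; lia.
  + intros r Hr'; apply (Hbox lam 1%nat r Hl ltac:(lia) Hr').
  + intros r Hr'; apply (Hbox lam 2%nat r Hl ltac:(lia) Hr').
  + intros r Hr'; apply (Hbox lam 3%nat r Hl ltac:(lia) Hr').
  + intros r Hr'; eapply is_derive_eq.
    * apply (Hr (c lam) 1%nat r); [lia|reflexivity|]; apply Hbox4; lra.
    * simpl; rewrite Hid, Hcut by lra; reflexivity.
  + intros r Hr'; eapply is_derive_eq.
    * apply (Hd (c lam) 2%nat r); [lia|lra|]; apply Hbox4; lra.
    * simpl local_field; simpl INR; rewrite Hid, Hcut by lra; change (c lam 2%nat) with 0; unfold Rdiv; ring.
  + intros r Hr'; eapply is_derive_eq.
    * apply (Hd (c lam) 3%nat r); [lia|lra|]; apply Hbox4; lra.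
    * simpl local_field; simpl INR; rewrite Hid, Hcut by lra; change (c lam 3%nat) with 0; unfold g_of, Rdiv; ring.
- assert (D : forall lam lam' r i, (i < 4)%nat -> 0 <= r <= eps ->
    Rabs (Y (c lam) i r - Y (c lam') i r) <= 3 * exp (2 * L * eps) * Rabs (lam - lam')).
  { intros lam lam' r i Hi Hr'.
    eapply Rle_trans; [apply (Hdep (c lam) (c lam') (3 / 2 * Rabs (lam - lam')))|].
    - assumption.
    - generalize (Rabs_pos (lam - lam')); lra.
    - intros j Hj; generalize (Rabs_pos (lam - lam')); intros Hp.
      destruct j as [|[|j]]; unfold c; try (rewrite Rminus_diag, Rabs_R0; lra).
      replace (- 3 * lam / 2 - - 3 * lam' / 2) with (- (3 / 2 * (lam - lam'))) by field.
      rewrite Rabs_Ropp, Rabs_mult, (Rabs_pos_eq (3 / 2)); lra.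
    - rewrite (Rabs_pos_eq r) by lra.
      assert (exp (2 * L * r) <= exp (2 * L * eps)) by (apply exp_mono; nra).
      generalize (Rabs_pos (lam - lam')); nra. }
  intros lam lam' r Hr'; repeat split; apply D; try lia; assumption.
- intros r Hr'.
  pose (x := fun (i : nat) (t : R) => match i with O => t | _ => 0 end).
  assert (X : forall i t, (i < 4)%nat -> 0 <= t <= eps -> x i t = Y (c 0) i t).
  { apply Hu.
    - intros i t Hi; destruct i; [apply cid | apply cconst].
    - intros i t Hi Ht; destruct i; simpl; [rewrite Rabs_pos_eq; lra | rewrite Rabs_R0; lra].
    - intros i t Hi Ht.
      assert (Hz : forall (m : nat), avg_int m (fun _ => 0) t = 0).
      { intros m; unfold avg_int; rewrite (RInt_ext (V := R_CompleteNormedModule) _ (fun _ => 0)).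
        - rewrite (RInt_const (V := R_CompleteNormedModule)); unfold scal; simpl; unfold mult; simpl; unfold Rdiv; ring.
        - intros; apply Rmult_0_r. }
      assert (Hz' : forall m (g : R -> R), (forall s, 0 <= s <= t -> g s = 0) -> avg_int m g t = 0).
      { intros m g Hg; rewrite <- (Hz m); apply avg_int_ext; [lra|assumption]. }
      destruct i as [|[|[|[|i]]]]; [| | | |lia].
      + unfold c, x, local_field, local_exponent, avg_int; simpl.
        rewrite (RInt_ext (V := R_CompleteNormedModule) _ (fun _ => 1)) by (intros; apply Rmult_1_l).
        rewrite (RInt_const (V := R_CompleteNormedModule)); change (t = 0 + (t - 0) * 1 / 1); field.
      + rewrite Hz'; [unfold x, c; field|].
        intros s Hs; simpl; unfold k_cut, k_num, v_of, z_of, a_of, x, Rdiv; ring.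
      + rewrite Hz'; [unfold x, c; ring|].
        intros s Hs; simpl; unfold k_cut, k_num, v_of, z_of, a_of, x, Rdiv; ring.
      + rewrite Hz'; [unfold x, c; ring|].
        intros s Hs; simpl; unfold b_rhs, k_cut, k_num, v_of, z_of, a_of, x, Rdiv; ring. }
  rewrite <- !X by (lia || assumption); unfold x; auto.
Qed.

Definition w_of (r q p : R) : R := 1 + r ^ 2 * v_of r q p.
Definition dw_of (r q p : R) : R := r * z_of r q p.
Definition A_of (r q b : R) : R := 1 + r ^ 2 * a_of q b.

(** The values that the first two equations prescribe for [w''] and [A']. *)
Definition ddw_rhs (w dw A : R -> R) (r : R) : R :=
  - (Phi A w r * dw r + w r * (1 - w r ^ 2)) / (r ^ 2 * A r).
Definition dA_rhs (w dw A : R -> R) (r : R) : R :=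
  (1 - (1 - w r ^ 2) ^ 2 / r ^ 2 - (2 * dw r ^ 2 + 1) * A r) / r.

Lemma local_solution_restrict lam eps eps' q p b : eps' <= eps ->
  local_solution lam eps q p b -> local_solution lam eps' q p b.
Proof.
intros He [H1 H2 H3 H4 H5 H6 H7 H8 H9 H10 H11 H12]; split; try assumption; intros;
  [apply H7|apply H8|apply H9|apply H10|apply H11|apply H12]; lra.
Qed.

Section Local.

Variables (lam eps : R) (q p b : R -> R).
Hypothesis eps_small : eps <= / 10.
Hypothesis sol : local_solution lam eps q p b.

Let w (r : R) : R := w_of r (q r) (p r).
Let dw (r : R) : R := dw_of r (q r) (p r).
Let A (r : R) : R := A_of r (q r) (b r).

Lemma local_A_bound r : 0 <= r <= eps -> 9 / 10 <= A r <= 101 / 100.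
Proof.
intros Hr; apply A_bound; [lra | apply (ls_q_bound _ _ _ _ _ sol); lra | apply (ls_b_bound _ _ _ _ _ sol); lra].
Qed.

Lemma local_v_bound r : 0 <= r <= eps -> Rabs (v_of r (q r) (p r)) <= 14 / 10.
Proof.
intros Hr; assert (Hq := ls_q_bound _ _ _ _ _ sol r Hr); assert (Hp := ls_p_bound _ _ _ _ _ sol r Hr).
apply Rabs_le_between in Hq, Hp; apply Rabs_le; unfold v_of.
assert (- / 10 <= r * p r <= / 10) by (split; nra); lra.
Qed.

Lemma local_z_bound r : 0 <= r <= eps -> Rabs (z_of r (q r) (p r)) <= 3.
Proof.
intros Hr; assert (Hq := ls_q_bound _ _ _ _ _ sol r Hr); assert (Hp := ls_p_bound _ _ _ _ _ sol r Hr).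
apply Rabs_le_between in Hq, Hp; apply Rabs_le; unfold z_of.
assert (- / 10 <= r * p r <= / 10) by (split; nra); lra.
Qed.

Lemma local_w_derive r : 0 < r <= eps -> is_derive w r (dw r).
Proof.
intros Hr; unfold w, dw, w_of, v_of, dw_of, z_of.
assert (Hq := ls_q_derive _ _ _ _ _ sol r Hr); assert (Hp := ls_p_derive _ _ _ _ _ sol r Hr).
derive_by; [lra|]; simpl; field; lra.
Qed.

Lemma local_dw_derive r : 0 < r <= eps -> is_derive dw r (ddw_rhs w dw A r).
Proof.
intros Hr; assert (HA := local_A_bound r ltac:(lra)).
unfold ddw_rhs, Phi; unfold w, dw, A, w_of, dw_of, A_of in *.
assert (Hq := ls_q_derive _ _ _ _ _ sol r Hr); assert (Hp := ls_p_derive _ _ _ _ _ sol r Hr).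
eapply is_derive_eq; [unfold z_of; dauto; lra|].
unfold k_of, k_num, v_of, z_of; simpl; field; lra.
Qed.

Lemma local_A_derive r : 0 < r <= eps -> is_derive A r (dA_rhs w dw A r).
Proof.
intros Hr; assert (HA := local_A_bound r ltac:(lra)).
unfold dA_rhs; unfold w, dw, A, w_of, dw_of, A_of in *.
assert (Hq := ls_q_derive _ _ _ _ _ sol r Hr); assert (Hb := ls_b_derive _ _ _ _ _ sol r Hr).
eapply is_derive_eq; [unfold a_of; dauto|].
unfold g_of, b_rhs, v_of, z_of, a_of; simpl; field; lra.
Qed.

Lemma local_w_continuous r : continuous w r.
Proof.
unfold w, w_of, v_of; assert (Hq := ls_q_cont _ _ _ _ _ sol r); assert (Hp := ls_p_cont _ _ _ _ _ sol r).
unfold Rdiv; cauto.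
Qed.

Lemma local_dw_continuous r : continuous dw r.
Proof.
unfold dw, dw_of, z_of; assert (Hq := ls_q_cont _ _ _ _ _ sol r); assert (Hp := ls_p_cont _ _ _ _ _ sol r).
unfold Rdiv; cauto.
Qed.

Lemma local_A_continuous r : continuous A r.
Proof.
unfold A, A_of, a_of; assert (Hq := ls_q_cont _ _ _ _ _ sol r); assert (Hp := ls_b_cont _ _ _ _ _ sol r).
cauto.
Qed.

Lemma local_w_near_1 r : 0 <= r <= eps -> Rabs (w r - 1) <= 14 / 1000.
Proof.
intros Hr; assert (Hv := local_v_bound r Hr); apply Rabs_le_between in Hv; apply Rabs_le.
unfold w, w_of; assert (Hx : 0 <= r ^ 2 <= / 100) by (split; nra).
set (x := r ^ 2) in *; set (v := v_of r (q r) (p r)) in *.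
assert (0 <= x * (v + 14 / 10)) by (apply Rmult_le_pos; lra).
assert (0 <= x * (14 / 10 - v)) by (apply Rmult_le_pos; lra); split; lra.
Qed.

Hypothesis lam_pos : 0 < lam.

(** The slope cannot return to zero while [0 < w < 1], by the sign of [w'']. *)
Lemma local_z_neg r : 0 <= r <= eps -> z_of r (q r) (p r) < 0.
Proof.
intros Hr0.
assert (Hz : forall i t, (i < 1)%nat -> 0 <= t <= r -> 0 < (fun (_ : nat) t => - z_of t (q t) (p t)) i t).
{ apply first_exit; [lra| | |].
  - intros i t _ _; assert (Hq := ls_q_cont _ _ _ _ _ sol t); assert (Hp := ls_p_cont _ _ _ _ _ sol t).
    unfold z_of, Rdiv; cauto.
  - intros i _; unfold z_of; rewrite (ls_q0 _ _ _ _ _ sol), (ls_p0 _ _ _ _ _ sol); lra.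
  - intros t Ht Hpos _ i Hi Hi0.
    specialize (fun u => Hpos i u Hi).
    assert (Ht' : 0 < t <= eps) by lra.
    assert (Hq := ls_q_derive _ _ _ _ _ sol t Ht'); assert (Hp := ls_p_derive _ _ _ _ _ sol t Ht').
    assert (Hw1 : 0 < w 0 - w t).
    { assert (w t < w 0); [|lra].
      apply Ropp_lt_cancel; apply (strict_monotone_by_derive (fun s => - w s) (fun s => - dw s) 0 t); [lra| | |].
      - intros s Hs; assert (H := local_w_derive s ltac:(lra)); derive_by; reflexivity.
      - intros s Hs; assert (H := local_w_continuous s); cauto.
      - intros s Hs; specialize (Hpos s ltac:(lra)); unfold dw, dw_of; nra. }
    assert (Hw0 := local_w_near_1 t ltac:(lra)); apply Rabs_le_between in Hw0.
    assert (HA := local_A_bound t ltac:(lra)).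
    assert (Hd : is_derive (fun t => - z_of t (q t) (p t)) t
              (- (v_of t (q t) (p t) * (1 + t ^ 2 * v_of t (q t) (p t)) * (2 + t ^ 2 * v_of t (q t) (p t)) / (t * A t)))).
    { unfold z_of; eapply is_derive_eq; [dauto; lra|]; cbv beta.
      assert (Hqp : q t = - t * p t / 2) by (unfold z_of in Hi0; lra).
      unfold k_of, k_num, z_of; unfold A, A_of in HA |- *; set (a0 := a_of (q t) (b t)) in *.
      unfold v_of; rewrite Hqp; simpl; field; simpl in HA; lra. }
    apply derive_at_first_zero in Hd; try assumption; [|lra].
    unfold w, w_of in Hw1, Hw0; set (v := v_of t (q t) (p t)) in *.
    assert (Hv : v < 0).
    { rewrite pow_i in Hw1 by lia; assert (0 < t ^ 2) by (apply pow_lt; lra); nra. }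
    assert (v * (1 + t ^ 2 * v) * (2 + t ^ 2 * v) / (t * A t) < 0); [|lra].
    assert (H1 : 0 < / (t * A t)) by (apply Rinv_0_lt_compat; nra).
    assert (H2 : 0 < (1 + t ^ 2 * v) * (2 + t ^ 2 * v)) by nra.
    unfold Rdiv; assert (v * ((1 + t ^ 2 * v) * (2 + t ^ 2 * v)) < 0) by nra; nra. }
specialize (Hz O r ltac:(lia) ltac:(lra)); lra.
Qed.

Lemma local_dw_neg r : 0 < r <= eps -> dw r < 0.
Proof. intros Hr; assert (H := local_z_neg r ltac:(lra)); unfold dw, dw_of; nra. Qed.

Lemma local_w_lt_1 r : 0 < r <= eps -> w r < 1.
Proof.
intros Hr; assert (H0 : w 0 = 1) by (unfold w, w_of; ring); rewrite <- H0.
apply Ropp_lt_cancel; apply (strict_monotone_by_derive (fun s => - w s) (fun s => - dw s) 0 r); [lra| | |].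
- intros s Hs; assert (H := local_w_derive s ltac:(lra)); derive_by; reflexivity.
- intros s Hs; assert (H := local_w_continuous s); cauto.
- intros s Hs; assert (H := local_dw_neg s ltac:(lra)); lra.
Qed.

(** The flat-space energy starts at zero and increases while the metric is
    nearly flat. *)
Lemma local_energy_pos r : 0 < r <= eps ->
  0 < r ^ 2 * A r * dw r ^ 2 - (1 - w r ^ 2) ^ 2 / 2.
Proof.
intros Hr.
assert (H0 : 0 ^ 2 * A 0 * dw 0 ^ 2 - (1 - w 0 ^ 2) ^ 2 / 2 = 0) by (unfold w, w_of; field).
rewrite <- H0.
apply (strict_monotone_by_derive (fun r => r ^ 2 * A r * dw r ^ 2 - (1 - w r ^ 2) ^ 2 / 2)
  (fun r => r * dw r ^ 2 * (3 * A r - 1 - 2 * A r * dw r ^ 2 + (1 - w r ^ 2) ^ 2 / r ^ 2))); [lra| | |].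
- intros t Ht; assert (Ht' : 0 < t <= eps) by lra.
  assert (D1 := local_w_derive t Ht'); assert (D2 := local_dw_derive t Ht'); assert (D3 := local_A_derive t Ht').
  assert (HA := local_A_bound t ltac:(lra)).
  derive_by; [lra|]; unfold ddw_rhs, dA_rhs, Phi; simpl; field; lra.
- intros t Ht; assert (C1 := local_w_continuous t); assert (C2 := local_dw_continuous t);
  assert (C3 := local_A_continuous t); unfold Rdiv; cauto.
- intros t Ht; assert (HA := local_A_bound t ltac:(lra)).
  assert (Hdw := local_dw_neg t ltac:(lra)).
  assert (Hz := local_z_bound t ltac:(lra)); apply Rabs_le_between in Hz.
  assert (H1 : -3 / 10 <= dw t) by (unfold dw, dw_of; nra).
  assert (H2 : 0 <= (1 - w t ^ 2) ^ 2 / t ^ 2) by (apply Rdiv_le_0_compat; [apply pow2_ge_0 | apply pow_lt; lra]).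
  assert (H3 : 0 < dw t ^ 2 <= 9 / 100) by (split; nra).
  apply Rmult_lt_0_compat; [apply Rmult_lt_0_compat; lra | nra].
Qed.

End Local.

(** Comparison after multiplication by the integrating factor [r^m]. *)
Lemma singular_upper_bound (m j : nat) (u g : R -> R) (C rho : R) : u 0 = 0 ->
  (forall r, continuous u r) ->
  (forall r, 0 < r <= rho -> is_derive u r (g r - INR m * u r / r)) ->
  (forall r, 0 < r <= rho -> g r <= C * r ^ j) ->
  forall r, 0 < r <= rho -> u r <= C / INR (m + j + 1) * r ^ (j + 1).
Proof.
intros H0 Hc Hd Hg r Hr.
assert (Hn : 0 < INR (m + j + 1)) by (apply lt_0_INR; lia).
assert (H : C / INR (m + j + 1) * 0 ^ (m + j + 1) - 0 ^ m * u 0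
            <= C / INR (m + j + 1) * r ^ (m + j + 1) - r ^ m * u r).
{ apply (monotone_by_derive (fun r => C / INR (m + j + 1) * r ^ (m + j + 1) - r ^ m * u r)
    (fun r => r ^ m * (C * r ^ j - g r))); [lra| | |].
  - intros t Ht; assert (D := Hd t ltac:(lra)).
    derive_by; replace (Init.Nat.pred (m + j + 1)) with (m + j)%nat by lia.
    rewrite (pow_add t m j); destruct m as [|m].
    + simpl (INR 0); simpl (_ ^ 0); field; lra.
    + simpl Init.Nat.pred; rewrite <- !(tech_pow_Rmult t m); field; lra.
  - intros t Ht; specialize (Hc t); cauto.
  - intros t Ht; apply Rmult_le_pos; [apply pow_le; lra | specialize (Hg t ltac:(lra)); lra]. }
rewrite H0, (pow_i (m + j + 1)), !Rmult_0_r, Rminus_diag in H by lia.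
replace (m + j + 1)%nat with (m + (j + 1))%nat in H at 2 by lia.
rewrite pow_add in H.
assert (Hp : 0 < r ^ m) by (apply pow_lt; lra).
apply (Rmult_le_reg_l (r ^ m)); lra.
Qed.

Lemma singular_expansion (m j : nat) (u g : R -> R) (c d rho : R) : u 0 = 0 ->
  (forall r, continuous u r) ->
  (forall r, 0 < r <= rho -> is_derive u r (g r - INR m * u r / r)) ->
  (forall r, 0 < r <= rho -> Rabs (g r - c * r ^ j) <= d * r ^ j) ->
  forall r, 0 < r <= rho ->
    Rabs (u r - c / INR (m + j + 1) * r ^ (j + 1)) <= d / INR (m + j + 1) * r ^ (j + 1).
Proof.
intros H0 Hc Hd Hg r Hr.
assert (U := singular_upper_bound m j u g (c + d) rho H0 Hc Hd).
assert (V := singular_upper_bound m j (fun r => - u r) (fun r => - g r) (- c + d) rho).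
specialize (U ltac:(intros t Ht; specialize (Hg t Ht); apply Rabs_le_between in Hg; lra) r Hr).
cbv beta in V; rewrite H0, Ropp_0 in V.
specialize (V eq_refl ltac:(intros t; specialize (Hc t); cauto)
  ltac:(intros t Ht; specialize (Hd t Ht); derive_by; unfold Rdiv; ring)
  ltac:(intros t Ht; specialize (Hg t Ht); apply Rabs_le_between in Hg; lra) r Hr).
apply Rabs_le; unfold Rdiv in *; lra.
Qed.

Lemma continuous_rel_error (f : R -> R) (d : R) : continuous f 0 -> 0 < d ->
  exists rho, 0 < rho /\ forall r, 0 < r <= rho -> Rabs (f r - f 0) <= d.
Proof.
intros Hf Hd; destruct (proj1 (continuous_eps f 0) Hf d Hd) as [rho [Hr H]].
exists (rho / 2); split; [lra|]; intros r Hr'; left; apply H.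
rewrite Rminus_0_r, Rabs_pos_eq; lra.
Qed.

(** Each coefficient is the value at [0] of [k] or of [g / r], namely -5 and
    148/3, divided by the exponent plus the degree: 2, 5 and 5. *)
Lemma local_taylor (eps : R) (q p b : R -> R) (d : R) : 0 < eps <= / 10 -> 0 < d ->
  local_solution 2 eps q p b ->
  exists rho, 0 < rho <= eps /\ forall r, 0 < r <= rho ->
    Rabs (q r + 3 + 5 / 2 * r ^ 2) <= d * r ^ 2 /\
    Rabs (p r + r) <= d * r /\
    Rabs (b r - 148 / 15 * r ^ 2) <= d * r ^ 2.
Proof.
intros Heps Hd sol.
pose (v := fun r => v_of r (q r) (p r)); pose (z := fun r => z_of r (q r) (p r)).
pose (a := fun r => a_of (q r) (b r)).
pose (k := fun r => k_of r (q r) (p r) (b r)).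
pose (g := fun r => 8 / 9 * q r * k r - 2 / 3 * p r ^ 2 - 2 * a r * z r ^ 2 - 4 * v r ^ 3 - r ^ 2 * v r ^ 4).
assert (Cq := ls_q_cont _ _ _ _ _ sol 0); assert (Cp := ls_p_cont _ _ _ _ _ sol 0);
assert (Cb := ls_b_cont _ _ _ _ _ sol 0).
assert (q0 : q 0 = -3) by (rewrite (ls_q0 _ _ _ _ _ sol); field).
assert (p0 := ls_p0 _ _ _ _ _ sol); assert (b0 := ls_b0 _ _ _ _ _ sol).
assert (Cv : continuous v 0) by (unfold v, v_of, Rdiv; cauto).
assert (Cz : continuous z 0) by (unfold z, z_of, Rdiv; cauto).
assert (Ca : continuous a 0) by (unfold a, a_of; cauto).
assert (Ck : continuous k 0).
{ unfold k, k_of, k_num; apply cmult; [fold (v 0); change (continuous (fun r => z r * (a r + (v r * (2 + r ^ 2 * v r)) ^ 2) + 3 * v r ^ 2 + r ^ 2 * v r ^ 3 - 2 * v r * a r) 0); cauto|].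
  apply (cinv (fun r => 1 + r ^ 2 * a r)); [cauto | rewrite pow_i by lia; lra]. }
assert (Cg : continuous g 0) by (unfold g; cauto).
assert (k0 : k 0 = -5).
{ unfold k, k_of, k_num, v_of, z_of, a_of; rewrite q0, p0, b0; field. }
assert (g0 : g 0 = 148 / 3).
{ unfold g; rewrite k0; unfold v, z, a, v_of, z_of, a_of; rewrite q0, p0, b0; field. }
destruct (continuous_rel_error k d Ck Hd) as [r1 [Hr1 Hk]].
destruct (continuous_rel_error g d Cg Hd) as [r2 [Hr2 Hg]].
rewrite k0 in Hk; rewrite g0 in Hg.
pose (rho := Rmin eps (Rmin r1 r2)).
assert (L1 : rho <= eps) by apply Rmin_l.
assert (L2 : rho <= Rmin r1 r2) by apply Rmin_r.
assert (L3 := Rmin_l r1 r2); assert (L4 := Rmin_r r1 r2).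
assert (L5 : 0 < rho) by (repeat apply Rmin_pos; lra).
exists rho; split; [lra|]; intros r Hr; repeat split.
- assert (E := singular_expansion 0 1 (fun r => q r + 3) (fun r => r * k r) (-5) d rho).
  cbv beta in E; rewrite q0 in E; specialize (E ltac:(ring)).
  specialize (E ltac:(intros t; assert (C := ls_q_cont _ _ _ _ _ sol t); cauto)).
  specialize (E ltac:(intros t Ht; assert (D := ls_q_derive _ _ _ _ _ sol t ltac:(lra)); derive_by;
    unfold k; simpl; field; lra)).
  specialize (E ltac:(intros t Ht; specialize (Hk t ltac:(lra)); rewrite !pow_1;
    replace (t * k t - -5 * t) with ((k t - -5) * t) by ring; rewrite Rabs_mult, (Rabs_pos_eq t) by lra; nra) r Hr).
  simpl INR in E; simpl (1 + 1)%nat in E.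
  replace (q r + 3 + 5 / 2 * r ^ 2) with (q r + 3 - -5 / (1 + 1) * r ^ 2) by field.
  eapply Rle_trans; [exact E|]; assert (0 <= r ^ 2) by apply pow2_ge_0; nra.
- assert (E := singular_expansion 4 0 p k (-5) d rho p0 (ls_p_cont _ _ _ _ _ sol)).
  specialize (E ltac:(intros t Ht; assert (D := ls_p_derive _ _ _ _ _ sol t ltac:(lra)); eapply is_derive_eq;
    [exact D|]; unfold k; simpl; field; lra)).
  specialize (E ltac:(intros t Ht; specialize (Hk t ltac:(lra)); rewrite !pow_O, !Rmult_1_r; assumption) r Hr).
  simpl INR in E; simpl (0 + 1)%nat in E; rewrite pow_1 in E.
  replace (p r + r) with (p r - -5 / (1 + 1 + 1 + 1 + 1) * r) by field.
  eapply Rle_trans; [exact E|]; nra.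
- assert (E := singular_expansion 3 1 b (fun r => r * g r) (148 / 3) d rho b0 (ls_b_cont _ _ _ _ _ sol)).
  specialize (E ltac:(intros t Ht; assert (D := ls_b_derive _ _ _ _ _ sol t ltac:(lra)); eapply is_derive_eq;
    [exact D|]; unfold g, g_of, b_rhs, k, v, z, a; simpl; field; lra)).
  specialize (E ltac:(intros t Ht; specialize (Hg t ltac:(lra)); rewrite !pow_1;
    replace (t * g t - 148 / 3 * t) with ((g t - 148 / 3) * t) by ring; rewrite Rabs_mult, (Rabs_pos_eq t) by lra; nra) r Hr).
  simpl INR in E; simpl (1 + 1)%nat in E.
  replace (b r - 148 / 15 * r ^ 2) with (b r - 148 / 3 / (1 + 1 + 1 + 1 + 1) * r ^ 2) by field.
  eapply Rle_trans; [exact E|]; assert (0 <= r ^ 2) by apply pow2_ge_0; nra.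
Qed.

(** Data for the regularized system at radius [r]: [1/r, w, r N w', N, kappa]
    with [N = sqrt A] and [kappa] fixed by the constraint. *)
Definition start_of (r w dw A : R) (i : nat) : R :=
  match i with
  | O => / r
  | 1%nat => w
  | 2%nat => r * sqrt A * dw
  | 3%nat => sqrt A
  | _ => (1 + A + 2 * A * dw ^ 2 - ((1 - w ^ 2) / r) ^ 2) / (2 * sqrt A)
  end.

Definition start (r q p b : R) : nat -> R := start_of r (w_of r q p) (dw_of r q p) (A_of r q b).

Definition close_on (d : R) (c c' : nat -> R) : Prop :=
  forall i, (i < 5)%nat -> Rabs (c i - c' i) <= d.

Lemma local_family_exists : exists rs (q p b : R -> R -> R),
  0 < rs <= / 10 /\
  (forall lam, 0 <= lam <= 2 -> local_solution lam rs (q lam) (p lam) (b lam)) /\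
  (forall lam0 d, 0 <= lam0 <= 2 -> 0 < d -> exists e, 0 < e /\ forall lam, 0 <= lam <= 2 ->
     Rabs (lam - lam0) < e ->
     close_on d (start rs (q lam rs) (p lam rs) (b lam rs))
                (start rs (q lam0 rs) (p lam0 rs) (b lam0 rs))) /\
  (q 0 rs = 0 /\ p 0 rs = 0 /\ b 0 rs = 0) /\
  (Rabs (q 2 rs + 3 + 5 / 2 * rs ^ 2) <= / 100 * rs ^ 2 /\
   Rabs (p 2 rs + rs) <= / 100 * rs /\
   Rabs (b 2 rs - 148 / 15 * rs ^ 2) <= / 100 * rs ^ 2).
Proof.
destruct local_solutions_exist as [eps [C [q [p [b [Heps [HC [Hsol [Hdep H0]]]]]]]]].
destruct (local_taylor eps (q 2) (p 2) (b 2) (/ 100) Heps ltac:(lra) (Hsol 2 ltac:(lra)))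
  as [rho [Hrho HT]].
exists rho, q, p, b.
assert (Hsol' : forall lam, 0 <= lam <= 2 -> local_solution lam rho (q lam) (p lam) (b lam)).
{ intros lam Hl; apply local_solution_restrict with eps; [lra | now apply Hsol]. }
split; [lra|]; split; [exact Hsol'|]; split; [|split; [apply H0; lra | apply HT; lra]].
intros lam0 d Hl0 Hd.
pose (pr := fun lam => Rmax 0 (Rmin 2 lam)).
assert (Hpr : forall lam, 0 <= pr lam <= 2).
{ intros lam; unfold pr; split; [apply Rmax_l | apply Rmax_lub; [lra | apply Rmin_l]]. }
assert (Hpr1 : forall lam, 0 <= lam <= 2 -> pr lam = lam).
{ intros lam Hl; unfold pr; rewrite Rmin_right by lra; apply Rmax_right; lra. }
assert (Hpr2 : forall x y, Rabs (pr x - pr y) <= Rabs (x - y)).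
{ intros x y; unfold pr, Rmax, Rmin; repeat destruct Rle_dec; unfold Rabs; repeat destruct Rcase_abs; lra. }
assert (Hlip : forall f : R -> R, (forall x y, Rabs (f x - f y) <= C * Rabs (pr x - pr y)) ->
  forall x, continuous f x).
{ intros f Hf x; apply continuous_eps; intros e He; exists (e / (C + 1)).
  split; [apply Rdiv_lt_0_compat; lra|]; intros y Hy.
  apply Rlt_div_r in Hy; [|lra].
  eapply Rle_lt_trans; [apply Hf|]; specialize (Hpr2 y x).
  assert (0 <= Rabs (pr y - pr x)) by apply Rabs_pos; nra. }
assert (Cq : continuous (fun lam => q (pr lam) rho) lam0) by (apply Hlip; intros; apply Hdep; lra).
assert (Cp : continuous (fun lam => p (pr lam) rho) lam0) by (apply Hlip; intros; apply Hdep; lra).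
assert (Cb : continuous (fun lam => b (pr lam) rho) lam0) by (apply Hlip; intros; apply Hdep; lra).
pose (W := fun lam => w_of rho (q (pr lam) rho) (p (pr lam) rho)).
pose (D := fun lam => dw_of rho (q (pr lam) rho) (p (pr lam) rho)).
pose (A := fun lam => A_of rho (q (pr lam) rho) (b (pr lam) rho)).
assert (CW : continuous W lam0) by (unfold W, w_of, v_of, Rdiv; cauto).
assert (CD : continuous D lam0) by (unfold D, dw_of, z_of, Rdiv; cauto).
assert (CA : continuous A lam0) by (unfold A, A_of, a_of; cauto).
assert (HA : 9 / 10 <= A lam0 <= 101 / 100).
{ apply (local_A_bound (pr lam0) rho _ _ _ ltac:(lra) (Hsol' _ (Hpr lam0))); lra. }
assert (CN : continuous (fun lam => sqrt (A lam)) lam0) by now apply csqrt.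
assert (HN : 0 < sqrt (A lam0)) by (apply sqrt_lt_R0; lra).
assert (CS : forall i, (i < 5)%nat -> continuous (fun lam => start_of rho (W lam) (D lam) (A lam) i) lam0).
{ intros i Hi; destruct i as [|[|[|[|[|i]]]]]; unfold start_of; [cauto|cauto|cauto|cauto| |lia].
  unfold Rdiv; apply cmult; [cauto|].
  apply (cinv (fun lam => 2 * sqrt (A lam))); [cauto|lra]. }
destruct (uniform_delta 5 (fun i e => forall lam, Rabs (lam - lam0) < e ->
   Rabs (start_of rho (W lam) (D lam) (A lam) i - start_of rho (W lam0) (D lam0) (A lam0) i) <= d))
  as [e [He H]].
- intros i e e' _ He Hee lam Hl; apply He; lra.
- intros i Hi; destruct (proj1 (continuous_eps _ lam0) (CS i Hi) d Hd) as [e [He H]].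
  exists e; split; [assumption|]; intros lam Hl; left; now apply H.
- exists e; split; [assumption|]; intros lam Hl Hlt i Hi; specialize (H i Hi lam Hlt).
  unfold W, D, A in H; rewrite !Hpr1 in H by assumption; exact H.
Qed.

(** * The regularized system *)

(** In the variable [tau] with [dr = r N dtau], [l = 1/r], [P = r N w'],
    [K = (1 + A + 2 A w'^2 - V^2) / (2 N)], the system is polynomial and stays
    regular where [N] vanishes. *)
Definition flow_field (i : nat) (x : nat -> R) : R :=
  match i with
  | O => - (x 3%nat * x 0%nat)
  | 1%nat => x 2%nat
  | 2%nat => (2 * x 3%nat - x 4%nat) * x 2%nat - x 1%nat * (1 - x 1%nat ^ 2)
  | 3%nat => (x 4%nat - x 3%nat) * x 3%nat - 2 * (x 0%nat ^ 2 * x 2%nat ^ 2)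
  | _ => 1 + 2 * (x 0%nat ^ 2 * x 2%nat ^ 2) - x 4%nat ^ 2
  end.

Lemma flow_field_lipschitz M i : 0 <= M -> (i < 5)%nat -> box_lipschitz 5 M (flow_field i).
Proof.
intros HM Hi; destruct i as [|[|[|[|[|i]]]]]; [| | | | |lia]; unfold flow_field; box_auto.
Qed.

Definition equations_at (l W P N K : R -> R) (t : R) : Prop :=
  is_derive l t (- (N t * l t)) /\
  is_derive W t (P t) /\
  is_derive P t ((2 * N t - K t) * P t - W t * (1 - W t ^ 2)) /\
  is_derive N t ((K t - N t) * N t - 2 * (l t ^ 2 * P t ^ 2)) /\
  is_derive K t (1 + 2 * (l t ^ 2 * P t ^ 2) - K t ^ 2).

Definition constraint (l W P N K : R -> R) (t : R) : R :=
  2 * K t * N t - 1 - N t ^ 2 - 2 * (l t ^ 2 * P t ^ 2) + l t ^ 2 * (1 - W t ^ 2) ^ 2.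

(** In flat space, where [N = K = 1], this energy increases along the flow. *)
Definition energy (W P : R -> R) (t : R) : R := P t ^ 2 - (1 - W t ^ 2) ^ 2 / 2.

(** A curve that solves the system while it stays in a large box, with the
    properties of the data obtained from a regular centre. *)
Record orbit (L : R) (l W P N K : R -> R) : Prop := {
  o_L : 10 <= L;
  o_l_cont : forall t, continuous l t;
  o_W_cont : forall t, continuous W t;
  o_P_cont : forall t, continuous P t;
  o_N_cont : forall t, continuous N t;
  o_K_cont : forall t, continuous K t;
  o_eq : forall t, Rabs (l t) <= 15 * L + 1 -> Rabs (W t) <= 15 * L + 1 -> Rabs (P t) <= 15 * L + 1 ->
    Rabs (N t) <= 15 * L + 1 -> Rabs (K t) <= 15 * L + 1 -> equations_at l W P N K t;
  o_l0 : l 0 = L;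
  o_W0 : 0 < W 0 < 1;
  o_P0 : -1 < P 0 < 0;
  o_N0 : 0 < N 0 < 2;
  o_K0 : / 2 < K 0 < 2;
  o_constraint0 : constraint l W P N K 0 = 0;
  o_energy0 : 0 < energy W P 0 }.

Definition good (W P N : R -> R) (t : R) : Prop := 0 < N t /\ P t < 0 /\ -1 < W t.

(** Leaving the good region through [W = -1], respectively through a different
    face; both are open conditions on the initial data. *)
Definition exits_low (W P N : R -> R) : Prop :=
  exists S, 0 < S /\ W S < -1 /\ forall t, 0 <= t <= S -> 0 < N t /\ P t < 0.
Definition exits_other (W P N : R -> R) : Prop :=
  exists S, 0 < S /\ (N S < 0 \/ 0 < P S) /\ forall t, 0 <= t <= S -> -1 < W t.

Lemma limit_nonneg (f : R -> R) (t : R) : 0 < t -> continuous f t ->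
  (forall u, 0 <= u < t -> 0 < f u) -> 0 <= f t.
Proof.
intros Ht Hc Hp; destruct (Rle_dec 0 (f t)) as [|Hn]; [assumption|exfalso].
destruct (proj1 (continuous_eps f t) Hc (- f t) ltac:(lra)) as [d [Hd H]].
assert (L1 := Rmin_l (t / 2) (d / 2)); assert (L2 := Rmin_r (t / 2) (d / 2)).
assert (L3 : 0 < Rmin (t / 2) (d / 2)) by (apply Rmin_pos; lra).
specialize (H (t - Rmin (t / 2) (d / 2)) ltac:(apply Rabs_def1; lra)).
specialize (Hp (t - Rmin (t / 2) (d / 2)) ltac:(lra)).
apply Rabs_def2 in H; lra.
Qed.

Lemma decreases_after (f : R -> R) (s d : R) : is_derive f s d -> d < 0 ->
  exists e, 0 < e /\ forall h, 0 < h < e -> f (s + h) < f s.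
Proof.
intros Hd Hneg; apply is_derive_Reals in Hd.
destruct (Hd (- d) ltac:(lra)) as [e He].
exists e; split; [apply cond_pos|]; intros h Hh.
specialize (He h ltac:(lra) ltac:(apply Rabs_def1; lra)).
apply Rabs_def2 in He; destruct He as [He _].
assert (H : (f (s + h) - f s) / h < 0) by lra.
apply (Rmult_lt_compat_r h) in H; [|lra].
replace ((f (s + h) - f s) / h * h) with (f (s + h) - f s) in H by (field; lra); lra.
Qed.

Lemma stays_positive (f : R -> R) (s : R) : continuous f s -> 0 < f s ->
  exists e, 0 < e /\ forall h, 0 <= h < e -> 0 < f (s + h).
Proof.
intros Hc Hp; destruct (proj1 (continuous_eps f s) Hc (f s) Hp) as [d [Hd H]].
exists d; split; [assumption|]; intros h Hh.
specialize (H (s + h) ltac:(apply Rabs_def1; lra)); apply Rabs_def2 in H; lra.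
Qed.

(** Uniqueness for a second-order linear equation, backwards in time: with an
    exponential weight, [X^2 + P^2] cannot decrease. *)
Lemma linear_no_double_zero (X P al be : R -> R) (C s : R) : 0 <= s -> 0 <= C ->
  (forall t, 0 <= t <= s -> is_derive X t (P t)) ->
  (forall t, 0 <= t <= s -> is_derive P t (be t * P t + al t * X t)) ->
  (forall t, 0 <= t <= s -> Rabs (al t) <= 2) ->
  (forall t, 0 <= t <= s -> - C <= be t) ->
  P 0 <> 0 -> X s = 0 -> P s = 0 -> False.
Proof.
intros Hs HC HX HP Hal Hbe HP0 HXs HPs.
assert (H : exp ((3 + 2 * C) * 0) * (X 0 ^ 2 + P 0 ^ 2) <= exp ((3 + 2 * C) * s) * (X s ^ 2 + P s ^ 2)).
{ apply (monotone_by_derive (fun t => exp ((3 + 2 * C) * t) * (X t ^ 2 + P t ^ 2))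
   (fun t => exp ((3 + 2 * C) * t) * ((3 + 2 * C) * (X t ^ 2 + P t ^ 2) + 2 * X t * P t
     + 2 * P t * (be t * P t + al t * X t)))); [assumption| | |].
  - intros t Ht; assert (D1 := HX t ltac:(lra)); assert (D2 := HP t ltac:(lra)).
    derive_by; simpl; ring.
  - intros t Ht; assert (D1 := is_derive_cont _ _ _ (HX t ltac:(lra)));
    assert (D2 := is_derive_cont _ _ _ (HP t ltac:(lra))).
    assert (D3 : continuous (fun t => exp ((3 + 2 * C) * t)) t).
    { eapply is_derive_cont; dauto. }
    cauto.
  - intros t Ht; apply Rmult_le_pos; [left; apply exp_pos|].
    assert (A1 := Hal t ltac:(lra)); assert (B1 := Hbe t ltac:(lra)); apply Rabs_le_between in A1.
    assert (S1 := pow2_ge_0 (X t + P t)); assert (S2 := pow2_ge_0 (X t - P t)).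
    assert (S3 : 0 <= P t ^ 2) by apply pow2_ge_0.
    assert (- C * P t ^ 2 <= be t * P t ^ 2) by (apply Rmult_le_compat_r; assumption).
    assert (H1 : -3 * (X t ^ 2 + P t ^ 2) <= 2 * (1 + al t) * (X t * P t)).
    { assert (- (X t ^ 2 + P t ^ 2) <= 2 * (X t * P t) <= X t ^ 2 + P t ^ 2) by (split; lra).
      assert (0 <= X t ^ 2 + P t ^ 2) by (generalize (pow2_ge_0 (X t)); lra).
      destruct (Rle_dec 0 (1 + al t)); nra. }
    nra. }
rewrite HXs, HPs, Rmult_0_r, exp_0 in H.
assert (0 < P 0 ^ 2) by (rewrite <- Rsqr_pow2; now apply Rsqr_pos_lt).
assert (0 <= X 0 ^ 2) by apply pow2_ge_0.
rewrite pow_i, Rplus_0_r, Rmult_0_r in H by lia; lra.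
Qed.

Section Orbit.

Variables (L : R) (l W P N K : R -> R).
Hypothesis orb : orbit L l W P N K.

Let L10 : 10 <= L := o_L _ _ _ _ _ _ orb.

Definition in_range (t : R) : Prop :=
  (0 < l t <= L) /\ (-1 <= W t < 1) /\ (-10 < P t <= 0) /\ (0 <= N t < 2) /\ (/ 2 < K t < 15 * L + 1).

(** [C' = - 2 N C], so [C^2] decreases. *)
Lemma constraint_preserved t : 0 <= t ->
  (forall u, 0 <= u <= t -> equations_at l W P N K u) -> (forall u, 0 <= u <= t -> 0 <= N u) ->
  constraint l W P N K t = 0.
Proof.
intros Ht Heq HN.
assert (H : - constraint l W P N K 0 ^ 2 <= - constraint l W P N K t ^ 2).
{ apply (monotone_by_derive (fun t => - constraint l W P N K t ^ 2)
    (fun t => 4 * N t * constraint l W P N K t ^ 2)); [assumption| | |].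
  - intros u Hu; destruct (Heq u ltac:(lra)) as [D1 [D2 [D3 [D4 D5]]]].
    unfold constraint; derive_by; simpl; ring.
  - intros u Hu; assert (C1 := o_l_cont _ _ _ _ _ _ orb u); assert (C2 := o_W_cont _ _ _ _ _ _ orb u);
    assert (C3 := o_P_cont _ _ _ _ _ _ orb u); assert (C4 := o_N_cont _ _ _ _ _ _ orb u);
    assert (C5 := o_K_cont _ _ _ _ _ _ orb u); unfold constraint; cauto.
  - intros u Hu; specialize (HN u ltac:(lra)); generalize (pow2_ge_0 (constraint l W P N K u)); nra. }
rewrite (o_constraint0 _ _ _ _ _ _ orb) in H.
assert (H2 := pow2_ge_0 (constraint l W P N K t)).
rewrite pow_i in H by lia.
assert (constraint l W P N K t ^ 2 = 0) by lra.
destruct (Req_dec (constraint l W P N K t) 0) as [|Hne]; [assumption|].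
exfalso; revert H0; now apply pow_nonzero.
Qed.

(** Since [energy' = 2 P^2 (2 N - K)], the function [sqrt (energy + 1)] grows at
    most at the rate [4 |P| = - 4 W'], and [W] drops by at most 2. *)
Lemma P_bound t : 0 <= t ->
  (forall u, 0 <= u <= t -> equations_at l W P N K u) ->
  (forall u, 0 <= u <= t -> 0 <= N u <= 2 /\ P u <= 0 /\ -1 <= W u <= 1 /\ 0 <= K u) -> -10 < P t.
Proof.
intros Ht Heq Hr.
pose (Y := fun t => sqrt (energy W P t + 1)).
assert (HE : forall u, 0 <= u <= t -> P u ^ 2 + / 2 <= energy W P u + 1).
{ intros u Hu; destruct (Hr u Hu) as [_ [_ [HW _]]]; unfold energy.
  assert (0 <= 1 - W u ^ 2 <= 1) by (split; nra); nra. }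
assert (HY : forall u, 0 <= u <= t -> - P u <= Y u /\ 0 < Y u).
{ intros u Hu; specialize (HE u Hu); assert (0 <= P u ^ 2) by apply pow2_ge_0; unfold Y; split.
  - rewrite <- (sqrt_pow2 (- P u)) by (destruct (Hr u Hu) as [_ [Hp _]]; lra).
    apply sqrt_le_1_alt; nra.
  - apply sqrt_lt_R0; lra. }
assert (H : - (Y 0 + 4 * W 0) <= - (Y t + 4 * W t)).
{ apply (monotone_by_derive (fun t => - (Y t + 4 * W t))
    (fun t => - (2 * P t ^ 2 * (2 * N t - K t) / (2 * Y t) + 4 * P t))); [assumption| | |].
  - intros u Hu; destruct (Heq u ltac:(lra)) as [D1 [D2 [D3 [D4 D5]]]].
    specialize (HE u ltac:(lra)); assert (0 <= P u ^ 2) by apply pow2_ge_0.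
    destruct (HY u ltac:(lra)) as [_ HYp]; unfold Y in *; unfold energy in *.
    derive_by; [lra|lra|]; simpl; simpl in HYp; field; lra.
  - intros u Hu; assert (C2 := o_W_cont _ _ _ _ _ _ orb u); assert (C3 := o_P_cont _ _ _ _ _ _ orb u).
    assert (CY : continuous Y u) by (apply csqrt; unfold energy, Rdiv; cauto).
    cauto.
  - intros u Hu; destruct (HY u ltac:(lra)) as [H1 H2]; destruct (Hr u ltac:(lra)) as [[HN0 HN] [HP [_ HK]]].
    replace (- (2 * P u ^ 2 * (2 * N u - K u) / (2 * Y u) + 4 * P u))
      with ((- P u) * (4 * Y u - (- P u) * (2 * N u - K u)) / Y u) by (field; lra).
    apply Rdiv_le_0_compat; [|lra]; apply Rmult_le_pos; [lra|].
    assert ((- P u) * (2 * N u - K u) <= (- P u) * 4) by (apply Rmult_le_compat_l; lra); lra. }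
assert (H0 : Y 0 <= 3 / 2).
{ unfold Y; rewrite <- (sqrt_pow2 (3 / 2)) by lra; apply sqrt_le_1_alt; unfold energy.
  assert (HP := o_P0 _ _ _ _ _ _ orb); assert (0 <= (1 - W 0 ^ 2) ^ 2) by apply pow2_ge_0; nra. }
assert (HW := o_W0 _ _ _ _ _ _ orb); destruct (Hr t ltac:(lra)) as [_ [_ [HWt _]]].
destruct (HY t ltac:(lra)); lra.
Qed.

(** Distances to the faces of the box to which good orbits are confined. *)
Definition margins (i : nat) (t : R) : R := match i with
  | O => l t | 1%nat => K t - / 2 | 2%nat => 15 * L + 1 - K t | 3%nat => 2 - N t
  | 4%nat => P t + 10 | 5%nat => L + 1 - l t | _ => 1 - W t end.

(** No face of the box is reached first: [l] decays at most exponentially, the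
    Riccati equation of [K] points inwards at both bounds, the constraint makes
    [N' < 0] where [N = 2], and [P] is controlled by [P_bound]. *)
Lemma apriori s : 0 <= s -> (forall t, 0 <= t < s -> good W P N t) ->
  forall t, 0 <= t <= s -> in_range t /\ equations_at l W P N K t /\ constraint l W P N K t = 0.
Proof.
intros Hs Hgood.
assert (Cl := o_l_cont _ _ _ _ _ _ orb); assert (CW := o_W_cont _ _ _ _ _ _ orb);
assert (CP := o_P_cont _ _ _ _ _ _ orb); assert (CN := o_N_cont _ _ _ _ _ _ orb);
assert (CK := o_K_cont _ _ _ _ _ _ orb).
assert (l0 := o_l0 _ _ _ _ _ _ orb); assert (W0 := o_W0 _ _ _ _ _ _ orb);
assert (P0 := o_P0 _ _ _ _ _ _ orb); assert (N0 := o_N0 _ _ _ _ _ _ orb);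
assert (K0 := o_K0 _ _ _ _ _ _ orb).
assert (Hclosed : forall t, 0 <= t <= s -> 0 <= N t /\ P t <= 0 /\ -1 <= W t).
{ intros t Ht; destruct (Req_dec t 0) as [->|Hne]; [lra|].
  assert (A1 := limit_nonneg N t ltac:(lra) (CN t) ltac:(intros u Hu; apply Hgood; lra)).
  assert (A2 := limit_nonneg (fun t => - P t) t ltac:(lra) ltac:(specialize (CP t); cauto)
    ltac:(intros u Hu; destruct (Hgood u ltac:(lra)); lra)).
  assert (A3 := limit_nonneg (fun t => W t + 1) t ltac:(lra) ltac:(specialize (CW t); cauto)
    ltac:(intros u Hu; destruct (Hgood u ltac:(lra)); lra)).
  lra. }
assert (Heq : forall t, 0 <= t <= s -> (forall i, (i < 7)%nat -> 0 <= margins i t) -> equations_at l W P N K t).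
{ intros t Ht Hf; destruct (Hclosed t Ht) as [H1 [H2 H3]].
  assert (F0 := Hf 0%nat ltac:(lia)); assert (F1 := Hf 1%nat ltac:(lia)); assert (F2 := Hf 2%nat ltac:(lia));
  assert (F3 := Hf 3%nat ltac:(lia)); assert (F4 := Hf 4%nat ltac:(lia)); assert (F5 := Hf 5%nat ltac:(lia));
  assert (F6 := Hf 6%nat ltac:(lia)); unfold margins in *.
  apply (o_eq _ _ _ _ _ _ orb); apply Rabs_le; lra. }
assert (Hpos : forall i t, (i < 7)%nat -> 0 <= t <= s -> 0 < margins i t).
{ apply first_exit; [assumption| | |].
  - intros i t Hi Ht; specialize (Cl t); specialize (CW t); specialize (CP t); specialize (CN t); specialize (CK t).
    destruct i as [|[|[|[|[|[|[|i]]]]]]]; unfold margins; [cauto|cauto|cauto|cauto|cauto|cauto|cauto|lia].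
  - intros i Hi; destruct i as [|[|[|[|[|[|[|i]]]]]]]; unfold margins; [lra|lra|lra|lra|lra|lra|lra|lia].
  - intros t Ht Hbefore Hat.
    assert (Hnn : forall i u, (i < 7)%nat -> 0 <= u <= t -> 0 <= margins i u).
    { intros i u Hi Hu; destruct (Req_dec u t) as [->|]; [now apply Hat|].
      left; apply Hbefore; [assumption|lra]. }
    assert (HE : forall u, 0 <= u <= t -> equations_at l W P N K u).
    { intros u Hu; apply Heq; [lra|]; intros; now apply Hnn. }
    assert (HC := constraint_preserved t ltac:(lra) HE ltac:(intros u Hu; apply Hclosed; lra)).
    destruct (Hclosed t ltac:(lra)) as [HN [HP HW]].
    assert (F0 := Hat 0%nat ltac:(lia)); assert (F1 := Hat 1%nat ltac:(lia)); assert (F2 := Hat 2%nat ltac:(lia));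
    assert (F3 := Hat 3%nat ltac:(lia)); assert (F4 := Hat 4%nat ltac:(lia)); assert (F5 := Hat 5%nat ltac:(lia));
    assert (F6 := Hat 6%nat ltac:(lia)).
    assert (HPb := P_bound t ltac:(lra) HE ltac:(intros u Hu; destruct (Hclosed u ltac:(lra)) as [? [? ?]];
      assert (G1 := Hnn 1%nat u ltac:(lia) Hu); assert (G3 := Hnn 3%nat u ltac:(lia) Hu);
      assert (G6 := Hnn 6%nat u ltac:(lia) Hu); unfold margins in *; lra)).
    assert (HlL : l t <= L).
    { rewrite <- l0; apply Ropp_le_cancel.
      apply (monotone_by_derive (fun t => - l t) (fun t => N t * l t)); [lra| | |].
      - intros u Hu; destruct (HE u ltac:(lra)) as [D _]; derive_by; ring.
      - intros u Hu; specialize (Cl u); cauto.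
      - intros u Hu; destruct (Hclosed u ltac:(lra)); assert (G := Hnn 0%nat u ltac:(lia) ltac:(lra)); unfold margins in G; nra. }
    assert (HQ : 0 <= l t ^ 2 * P t ^ 2 <= 100 * L ^ 2).
    { unfold margins in F0; assert (0 <= l t ^ 2 <= L ^ 2) by (split; nra); assert (0 <= P t ^ 2 <= 100) by (split; nra); split; nra. }
    assert (HV : 0 <= l t ^ 2 * (1 - W t ^ 2) ^ 2).
    { apply Rmult_le_pos; apply pow2_ge_0. }
    destruct (HE t ltac:(lra)) as [D1 [D2 [D3 [D4 D5]]]].
    intros i Hi Hz; destruct i as [|[|[|[|[|[|[|i]]]]]]]; [| | | | | | |lia]; unfold margins in Hz.
    + assert (H : exp (2 * 0) * l 0 <= exp (2 * t) * l t).
      { apply (monotone_by_derive (fun t => exp (2 * t) * l t) (fun t => exp (2 * t) * ((2 - N t) * l t))); [lra| | |].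
        - intros u Hu; destruct (HE u ltac:(lra)) as [D _]; derive_by; ring.
        - intros u Hu; specialize (Cl u).
          assert (continuous (fun t => exp (2 * t)) u) by (eapply is_derive_cont; dauto); cauto.
        - intros u Hu; apply Rmult_le_pos; [left; apply exp_pos|].
          assert (G := Hnn 0%nat u ltac:(lia) ltac:(lra)); assert (G3 := Hnn 3%nat u ltac:(lia) ltac:(lra)).
          unfold margins in G, G3; nra. }
      rewrite Hz, Rmult_0_r, exp_0, l0, Rmult_0_r in H; lra.
    + assert (H : is_derive (fun t => K t - / 2) t (1 + 2 * (l t ^ 2 * P t ^ 2) - K t ^ 2)) by (derive_by; ring).
      apply derive_at_first_zero in H; [|lra| |assumption].
      * assert (K t = / 2) by lra; nra.
      * intros u Hu; apply (Hbefore 1%nat u); [lia|assumption].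
    + assert (H : is_derive (fun t => 15 * L + 1 - K t) t (- (1 + 2 * (l t ^ 2 * P t ^ 2) - K t ^ 2))) by (derive_by; ring).
      apply derive_at_first_zero in H; [|lra| |assumption].
      * assert (K t = 15 * L + 1) by lra; nra.
      * intros u Hu; apply (Hbefore 2%nat u); [lia|assumption].
    + assert (H : is_derive (fun t => 2 - N t) t (- ((K t - N t) * N t - 2 * (l t ^ 2 * P t ^ 2)))) by (derive_by; ring).
      apply derive_at_first_zero in H; [|lra| |assumption].
      * unfold constraint in HC; assert (HN2 : N t = 2) by lra; rewrite HN2 in *; lra.
      * intros u Hu; apply (Hbefore 3%nat u); [lia|assumption].
    + lra.
    + lra.
    + assert (H : - W 0 <= - W t); [|lra].
      apply (monotone_by_derive (fun t => - W t) (fun t => - P t)); [lra| | |].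
      * intros u Hu; destruct (HE u ltac:(lra)) as [_ [D _]]; derive_by; ring.
      * intros u Hu; specialize (CW u); cauto.
      * intros u Hu; destruct (Hclosed u ltac:(lra)) as [_ [? _]]; lra. }
assert (HE : forall t, 0 <= t <= s -> equations_at l W P N K t).
{ intros t Ht; apply Heq; [assumption|]; intros i Hi; left; now apply Hpos. }
intros t Ht; split; [|split].
- destruct (Hclosed t Ht) as [? [? ?]].
  assert (F0 := Hpos 0%nat t ltac:(lia) Ht); assert (F1 := Hpos 1%nat t ltac:(lia) Ht); assert (F2 := Hpos 2%nat t ltac:(lia) Ht);
  assert (F3 := Hpos 3%nat t ltac:(lia) Ht); assert (F4 := Hpos 4%nat t ltac:(lia) Ht);
  assert (F6 := Hpos 6%nat t ltac:(lia) Ht); unfold margins in *.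
  assert (l t <= L); [|unfold in_range; lra].
  rewrite <- l0; apply Ropp_le_cancel.
  apply (monotone_by_derive (fun t => - l t) (fun t => N t * l t)); [lra| | |].
  + intros u Hu; destruct (HE u ltac:(lra)) as [D _]; derive_by; ring.
  + intros u Hu; specialize (Cl u); cauto.
  + intros u Hu; destruct (Hclosed u ltac:(lra)); assert (G := Hpos 0%nat u ltac:(lia) ltac:(lra)); unfold margins in G; nra.
- now apply HE.
- apply constraint_preserved; [lra| |].
  + intros u Hu; apply HE; lra.
  + intros u Hu; apply Hclosed; lra.
Qed.

(** The orbit leaves the good region only transversally: on [W = -1] the
    constraint excludes [N = 0] and uniqueness excludes [P = 0]. *)
Lemma exit_alternative s : 0 < s -> (forall t, 0 <= t < s -> good W P N t) ->
  good W P N s \/ (W s = -1 /\ 0 < N s /\ P s < 0) \/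
  (-1 < W s /\ ((N s = 0 /\ P s < 0) \/ (P s = 0 /\ W s < 0))).
Proof.
intros Hs Hgood.
assert (HA := apriori s ltac:(lra) Hgood).
destruct (HA s ltac:(lra)) as [[Hl [HW [HP [HN HK]]]] [[D1 [D2 [D3 [D4 D5]]]] HC]].
assert (Hlow : W s = -1 -> 0 < N s).
{ intros HW1; destruct (Req_dec (N s) 0) as [HN0|]; [exfalso|lra].
  unfold constraint in HC; rewrite HW1, HN0 in HC.
  assert (0 <= l s ^ 2 * P s ^ 2) by (apply Rmult_le_pos; apply pow2_ge_0); lra. }
assert (HP0 := o_P0 _ _ _ _ _ _ orb).
assert (Hne : P s = 0 -> W s < 0 /\ -1 < W s).
{ intros HPs.
  assert (H1 : W s <> -1).
  { intros HW1; apply (linear_no_double_zero (fun t => W t + 1) P (fun t => - W t * (1 - W t))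
      (fun t => 2 * N t - K t) (15 * L + 1) s); try lra.
    - intros t Ht; destruct (HA t Ht) as [_ [[_ [D _]] _]]; derive_by; ring.
    - intros t Ht; destruct (HA t Ht) as [_ [[_ [_ [D _]]] _]]; eapply is_derive_eq; [exact D|]; ring.
    - intros t Ht; destruct (HA t Ht) as [[_ [HWt _]] _]; apply Rabs_le; nra.
    - intros t Ht; destruct (HA t Ht) as [[_ [_ [_ [HNt HKt]]]] _]; lra. }
  assert (H2 : W s <> 0).
  { intros HW1; apply (linear_no_double_zero W P (fun t => - (1 - W t ^ 2))
      (fun t => 2 * N t - K t) (15 * L + 1) s); try lra.
    - intros t Ht; destruct (HA t Ht) as [_ [[_ [D _]] _]]; exact D.
    - intros t Ht; destruct (HA t Ht) as [_ [[_ [_ [D _]]] _]]; eapply is_derive_eq; [exact D|]; ring.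
    - intros t Ht; destruct (HA t Ht) as [[_ [HWt _]] _]; apply Rabs_le; nra.
    - intros t Ht; destruct (HA t Ht) as [[_ [_ [_ [HNt HKt]]]] _]; lra. }
  assert (H : is_derive (fun t => - P t) s (- ((2 * N s - K s) * P s - W s * (1 - W s ^ 2)))) by (derive_by; ring).
  apply derive_at_first_zero in H; [|lra| |lra].
  - rewrite HPs in H; assert (0 < 1 - W s ^ 2) by nra.
    split; [|lra]; destruct (Rle_dec (W s) 0); [lra|exfalso]; nra.
  - intros u Hu; destruct (Hgood u Hu); lra. }
destruct (Req_dec (P s) 0) as [HPs|HPs].
{ right; right; destruct (Hne HPs); split; [assumption|right; split; assumption]. }
destruct (Req_dec (W s) (-1)) as [HWs|HWs].
{ right; left; specialize (Hlow HWs); lra. }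
destruct (Req_dec (N s) 0) as [HNs|HNs].
{ right; right; split; [lra|left; lra]. }
left; unfold good; lra.
Qed.

Lemma low_exit s : 0 < s -> (forall t, 0 <= t < s -> good W P N t) ->
  W s = -1 -> 0 < N s -> P s < 0 -> exits_low W P N.
Proof.
intros Hs Hgood HW1 HN1 HP1.
destruct (apriori s ltac:(lra) Hgood s ltac:(lra)) as [_ [[_ [D2 _]] _]].
assert (CP := o_P_cont _ _ _ _ _ _ orb s); assert (CN := o_N_cont _ _ _ _ _ _ orb s).
destruct (decreases_after W s _ D2 HP1) as [e1 [He1 H1]].
destruct (stays_positive N s CN HN1) as [e2 [He2 H2]].
destruct (stays_positive (fun t => - P t) s ltac:(cauto) ltac:(lra)) as [e3 [He3 H3]].
pose (h := Rmin e1 (Rmin e2 e3) / 2).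
assert (L1 := Rmin_l e1 (Rmin e2 e3)); assert (L2 := Rmin_r e1 (Rmin e2 e3)).
assert (L3 := Rmin_l e2 e3); assert (L4 := Rmin_r e2 e3).
assert (L5 : 0 < Rmin e1 (Rmin e2 e3)) by (repeat apply Rmin_pos; lra).
exists (s + h); split; [unfold h; lra|]; split.
- specialize (H1 h ltac:(unfold h; lra)); lra.
- intros t Ht; destruct (Rlt_dec t s) as [Hts|Hts].
  + destruct (Hgood t ltac:(lra)) as [? [? ?]]; lra.
  + replace t with (s + (t - s)) by ring.
    specialize (H2 (t - s) ltac:(unfold h in *; lra)); specialize (H3 (t - s) ltac:(unfold h in *; lra)); lra.
Qed.

(** At the exit found by [exit_alternative] the vanishing quantity has nonzero
    derivative, so its sign changes right after. *)
Lemma exit_classification s : 0 < s -> (forall t, 0 <= t < s -> good W P N t) ->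
  good W P N s \/ exits_low W P N \/ exits_other W P N.
Proof.
intros Hs Hgood.
destruct (apriori s ltac:(lra) Hgood s ltac:(lra)) as [[Hl [HW [HP [HN HK]]]] [[D1 [D2 [D3 [D4 D5]]]] HC]].
assert (CW := o_W_cont _ _ _ _ _ _ orb s); assert (CP := o_P_cont _ _ _ _ _ _ orb s);
assert (CN := o_N_cont _ _ _ _ _ _ orb s).
destruct (exit_alternative s Hs Hgood) as [H|[[HW1 [HN1 HP1]]|[HW1 Hor]]]; [now left| |].
- right; left; now apply (low_exit s).
- right; right.
  destruct (stays_positive (fun t => W t + 1) s ltac:(cauto) ltac:(lra)) as [e2 [He2 H2]].
  assert (Hx : exists e1, 0 < e1 /\ forall h, 0 < h < e1 -> N (s + h) < 0 \/ 0 < P (s + h)).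
  { destruct Hor as [[HN1 HP1]|[HP1 HWn]].
    - assert (Hneg : (K s - N s) * N s - 2 * (l s ^ 2 * P s ^ 2) < 0).
      { rewrite HN1; assert (0 < l s ^ 2) by (apply pow_lt; lra).
        assert (0 < P s ^ 2) by nra; nra. }
      destruct (decreases_after N s _ D4 Hneg) as [e1 [He1 H1]].
      exists e1; split; [assumption|]; intros h Hh; left; specialize (H1 h Hh); lra.
    - assert (D : is_derive (fun t => - P t) s (W s * (1 - W s ^ 2))) by (derive_by; rewrite HP1; ring).
      destruct (decreases_after _ s _ D) as [e1 [He1 H1]].
      { assert (0 < 1 - W s ^ 2) by nra; nra. }
      exists e1; split; [assumption|]; intros h Hh; right; specialize (H1 h Hh); lra. }
  destruct Hx as [e1 [He1 H1]].
  pose (h := Rmin e1 e2 / 2).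
  assert (L1 := Rmin_l e1 e2); assert (L2 := Rmin_r e1 e2).
  assert (L5 : 0 < Rmin e1 e2) by (repeat apply Rmin_pos; lra).
  exists (s + h); split; [unfold h; lra|]; split.
  + apply H1; unfold h; lra.
  + intros t Ht; destruct (Rlt_dec t s) as [Hts|Hts].
    * destruct (Hgood t ltac:(lra)) as [? [? ?]]; lra.
    * replace t with (s + (t - s)) by ring.
      specialize (H2 (t - s) ltac:(unfold h in *; lra)); lra.
Qed.

Lemma good_0 : good W P N 0.
Proof.
assert (W0 := o_W0 _ _ _ _ _ _ orb); assert (P0 := o_P0 _ _ _ _ _ _ orb); assert (N0 := o_N0 _ _ _ _ _ _ orb).
unfold good; lra.
Qed.

Lemma good_induction s : 0 <= s ->
  (forall t, 0 < t <= s -> (forall u, 0 <= u < t -> good W P N u) -> good W P N t) ->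
  forall t, 0 <= t <= s -> good W P N t.
Proof.
intros Hs Hstep.
assert (CW := o_W_cont _ _ _ _ _ _ orb); assert (CP := o_P_cont _ _ _ _ _ _ orb);
assert (CN := o_N_cont _ _ _ _ _ _ orb); assert (H0 := good_0).
assert (H : forall i t, (i < 3)%nat -> 0 <= t <= s ->
  0 < match i with O => N t | 1%nat => - P t | _ => W t + 1 end).
{ apply (first_exit 3 (fun i t => match i with O => N t | 1%nat => - P t | _ => W t + 1 end)); [assumption| | |].
  - intros i t Hi Ht; specialize (CW t); specialize (CP t); specialize (CN t);
    destruct i as [|[|i]]; cauto.
  - intros i Hi; destruct H0 as [? [? ?]]; destruct i as [|[|i]]; lra.
  - intros t Ht Hb _ i Hi.
    destruct (Hstep t Ht) as [? [? ?]].
    + intros u Hu; assert (B0 := Hb 0%nat u ltac:(lia) Hu); assert (B1 := Hb 1%nat u ltac:(lia) Hu);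
      assert (B2 := Hb 2%nat u ltac:(lia) Hu); cbv beta iota in *; unfold good; lra.
    + destruct i as [|[|i]]; lra. }
intros t Ht; assert (B0 := H 0%nat t ltac:(lia) Ht); assert (B1 := H 1%nat t ltac:(lia) Ht);
assert (B2 := H 2%nat t ltac:(lia) Ht); cbv beta iota in *; unfold good; lra.
Qed.

Lemma good_forever : ~ exits_low W P N -> ~ exits_other W P N -> forall t, 0 <= t -> good W P N t.
Proof.
intros H1 H2 t Ht; apply (good_induction t Ht); [|lra].
intros u Hu Hgood; destruct (exit_classification u ltac:(lra) Hgood) as [|[|]]; [assumption|contradiction|contradiction].
Qed.

End Orbit.

(** [(1 - N^2) / l] is the mass function [r (1 - A)]. *)
Lemma mass_derive (l W P N K : R -> R) (t : R) : 0 < l t -> equations_at l W P N K t ->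
  constraint l W P N K t = 0 ->
  is_derive (fun t => (1 - N t ^ 2) / l t) t (N t * l t * (2 * P t ^ 2 + (1 - W t ^ 2) ^ 2)).
Proof.
intros Hl [D1 [_ [_ [D4 _]]]] HC.
derive_by; [lra|].
unfold constraint in HC.
assert (HC' : N t * l t * (2 * P t ^ 2 + (1 - W t ^ 2) ^ 2)
  = (N t * l t * l t * l t * (2 * P t ^ 2 + (1 - W t ^ 2) ^ 2)
     - N t * l t * (2 * K t * N t - 1 - N t ^ 2 - 2 * (l t ^ 2 * P t ^ 2) + l t ^ 2 * (1 - W t ^ 2) ^ 2)) / l t ^ 2).
{ rewrite HC; field; lra. }
rewrite HC'; simpl; field; lra.
Qed.

Lemma l_decreasing (L : R) (l W P N K : R -> R) (s t : R) : s <= t ->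
  (forall u, s <= u <= t -> in_range L l W P N K u /\ equations_at l W P N K u /\ constraint l W P N K u = 0) ->
  l t <= l s.
Proof.
intros Hst H; apply Ropp_le_cancel.
apply (monotone_by_derive (fun t => - l t) (fun t => N t * l t)); [assumption| | |].
- intros u Hu; destruct (H u ltac:(lra)) as [_ [[D _] _]]; derive_by; ring.
- intros u Hu; destruct (H u ltac:(lra)) as [_ [[D _] _]].
  assert (C := is_derive_cont _ _ _ D); cauto.
- intros u Hu; destruct (H u ltac:(lra)) as [[Hl [_ [_ [HN _]]]] _]; apply Rmult_le_pos; lra.
Qed.

(** The mass density is bounded, so the mass gained between two radii is at
    most a multiple of the decrease of [l = 1/r]. *)
Lemma mass_growth (L : R) (l W P N K : R -> R) (s t : R) : s <= t ->
  (forall u, s <= u <= t -> in_range L l W P N K u /\ equations_at l W P N K u /\ constraint l W P N K u = 0) ->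
  (1 - N s ^ 2) / l s <= (1 - N t ^ 2) / l t /\
  (1 - N t ^ 2) / l t + 201 * l t <= (1 - N s ^ 2) / l s + 201 * l s.
Proof.
intros Hst H.
assert (D : forall u, s <= u <= t -> is_derive (fun t => (1 - N t ^ 2) / l t) u
  (N u * l u * (2 * P u ^ 2 + (1 - W u ^ 2) ^ 2))).
{ intros u Hu; destruct (H u Hu) as [[Hl _] [E HC]]; now apply (mass_derive l W P N K). }
assert (B : forall u, s <= u <= t -> 0 <= N u * l u /\ 0 <= 2 * P u ^ 2 + (1 - W u ^ 2) ^ 2 <= 201).
{ intros u Hu; destruct (H u Hu) as [[Hl [HW [HP [HN HK]]]] _].
  assert (0 <= P u ^ 2 <= 100) by (split; nra).
  assert (0 <= 1 - W u ^ 2 <= 1) by (split; nra).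
  assert (0 <= (1 - W u ^ 2) ^ 2 <= 1) by (split; nra).
  split; [apply Rmult_le_pos|]; lra. }
split.
- apply (monotone_by_derive (fun t => (1 - N t ^ 2) / l t) (fun u => N u * l u * (2 * P u ^ 2 + (1 - W u ^ 2) ^ 2))); [assumption| | |].
  + intros u Hu; apply D; lra.
  + intros u Hu; eapply is_derive_cont; apply D; lra.
  + intros u Hu; destruct (B u ltac:(lra)) as [B1 [B2 _]]; now apply Rmult_le_pos.
- assert (M : - ((1 - N s ^ 2) / l s + 201 * l s) <= - ((1 - N t ^ 2) / l t + 201 * l t)); [|lra].
  assert (D2 : forall u, s <= u <= t -> is_derive (fun t => - ((1 - N t ^ 2) / l t + 201 * l t)) u
    ((N u * l u) * (201 - (2 * P u ^ 2 + (1 - W u ^ 2) ^ 2)))).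
  { intros u Hu; assert (D1 := D u Hu); destruct (H u Hu) as [_ [[Dl _] _]].
    eapply is_derive_eq.
    - apply (dopp (fun t => (1 - N t ^ 2) / l t + 201 * l t)).
      apply (dplus (fun t => (1 - N t ^ 2) / l t)); [exact D1|dauto].
    - cbv beta; ring. }
  apply (monotone_by_derive (fun t => - ((1 - N t ^ 2) / l t + 201 * l t))
    (fun u => (N u * l u) * (201 - (2 * P u ^ 2 + (1 - W u ^ 2) ^ 2)))); [assumption| | |].
  + intros u Hu; apply D2; lra.
  + intros u Hu; eapply is_derive_cont; apply D2; lra.
  + intros u Hu; destruct (B u ltac:(lra)) as [B1 [_ B2]]; apply Rmult_le_pos; lra.
Qed.

(** * Asymptotics of an orbit that stays in the good region *)

Definition tends (f : R -> R) (c : R) : Prop :=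
  forall e, 0 < e -> exists T, 0 <= T /\ forall t, T <= t -> Rabs (f t - c) < e.

Lemma tends_common f g c d e : tends f c -> tends g d -> 0 < e ->
  exists T, 0 <= T /\ forall t, T <= t -> Rabs (f t - c) < e /\ Rabs (g t - d) < e.
Proof.
intros Hf Hg He; destruct (Hf e He) as [T1 [HT1 H1]]; destruct (Hg e He) as [T2 [HT2 H2]].
exists (Rmax T1 T2); assert (L1 := Rmax_l T1 T2); assert (L2 := Rmax_r T1 T2).
split; [lra|]; intros t Ht; split; [apply H1 | apply H2]; lra.
Qed.

Lemma tends_const c : tends (fun _ => c) c.
Proof. intros e He; exists 0; split; [lra|]; intros; rewrite Rminus_diag, Rabs_R0; exact He. Qed.

Lemma tends_plus f g c d : tends f c -> tends g d -> tends (fun t => f t + g t) (c + d).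
Proof.
intros Hf Hg e He; destruct (tends_common f g c d (e / 2) Hf Hg ltac:(lra)) as [T [HT H]].
exists T; split; [assumption|]; intros t Ht; destruct (H t Ht) as [H1 H2].
apply Rabs_def2 in H1, H2; apply Rabs_def1; lra.
Qed.

Lemma tends_bounded_mult f g B : (forall t, 0 <= t -> Rabs (f t) <= B) -> tends g 0 ->
  tends (fun t => f t * g t) 0.
Proof.
intros Hf Hg e He.
assert (HB : 0 <= B) by (eapply Rle_trans; [apply Rabs_pos | apply (Hf 0 (Rle_refl 0))]).
destruct (Hg (e / (B + 1)) ltac:(apply Rdiv_lt_0_compat; lra)) as [T [HT H]].
exists T; split; [assumption|]; intros t Ht; specialize (H t Ht); specialize (Hf t ltac:(lra)).
rewrite Rminus_0_r in H |- *; rewrite Rabs_mult.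
apply Rlt_div_r in H; [|lra]; assert (P1 := Rabs_pos (g t)); assert (P2 := Rabs_pos (f t)); nra.
Qed.

Lemma tends_squeeze f g c T0 : 0 <= T0 -> (forall t, T0 <= t -> Rabs (f t - c) <= g t) ->
  tends g 0 -> tends f c.
Proof.
intros HT0 Hf Hg e He; destruct (Hg e He) as [T [HT H]].
exists (Rmax T0 T); assert (L1 := Rmax_l T0 T); assert (L2 := Rmax_r T0 T).
split; [lra|]; intros t Ht; specialize (H t ltac:(lra)); specialize (Hf t ltac:(lra)).
rewrite Rminus_0_r in H; apply Rabs_def2 in H; lra.
Qed.

Lemma tends_ext f g c : (forall t, 0 <= t -> f t = g t) -> tends f c -> tends g c.
Proof.
intros Hfg Hf e He; destruct (Hf e He) as [T [HT H]]; exists T; split; [assumption|].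
intros t Ht; rewrite <- Hfg by lra; now apply H.
Qed.

Lemma tends_sq f : tends (fun t => f t ^ 2) 0 -> tends f 0.
Proof.
intros Hf e He; destruct (Hf (e ^ 2) ltac:(apply pow_lt; lra)) as [T [HT H]].
exists T; split; [assumption|]; intros t Ht; specialize (H t Ht).
rewrite Rminus_0_r in H |- *; rewrite (Rabs_pos_eq (f t ^ 2)) in H by apply pow2_ge_0.
rewrite <- pow2_abs in H; assert (P := Rabs_pos (f t)); nra.
Qed.

Lemma tends_decreasing f B : (forall s t, 0 <= s <= t -> f t <= f s) -> (forall t, 0 <= t -> B <= f t) ->
  exists c, tends f c /\ forall t, 0 <= t -> c <= f t.
Proof.
intros Hmono HB.
pose (E := fun x => exists t, 0 <= t /\ x = - f t).
destruct (completeness E) as [m [Hub Hlub]].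
- exists (- B); intros x [t [Ht ->]]; specialize (HB t Ht); lra.
- exists (- f 0), 0; split; [lra|reflexivity].
- assert (Hm : forall t, 0 <= t -> - m <= f t).
  { intros t Ht; assert (- f t <= m); [|lra]; apply Hub; exists t; split; [assumption|reflexivity]. }
  exists (- m); split; [|assumption].
  intros e He.
  destruct (Classical_Prop.classic (exists t, 0 <= t /\ f t < - m + e)) as [[T [HT H]]|Hn].
  + exists T; split; [assumption|]; intros t Ht; specialize (Hm t ltac:(lra)); specialize (Hmono T t ltac:(lra)).
    apply Rabs_def1; lra.
  + exfalso; assert (m <= m - e); [|lra].
    apply Hlub; intros x [t [Ht ->]].
    destruct (Rlt_dec (f t) (- m + e)); [|lra]; exfalso; apply Hn; now exists t.
Qed.

(** After the time at which [h < c e / 2], the function [g - e / 2] decays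
    exponentially. *)
Lemma tends_gronwall g dg h c T0 : 0 < c -> 0 <= T0 ->
  (forall t, T0 <= t -> is_derive g t (dg t)) -> (forall t, T0 <= t -> 0 <= g t) ->
  (forall t, T0 <= t -> dg t <= - c * g t + h t) -> tends h 0 -> tends g 0.
Proof.
intros Hc HT0 Hd Hg Hle Hh e He.
destruct (Hh (c * e / 2) ltac:(apply Rdiv_lt_0_compat; nra)) as [T1 [HT1 H1]].
pose (T := Rmax T0 T1); assert (L1 : T0 <= T) by apply Rmax_l; assert (L2 : T1 <= T) by apply Rmax_r.
pose (x := 2 * g T / (c * e)).
assert (Hx : 0 <= x) by (apply Rdiv_le_0_compat; [specialize (Hg T L1); lra | nra]).
exists (T + x); split; [lra|]; intros t Ht.
assert (H : - (exp (c * (T - T)) * (g T - e / 2)) <= - (exp (c * (t - T)) * (g t - e / 2))).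
{ apply (monotone_by_derive (fun t => - (exp (c * (t - T)) * (g t - e / 2)))
   (fun t => - (exp (c * (t - T)) * (dg t + c * g t - c * e / 2)))); [lra| | |].
  - intros u Hu; assert (D := Hd u ltac:(lra)); derive_by; field.
  - intros u Hu; assert (D := is_derive_cont _ _ _ (Hd u ltac:(lra))).
    assert (continuous (fun t => exp (c * (t - T))) u) by (eapply is_derive_cont; dauto); cauto.
  - intros u Hu; specialize (Hle u ltac:(lra)); specialize (H1 u ltac:(lra)).
    rewrite Rminus_0_r in H1; apply Rabs_def2 in H1.
    assert (P := exp_pos (c * (u - T))).
    assert (dg u + c * g u - c * e / 2 <= 0) by lra; nra. }
rewrite Rminus_diag, Rmult_0_r, exp_0, Rmult_1_l in H.
assert (E := exp_ineq1_le (c * (t - T))).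
assert (G := Hg t ltac:(lra)); assert (GT := Hg T L1).
assert (Hxt : 2 * g T <= e * (c * (t - T))).
{ replace (2 * g T) with (e * (c * x)) by (unfold x; field; split; lra).
  apply Rmult_le_compat_l; [lra|]; apply Rmult_le_compat_l; lra. }
rewrite Rminus_0_r, Rabs_pos_eq by assumption.
destruct (Rlt_dec (g t) e) as [|Hn]; [assumption|exfalso].
assert (exp (c * (t - T)) * (e / 2) <= exp (c * (t - T)) * (g t - e / 2)).
{ apply Rmult_le_compat_l; [left; apply exp_pos | lra]. }
nra.
Qed.

(** A derivative that stays above a positive constant makes the function
    unbounded. *)
Lemma derivative_limit_nonpos f df c B T0 : 0 <= T0 ->
  (forall t, T0 <= t -> is_derive f t (df t)) -> (forall t, T0 <= t -> Rabs (f t) <= B) ->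
  tends df c -> c <= 0.
Proof.
intros HT0 Hd HB Hl; destruct (Rle_dec c 0) as [|Hn]; [assumption|exfalso].
destruct (Hl (c / 2) ltac:(lra)) as [T1 [HT1 H1]].
pose (T := Rmax T0 T1); assert (L1 : T0 <= T) by apply Rmax_l; assert (L2 : T1 <= T) by apply Rmax_r.
assert (HB0 : 0 <= B) by (eapply Rle_trans; [apply Rabs_pos | apply (HB T0); lra]).
pose (t := T + (4 * B + 4) / c).
assert (Ht : T < t) by (unfold t; assert (0 < (4 * B + 4) / c) by (apply Rdiv_lt_0_compat; lra); lra).
assert (H : f T - c / 2 * T <= f t - c / 2 * t).
{ apply (monotone_by_derive (fun t => f t - c / 2 * t) (fun t => df t - c / 2)); [lra| | |].
  - intros u Hu; assert (D := Hd u ltac:(lra)); derive_by; ring.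
  - intros u Hu; assert (D := is_derive_cont _ _ _ (Hd u ltac:(lra))); cauto.
  - intros u Hu; specialize (H1 u ltac:(lra)); apply Rabs_def2 in H1; lra. }
assert (A1 := HB T L1); assert (A2 := HB t ltac:(lra)); apply Rabs_le_between in A1, A2.
assert (c / 2 * (t - T) = 2 * B + 2) by (unfold t; field; lra); lra.
Qed.

Lemma derivative_limit_zero f df c B T0 : 0 <= T0 ->
  (forall t, T0 <= t -> is_derive f t (df t)) -> (forall t, T0 <= t -> Rabs (f t) <= B) ->
  tends df c -> c = 0.
Proof.
intros HT0 Hd HB Hl; apply Rle_antisym.
- now apply (derivative_limit_nonpos f df c B T0).
- assert (- c <= 0); [|lra].
  apply (derivative_limit_nonpos (fun t => - f t) (fun t => - df t) (- c) B T0); [assumption| | |].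
  + intros t Ht; assert (D := Hd t Ht); derive_by; reflexivity.
  + intros t Ht; rewrite Rabs_Ropp; now apply HB.
  + intros e He; destruct (Hl e He) as [T [HT H]]; exists T; split; [assumption|]; intros t Ht.
    replace (- df t - - c) with (- (df t - c)) by ring; rewrite Rabs_Ropp; now apply H.
Qed.

Section Global.

Variables (L : R) (l W P N K : R -> R).
Hypothesis orb : orbit L l W P N K.
Hypothesis always_good : forall t, 0 <= t -> good W P N t.

Lemma L_ge_10 : 10 <= L.
Proof. exact (o_L _ _ _ _ _ _ orb). Qed.

Lemma global_facts t : 0 <= t -> in_range L l W P N K t /\ equations_at l W P N K t /\ constraint l W P N K t = 0.
Proof.
intros Ht; apply (apriori L l W P N K orb t Ht); [|lra].
intros u Hu; apply always_good; lra.
Qed.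

Lemma W_strictly_decreasing s t : 0 <= s < t -> W t < W s.
Proof.
intros Hst; apply Ropp_lt_cancel.
apply (strict_monotone_by_derive (fun t => - W t) (fun t => - P t)); [lra| | |].
- intros u Hu; destruct (global_facts u ltac:(lra)) as [_ [[_ [D _]] _]]; derive_by; reflexivity.
- intros u Hu; assert (C := o_W_cont _ _ _ _ _ _ orb u); cauto.
- intros u Hu; destruct (always_good u ltac:(lra)) as [_ [? _]]; lra.
Qed.

(** [P] is Lipschitz and the integral of [-P] is the finite drop of [W]. *)
Lemma P_tends_0 : tends P 0.
Proof.
assert (HL := L_ge_10).
destruct (tends_decreasing W (-1)) as [c [Hc _]].
- intros s t Hst; destruct (Req_dec s t) as [->|]; [lra|left; apply W_strictly_decreasing; lra].
- intros t Ht; destruct (always_good t Ht) as [_ [_ ?]]; lra.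
- pose (D := 10 * (15 * L + 1) + 1).
  assert (HD : forall t, 0 <= t -> (2 * N t - K t) * P t - W t * (1 - W t ^ 2) <= D).
  { intros t Ht; destruct (global_facts t Ht) as [[_ [HW [HP [HN HK]]]] _]; unfold D.
    assert (-1 <= W t * (1 - W t ^ 2) <= 1) by (assert (0 <= 1 - W t ^ 2 <= 1) by (split; nra); split; nra).
    assert ((2 * N t - K t) * P t <= (15 * L + 1) * 10) by nra; lra. }
  intros e He.
  pose (h := e / (2 * D)); assert (HD0 : 0 < D) by (unfold D; lra).
  assert (Hh : 0 < h) by (apply Rdiv_lt_0_compat; lra).
  destruct (Hc (h * e / 4) ltac:(apply Rdiv_lt_0_compat; nra)) as [T [HT H]].
  exists T; split; [assumption|]; intros t Ht.
  destruct (global_facts t ltac:(lra)) as [[_ [_ [HP _]]] _].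
  rewrite Rminus_0_r, Rabs_left1 by lra.
  destruct (Rlt_dec (- P t) e) as [|Hn]; [assumption|exfalso].
  assert (HPle : forall u, t <= u <= t + h -> P u <= - e / 2).
  { intros u Hu; assert (S : P u - P t <= D * (u - t)).
    { apply (slope_le_by_derive P (fun t => (2 * N t - K t) * P t - W t * (1 - W t ^ 2))); [lra| | |].
      - intros x Hx; destruct (global_facts x ltac:(lra)) as [_ [[_ [_ [D3 _]]] _]]; exact D3.
      - intros x Hx; apply (o_P_cont _ _ _ _ _ _ orb).
      - intros x Hx; apply HD; lra. }
    assert (D * h = e / 2) by (unfold h; field; lra); nra. }
  assert (S : W (t + h) - W t <= - e / 2 * (t + h - t)).
  { apply (slope_le_by_derive W P); [lra| | |].
    - intros x Hx; destruct (global_facts x ltac:(lra)) as [_ [[_ [D2 _]] _]]; exact D2.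
    - intros x Hx; apply (o_W_cont _ _ _ _ _ _ orb).
    - intros x Hx; apply HPle; lra. }
  assert (A1 := H t Ht); assert (A2 := H (t + h) ltac:(lra)); apply Rabs_def2 in A1, A2.
  nra.
Qed.

Lemma Q_tends_0 : tends (fun t => l t ^ 2 * P t ^ 2) 0.
Proof.
assert (HL := L_ge_10).
apply (tends_ext (fun t => (l t ^ 2 * P t) * P t)); [intros; ring|].
apply tends_bounded_mult with (L ^ 2 * 10); [|apply P_tends_0].
intros t Ht; destruct (global_facts t Ht) as [[Hl [_ [HP _]]] _].
rewrite Rabs_mult; apply Rmult_le_compat; try apply Rabs_pos.
- rewrite Rabs_pos_eq by apply pow2_ge_0; nra.
- apply Rabs_le; lra.
Qed.

(** The Riccati equation [K' = 1 - K^2 + 2 l^2 P^2] attracts [K] to 1, up to a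
    forcing that tends to zero. *)
Lemma K_tends_1 : tends K 1.
Proof.
assert (HL := L_ge_10).
assert (H : tends (fun t => K t - 1) 0).
{ apply tends_sq.
  apply (tends_gronwall (fun t => (K t - 1) ^ 2)
    (fun t => 2 * (K t - 1) * (1 + 2 * (l t ^ 2 * P t ^ 2) - K t ^ 2))
    (fun t => (4 * (15 * L + 1)) * (l t ^ 2 * P t ^ 2)) 3 0); try lra.
  - intros t Ht; destruct (global_facts t Ht) as [_ [[_ [_ [_ [_ D]]]] _]].
    derive_by; simpl; ring.
  - intros t Ht; apply pow2_ge_0.
  - intros t Ht; destruct (global_facts t Ht) as [[_ [_ [_ [_ HK]]]] _].
    assert (HQ : 0 <= l t ^ 2 * P t ^ 2) by (apply Rmult_le_pos; apply pow2_ge_0).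
    set (Q := l t ^ 2 * P t ^ 2) in *.
    assert (0 <= (K t - 1) ^ 2 * (2 * K t - 1)) by (apply Rmult_le_pos; [apply pow2_ge_0|lra]).
    assert (Q * (K t - 1) <= Q * (15 * L + 1)) by (apply Rmult_le_compat_l; lra).
    lra.
  - apply tends_bounded_mult with (4 * (15 * L + 1)); [|apply Q_tends_0].
    intros; rewrite Rabs_pos_eq; lra. }
intros e He; destruct (H e He) as [T [HT HH]]; exists T; split; [assumption|]; intros t Ht.
specialize (HH t Ht); now rewrite Rminus_0_r in HH.
Qed.

(** Near [W = 0] the equation is an underdamped oscillator, so [W] would have
    to cross zero: the angle [atan (-P/W)] would grow without bound. *)
Lemma W_limit_not_0 : ~ tends W 0.
Proof.
intros HW0; assert (HL := L_ge_10).
assert (HWpos : forall t, 0 <= t -> 0 < W t).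
{ intros t Ht; destruct (Rlt_dec 0 (W t)) as [|Hn]; [assumption|exfalso].
  assert (H1 := W_strictly_decreasing t (t + 1) ltac:(lra)).
  destruct (HW0 (- W (t + 1)) ltac:(lra)) as [T [HT H]].
  specialize (H (T + t + 2) ltac:(lra)).
  assert (H2 := W_strictly_decreasing (t + 1) (T + t + 2) ltac:(lra)).
  rewrite Rminus_0_r in H; apply Rabs_def2 in H; lra. }
destruct (tends_common W K 0 1 (/ 10) HW0 K_tends_1 ltac:(lra)) as [T [HT H]].
assert (M : atan (- P T / W T) - / 5 * T <= atan (- P (T + 10) / W (T + 10)) - / 5 * (T + 10)).
{ apply (monotone_by_derive (fun t => atan (- P t / W t) - / 5 * t)
   (fun t => ((- ((2 * N t - K t) * P t - W t * (1 - W t ^ 2))) * W t - (- P t) * P t) / W t ^ 2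
               * / (1 + (- P t / W t) ^ 2) - / 5)); [lra| | |].
  - intros u Hu; destruct (global_facts u ltac:(lra)) as [_ [[_ [D2 [D3 _]]] _]].
    assert (Hu' := HWpos u ltac:(lra)).
    assert (Dphi : is_derive (fun t => - P t / W t) u
      (((- ((2 * N u - K u) * P u - W u * (1 - W u ^ 2))) * W u - (- P u) * P u) / W u ^ 2)).
    { derive_by; [lra|reflexivity]. }
    assert (Da := dcomp atan (fun t => - P t / W t) u _ _ (is_derive_atan _) Dphi).
    cbv beta in Da; derive_by; unfold Rsqr; field; split; [lra|]; nra.
  - intros u Hu; apply (cminus (fun t => atan (- P t / W t)) (fun t => / 5 * t)); [|cauto].
    assert (Hu' := HWpos u ltac:(lra)).
    apply (continuous_comp (fun t => - P t / W t) atan); [|apply continuous_atan].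
    assert (CP := o_P_cont _ _ _ _ _ _ orb u); assert (CW := o_W_cont _ _ _ _ _ _ orb u).
    unfold Rdiv; apply cmult; [cauto|apply cinv; [cauto|lra]].
  - intros u Hu; destruct (global_facts u ltac:(lra)) as [[_ [_ [HP [HN HK]]]] _].
    assert (Hu' := HWpos u ltac:(lra)).
    destruct (H u ltac:(lra)) as [H1 H2]; apply Rabs_def2 in H1, H2.
    set (phi := - P u / W u).
    assert (Hphi : 0 <= phi) by (apply Rdiv_le_0_compat; lra).
    replace (((- ((2 * N u - K u) * P u - W u * (1 - W u ^ 2))) * W u - (- P u) * P u) / W u ^ 2)
      with ((2 * N u - K u) * phi + (1 - W u ^ 2) + phi ^ 2) by (unfold phi; field; lra).
    assert (Hd : 0 < 1 + phi ^ 2) by (assert (0 <= phi ^ 2) by apply pow2_ge_0; lra).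
    apply (Rmult_le_reg_r (1 + phi ^ 2)); [assumption|].
    rewrite Rmult_0_l.
    replace (((((2 * N u - K u) * phi + (1 - W u ^ 2) + phi ^ 2) * / (1 + phi ^ 2)) - / 5) * (1 + phi ^ 2))
      with ((2 * N u - K u) * phi + (1 - W u ^ 2) + phi ^ 2 - / 5 * (1 + phi ^ 2)) by (field; lra).
    assert (W u ^ 2 <= / 100) by nra.
    assert (- (11 / 10) * phi <= (2 * N u - K u) * phi) by (apply Rmult_le_compat_r; lra).
    assert (0 <= (phi - 11 / 16) ^ 2) by apply pow2_ge_0.
    nra. }
destruct (atan_bound (- P (T + 10) / W (T + 10))) as [_ B2].
assert (B1 : 0 < atan (- P T / W T)).
{ rewrite <- atan_0; apply atan_increasing.
  destruct (always_good T HT) as [_ [? _]]; apply Rdiv_lt_0_compat; [lra|now apply HWpos]. }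
assert (H4 := PI_4); lra.
Qed.

(** [P'] converges since [P] and [W] do, hence to zero: the limit of [W] is a
    zero of [W (1 - W^2)]. *)
Lemma W_tends_m1 : tends W (-1).
Proof.
assert (HL := L_ge_10).
destruct (tends_decreasing W (-1)) as [c [Hc Hcle]].
- intros s t Hst; destruct (Req_dec s t) as [->|]; [lra|left; apply W_strictly_decreasing; lra].
- intros t Ht; destruct (always_good t Ht) as [_ [_ ?]]; lra.
- assert (Hc1 : -1 <= c < 1).
  { split.
    - destruct (Rle_dec (-1) c) as [|Hn]; [assumption|exfalso].
      destruct (Hc (-1 - c) ltac:(lra)) as [T [HT H]]; specialize (H T ltac:(lra)).
      destruct (always_good T HT) as [_ [_ ?]]; apply Rabs_def2 in H; lra.
    - specialize (Hcle 0 ltac:(lra)); assert (W0 := o_W0 _ _ _ _ _ _ orb); lra. }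
  assert (Hz : - (c * (1 - c ^ 2)) = 0).
  { apply (derivative_limit_zero P (fun t => (2 * N t - K t) * P t - W t * (1 - W t ^ 2)) _ 10 0); [lra| | |].
    - intros t Ht; destruct (global_facts t Ht) as [_ [[_ [_ [D3 _]]] _]]; exact D3.
    - intros t Ht; destruct (global_facts t Ht) as [[_ [_ [HP _]]] _]; apply Rabs_le; lra.
    - replace (- (c * (1 - c ^ 2))) with (0 + - (c * (1 - c ^ 2))) by ring.
      apply (tends_plus (fun t => (2 * N t - K t) * P t) (fun t => - (W t * (1 - W t ^ 2)))).
      + apply tends_bounded_mult with (15 * L + 1); [|apply P_tends_0].
        intros t Ht; destruct (global_facts t Ht) as [[_ [_ [_ [HN HK]]]] _]; apply Rabs_le; lra.
      + assert (HWc : tends (fun t => W t - c) 0).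
        { intros e He; destruct (Hc e He) as [T [HT H]]; exists T; split; [assumption|]; intros t Ht.
          rewrite Rminus_0_r; now apply H. }
        assert (Hm := tends_bounded_mult (fun t => - (1 - (W t ^ 2 + W t * c + c ^ 2))) (fun t => W t - c) 4).
        apply (tends_squeeze _ (fun t => Rabs (- (1 - (W t ^ 2 + W t * c + c ^ 2)) * (W t - c))) _ 0); [lra| |].
        * intros t Ht; right; f_equal; ring.
        * intros e He; destruct Hm with (e := e) as [T [HT H]]; try assumption.
          -- intros t Ht; destruct (global_facts t Ht) as [[_ [HW _]] _].
             apply Rabs_le; split; nra.
          -- exists T; split; [assumption|]; intros t Ht; specialize (H t Ht).
             rewrite Rminus_0_r in H |- *; now rewrite Rabs_Rabsolu. }
  assert (Hor : c = 0 \/ c = -1).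
  { assert (Hf : c * ((1 - c) * (c + 1)) = 0) by lra.
    apply Rmult_integral in Hf; destruct Hf as [|Hf]; [now left|right].
    apply Rmult_integral in Hf; destruct Hf; lra. }
  destruct Hor as [->| ->]; [exfalso; now apply W_limit_not_0 | assumption].
Qed.

(** By the constraint, [(N - 1)^2] is a combination of [K - 1], [1 + W] and
    [l^2 P^2] with bounded coefficients. *)
Lemma N_tends_1 : tends N 1.
Proof.
assert (HL := L_ge_10).
assert (H : tends (fun t => N t - 1) 0).
{ apply tends_sq.
  apply (tends_ext (fun t => (2 * N t) * (K t - 1) + ((l t ^ 2 * (1 - W t ^ 2) * (1 - W t)) * (1 + W t)
      + (-2) * (l t ^ 2 * P t ^ 2)))).
  { intros t Ht; destruct (global_facts t Ht) as [_ [_ HC]]; unfold constraint in HC.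
    replace ((N t - 1) ^ 2) with ((N t - 1) ^ 2 + (2 * K t * N t - 1 - N t ^ 2 - 2 * (l t ^ 2 * P t ^ 2)
      + l t ^ 2 * (1 - W t ^ 2) ^ 2)) by lra; ring. }
  replace 0 with (0 + (0 + 0)) by ring.
  apply (tends_plus (fun t => (2 * N t) * (K t - 1))); [|apply tends_plus].
  - apply tends_bounded_mult with 4.
    + intros t Ht; destruct (global_facts t Ht) as [[_ [_ [_ [HN HK]]]] _]; apply Rabs_le; lra.
    + intros e He; destruct (K_tends_1 e He) as [T [HT H]]; exists T; split; [assumption|]; intros t Ht.
      rewrite Rminus_0_r; now apply H.
  - apply tends_bounded_mult with (L ^ 2 * 1 * 2).
    + intros t Ht; destruct (global_facts t Ht) as [[Hl [HW _]] _].
      assert (0 <= 1 - W t ^ 2 <= 1) by (split; nra).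
      assert (0 <= l t ^ 2 <= L ^ 2) by (split; nra).
      rewrite Rabs_pos_eq by (repeat apply Rmult_le_pos; lra).
      apply Rmult_le_compat; [apply Rmult_le_pos; lra|lra| |lra].
      apply Rmult_le_compat; lra.
    + intros e He; destruct (W_tends_m1 e He) as [T [HT H]]; exists T; split; [assumption|]; intros t Ht.
      specialize (H t Ht); replace (1 + W t - 0) with (W t - -1) by ring; exact H.
  - apply tends_bounded_mult with 2; [|apply Q_tends_0].
    intros; rewrite Rabs_left; lra. }
intros e He; destruct (H e He) as [T [HT HH]]; exists T; split; [assumption|]; intros t Ht.
specialize (HH t Ht); now rewrite Rminus_0_r in HH.
Qed.

Lemma N_eventually : exists T, 0 <= T /\ forall t, T <= t -> / 2 <= N t.
Proof.
destruct (N_tends_1 (/ 2) ltac:(lra)) as [T [HT H]]; exists T; split; [assumption|].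
intros t Ht; specialize (H t Ht); apply Rabs_def2 in H; lra.
Qed.

Lemma l_tends_0 : tends l 0.
Proof.
destruct N_eventually as [T [HT H]].
apply (tends_gronwall l (fun t => - (N t * l t)) (fun _ => 0) (/ 2) T); try assumption; try lra.
- intros t Ht; destruct (global_facts t ltac:(lra)) as [_ [[D _] _]]; exact D.
- intros t Ht; destruct (global_facts t ltac:(lra)) as [[Hl _] _]; lra.
- intros t Ht; destruct (global_facts t ltac:(lra)) as [[Hl _] _]; specialize (H t Ht); nra.
- apply tends_const.
Qed.

Lemma mass_tends : exists m, tends (fun t => (1 - N t ^ 2) / l t) m.
Proof.
assert (G : forall s t, 0 <= s <= t -> (1 - N s ^ 2) / l s <= (1 - N t ^ 2) / l t /\
  (1 - N t ^ 2) / l t + 201 * l t <= (1 - N s ^ 2) / l s + 201 * l s).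
{ intros s t Hst; apply (mass_growth L l W P N K); [lra|]; intros u Hu; apply global_facts; lra. }
destruct (tends_decreasing (fun t => - ((1 - N t ^ 2) / l t)) (- ((1 - N 0 ^ 2) / l 0) - 201 * l 0)) as [c [Hc _]].
- intros s t Hst; apply Ropp_le_contravar, G, Hst.
- intros t Ht; destruct (G 0 t ltac:(lra)) as [_ G2]; destruct (global_facts t Ht) as [[Hl _] _]; lra.
- exists (- c); intros e He; destruct (Hc e He) as [T [HT H]]; exists T; split; [assumption|]; intros t Ht.
  specialize (H t Ht).
  replace ((1 - N t ^ 2) / l t - - c) with (- (- ((1 - N t ^ 2) / l t) - c)) by ring.
  now rewrite Rabs_Ropp.
Qed.

End Global.

(** * Nearly flat orbits *)

Section NearFlat.

Variables (L : R) (l W P N K : R -> R) (S : R).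
Hypothesis orb : orbit L l W P N K.
Hypothesis S_nonneg : 0 <= S.
Hypothesis near_flat : forall t, 0 <= t <= S ->
  Rabs (W t - 1) <= / 200 /\ Rabs (N t - 1) <= / 200 /\ Rabs (K t - 1) <= / 200.
Hypothesis far_out : l S <= / 100.

Lemma energy_derive t : equations_at l W P N K t ->
  is_derive (energy W P) t (2 * P t ^ 2 * (2 * N t - K t)).
Proof.
intros [_ [D2 [D3 _]]]; unfold energy; derive_by; [lra|]; simpl; field.
Qed.

Lemma energy_grows s t : 0 <= s <= t ->
  (forall u, s <= u <= t -> equations_at l W P N K u /\ 0 <= 2 * N u - K u) ->
  energy W P s <= energy W P t.
Proof.
intros Hst H; apply (monotone_by_derive _ (fun t => 2 * P t ^ 2 * (2 * N t - K t))); [lra| | |].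
- intros u Hu; apply energy_derive, H; lra.
- intros u Hu; eapply is_derive_cont, energy_derive, H; lra.
- intros u Hu; destruct (H u ltac:(lra)); apply Rmult_le_pos; [|assumption].
  generalize (pow2_ge_0 (P u)); lra.
Qed.

Lemma near_flat_good t : 0 <= t <= S -> good W P N t.
Proof.
apply (good_induction L l W P N K orb S S_nonneg); intros u Hu Hgood.
destruct (near_flat u ltac:(lra)) as [H1 [H2 _]]; apply Rabs_le_between in H1, H2.
destruct (exit_alternative L l W P N K orb u ltac:(lra) Hgood) as [|[|[_ [|]]]]; [assumption|lra|lra|lra].
Qed.

Lemma energy_pos_at_S : 0 < energy W P S.
Proof.
apply Rlt_le_trans with (energy W P 0); [apply (o_energy0 _ _ _ _ _ _ orb)|].
apply energy_grows; [lra|]; intros u Hu.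
destruct (apriori L l W P N K orb S S_nonneg ltac:(intros; apply near_flat_good; lra) u Hu) as [_ [E _]].
split; [exact E|]; destruct (near_flat u Hu) as [_ [H2 H3]]; apply Rabs_le_between in H2, H3; lra.
Qed.

(** Beyond [S] the mass cannot grow enough to spoil [A > 0.9], so the energy
    keeps increasing and the orbit stays away from [P = 0] and [N = 0]. *)
Lemma energy_stays_positive t : S <= t -> (forall u, 0 <= u < t -> good W P N u) ->
  0 < N t /\ energy W P S <= energy W P t.
Proof.
intros Ht Hgood.
assert (HA := apriori L l W P N K orb t ltac:(lra) Hgood).
assert (HN : forall u, S <= u <= t -> 92 / 100 <= N u ^ 2).
{ intros u Hu.
  destruct (mass_growth L l W P N K S u ltac:(lra) ltac:(intros; apply HA; lra)) as [_ M].
  destruct (HA u ltac:(lra)) as [[Hl [_ [_ [HNu _]]]] _].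
  destruct (HA S ltac:(lra)) as [[HlS _] _].
  assert (Hlu : l u <= l S).
  { apply (l_decreasing L l W P N K); [lra|]; intros; apply HA; lra. }
  assert (HNS : (1 - N S ^ 2) / l S <= / 20 / l S).
  { apply Rmult_le_compat_r; [left; apply Rinv_0_lt_compat; lra|].
    destruct (near_flat S ltac:(lra)) as [_ [H2 _]]; apply Rabs_le_between in H2; nra. }
  assert (H1 : (1 - N u ^ 2) / l u <= / 20 / l S + 201 * l S) by lra.
  apply (Rmult_le_compat_r (l u)) in H1; [|lra].
  replace ((1 - N u ^ 2) / l u * l u) with (1 - N u ^ 2) in H1 by (field; lra).
  assert (H2 : / 20 / l S * l u <= / 20).
  { apply (Rmult_le_reg_r (l S)); [lra|].
    replace (/ 20 / l S * l u * l S) with (/ 20 * l u) by (field; lra); lra. }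
  assert (l S * l u <= / 10000) by nra.
  lra. }
split.
- destruct (HA t ltac:(lra)) as [[_ [_ [_ [HNt _]]]] _]; specialize (HN t ltac:(lra)); nra.
- apply energy_grows; [lra|]; intros u Hu; destruct (HA u ltac:(lra)) as [[Hl [_ [HP [HNu HK]]]] [E HC]].
  split; [exact E|]; specialize (HN u Hu).
  assert (Hlu : l u <= / 100).
  { apply Rle_trans with (l S); [|assumption].
    apply (l_decreasing L l W P N K); [lra|]; intros; apply HA; lra. }
  unfold constraint in HC.
  assert (HQ : l u ^ 2 * P u ^ 2 <= / 100).
  { assert (0 <= l u ^ 2 <= / 10000) by (split; nra); assert (0 <= P u ^ 2 <= 100) by (split; nra); nra. }
  assert (HV : 0 <= l u ^ 2 * (1 - W u ^ 2) ^ 2) by (apply Rmult_le_pos; apply pow2_ge_0).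
  assert (0 < N u) by nra.
  assert (0 <= (2 * N u - K u) * N u) by nra.
  destruct (Rle_dec 0 (2 * N u - K u)); [assumption|exfalso; nra].
Qed.

(** Where the energy is positive, [|P|] is bounded below by its square root, so
    [W] cannot stay above -1. *)
Lemma near_flat_exits_low : exits_low W P N.
Proof.
destruct (Classical_Prop.classic (exits_low W P N)) as [|Hn]; [assumption|exfalso].
assert (HE := energy_pos_at_S).
assert (Hgood : forall t, 0 <= t -> good W P N t).
{ intros t Ht; apply (good_induction L l W P N K orb t Ht); [|lra].
  intros u Hu Hg.
  destruct (Rle_dec u S) as [HuS|HuS]; [apply near_flat_good; lra|].
  destruct (energy_stays_positive u ltac:(lra) Hg) as [HN He].
  assert (HP : P u <> 0).
  { intros HP; unfold energy at 2 in He; rewrite HP in He.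
    assert (0 <= (1 - W u ^ 2) ^ 2) by apply pow2_ge_0; lra. }
  destruct (exit_alternative L l W P N K orb u ltac:(lra) Hg) as [|[[H1 [H2 H3]]|[_ [|]]]]; [assumption| |lra|lra].
  exfalso; apply Hn; now apply (low_exit L l W P N K orb u). }
pose (k := energy W P S); assert (Hk : 0 < k) by exact HE.
pose (T := S + 3 / sqrt k).
assert (Hs : 0 < sqrt k) by now apply sqrt_lt_R0.
assert (HT : S < T) by (unfold T; assert (0 < 3 / sqrt k) by (apply Rdiv_lt_0_compat; lra); lra).
assert (M : W T - W S <= - sqrt k * (T - S)).
{ apply (slope_le_by_derive W P); [lra| | |].
  - intros u Hu; destruct (apriori L l W P N K orb u ltac:(lra) ltac:(intros; apply Hgood; lra) u ltac:(lra))
      as [_ [[_ [D2 _]] _]]; exact D2.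
  - intros u Hu; apply (o_W_cont _ _ _ _ _ _ orb).
  - intros u Hu; destruct (energy_stays_positive u ltac:(lra) ltac:(intros; apply Hgood; lra)) as [_ He].
    fold k in He; unfold energy in He; assert (0 <= (1 - W u ^ 2) ^ 2) by apply pow2_ge_0.
    destruct (Hgood u ltac:(lra)) as [_ [HP _]].
    assert (sqrt k <= - P u); [|lra].
    rewrite <- (sqrt_pow2 (- P u)) by lra; apply sqrt_le_1_alt; lra. }
assert (H3 : sqrt k * (T - S) = 3) by (unfold T; field; lra).
destruct (Hgood T ltac:(lra)) as [_ [_ HWT]].
destruct (near_flat S ltac:(lra)) as [H1 _]; apply Rabs_le_between in H1; lra.
Qed.

End NearFlat.

(** * Steep initial data: the orbit with parameter 2 *)

(** Barrier functions of the radius: [- w'] stays above [eta], [1 - w] above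
    its primitive [gam], and [A] below [alp]. *)
Definition eta (r : R) : R := 2 * r + 9 / 5 * r ^ 3.
Definition gam (r : R) : R := r ^ 2 + 9 / 20 * r ^ 4.
Definition alp (r : R) : R := 1 - 4 * r ^ 2 + 21 / 5 * r ^ 4.

(** In these quantities, [y = - w'], [V = (1 - w^2) / r]; the last inequality
    but one says that [Phi] is negative. *)
Definition steep (r w A V y : R) : Prop :=
  eta r < y /\ V < y /\ A * y < w * V /\ A < w ^ 2 /\ 0 < V ^ 2 + A - 1 /\ A < alp r.

(** The polynomial inequality, in [x = r^2], that makes [alp - A] increase where
    it vanishes, once [y] and [V] are replaced by their lower bounds; the range
    comes from [0.53^2 < 0.281]. *)
Lemma barrier_alp x : 0 < x <= 281 / 1000 ->
  0 < -12 * x + 21 * x ^ 2 + 2 * (1 - 4 * x + 21 / 5 * x ^ 2) * x * (2 + 9 / 5 * x) ^ 2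
      + x * (1 + 9 / 20 * x) ^ 2 * (2 - x - 9 / 20 * x ^ 2) ^ 2.
Proof.
intros Hx.
assert (H1 : 0 <= (x - 24 / 100) ^ 2 * (x + 48 / 100)) by (apply Rmult_le_pos; [apply pow2_ge_0|lra]).
assert (H2 : 0 < 3 - 2111 / 100 * x + 3393 / 100 * x ^ 2 + 28 * x ^ 3).
{ assert (0 <= (x - 24 / 100) ^ 2) by apply pow2_ge_0; nra. }
assert (H3 : 0 <= x ^ 3) by (apply pow_le; lra).
assert (H4 : 0 <= x ^ 4) by (apply pow_le; lra).
assert (H5 : 0 <= x ^ 5) by (apply pow_le; lra).
match goal with |- 0 < ?e => replace e with
  (x ^ 2 * (3 - 2111 / 100 * x + 3393 / 100 * x ^ 2 + 280665 / 10000 * x ^ 3 + 3645 / 10000 * x ^ 4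
        + 4100625 / 100000000 * x ^ 5)) by field end.
apply Rmult_lt_0_compat; [apply pow_lt|]; lra.
Qed.

(** The corresponding inequality for [y - eta]. *)
Lemma barrier_eta x : 0 < x <= 281 / 1000 ->
  (1 - 4 * x + 21 / 5 * x ^ 2) * (2 * x + 27 / 5 * x ^ 2)
  < (x + 9 / 20 * x ^ 2) * (1 - (x + 9 / 20 * x ^ 2)) * (2 - (x + 9 / 20 * x ^ 2)).
Proof.
intros Hx; apply Rlt_0_minus.
match goal with |- 0 < ?e => replace e with
  (x ^ 2 * (1 / 2 + 23 / 2 * x - 219375 / 10000 * x ^ 2 + 6075 / 10000 * x ^ 3 + 91125 / 1000000 * x ^ 4)) by field end.
assert (H3 : 0 <= x ^ 3) by (apply pow_le; lra).
assert (H4 : 0 <= x ^ 4) by (apply pow_le; lra).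
apply Rmult_lt_0_compat; [apply pow_lt; lra|]; nra.
Qed.

Section Barrier.

(** Time is parametrized so that [d/dt = N r d/dr]. *)
Variables (s : R) (N r W A V y : R -> R).
Hypothesis s_nonneg : 0 <= s.
Hypothesis N_pos : forall t, 0 <= t <= s -> 0 < N t.
Hypothesis r_pos : forall t, 0 <= t <= s -> 0 < r t.
Hypothesis A_pos : forall t, 0 <= t <= s -> 0 < A t.
Hypothesis W_range : forall t, 0 <= t <= s -> - / 5 <= W t < 1.
Hypothesis V_eq : forall t, 0 <= t <= s -> r t * V t = 1 - W t ^ 2.
Hypothesis dr : forall t, 0 <= t <= s -> is_derive r t (N t * r t).
Hypothesis dW : forall t, 0 <= t <= s -> is_derive W t (N t * (- r t * y t)).
Hypothesis dA : forall t, 0 <= t <= s -> is_derive A t (N t * (1 - A t - 2 * A t * y t ^ 2 - V t ^ 2)).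
Hypothesis dV : forall t, 0 <= t <= s -> is_derive V t (N t * (2 * W t * y t - V t)).
Hypothesis dy : forall t, 0 <= t <= s ->
  is_derive y t (N t * ((W t * V t - (1 - A t - V t ^ 2) * y t) / A t)).
Hypothesis start_steep : steep (r 0) (W 0) (A 0) (V 0) (y 0).
Hypothesis start_gam : gam (r 0) < 1 - W 0.
Hypothesis start_r : r 0 < 53 / 100.
Hypothesis V_small : forall t, 0 <= t <= s -> V t <= 1001 / 1000.

Definition steep_margins (i : nat) (t : R) : R := match i with
  | O => y t - eta (r t)
  | 1%nat => y t - V t
  | 2%nat => W t * V t - A t * y t
  | 3%nat => W t ^ 2 - A t
  | 4%nat => V t ^ 2 + A t - 1
  | 5%nat => alp (r t) - A t
  | _ => 53 / 100 - r t end.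

(** At the first time at which one of the margins vanishes, the other margins
    force its derivative to be positive.  The last margin needs no derivative:
    at [r = 0.53] the bound [1 - w > gam] would make [V > 1.001]. *)
Lemma steep_persists : forall i t, (i < 7)%nat -> 0 <= t <= s -> 0 < steep_margins i t.
Proof.
apply first_exit; [assumption| | |].
- intros i t Hi Ht.
  assert (C1 := is_derive_cont _ _ _ (dr t Ht)); assert (C2 := is_derive_cont _ _ _ (dW t Ht));
  assert (C3 := is_derive_cont _ _ _ (dA t Ht)); assert (C4 := is_derive_cont _ _ _ (dV t Ht));
  assert (C5 := is_derive_cont _ _ _ (dy t Ht)).
  destruct i as [|[|[|[|[|[|[|i]]]]]]]; unfold steep_margins, eta, alp; try lia; cauto.
- intros i Hi; destruct start_steep as [S0 [S1 [S2 [S3 [S4 S5]]]]].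
  destruct i as [|[|[|[|[|[|[|i]]]]]]]; unfold steep_margins; try lia; lra.
- intros t Ht Hb Hat i Hi Hz.
  assert (Hnn : forall i u, (i < 7)%nat -> 0 <= u <= t -> 0 <= steep_margins i u).
  { intros j u Hj Hu; destruct (Req_dec u t) as [->|]; [now apply Hat|].
    left; apply Hb; [assumption|lra]. }
  assert (Hgam : gam (r t) < 1 - W t).
  { assert (M : 1 - W 0 - gam (r 0) <= 1 - W t - gam (r t)); [|lra].
    apply (monotone_by_derive (fun t => 1 - W t - gam (r t)) (fun t => N t * (r t * (y t - eta (r t))))); [lra| | |].
    - intros u Hu; assert (D1 := dr u ltac:(lra)); assert (D2 := dW u ltac:(lra)).
      unfold gam, eta; derive_by; simpl; field.
    - intros u Hu; assert (C1 := is_derive_cont _ _ _ (dr u ltac:(lra)));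
      assert (C2 := is_derive_cont _ _ _ (dW u ltac:(lra))); unfold gam; cauto.
    - intros u Hu; assert (G := Hnn 0%nat u ltac:(lia) ltac:(lra)); unfold steep_margins in G.
      assert (N1 := N_pos u ltac:(lra)); assert (R1 := r_pos u ltac:(lra)).
      repeat apply Rmult_le_pos; lra. }
  assert (F0 := Hat 0%nat ltac:(lia)); assert (F1 := Hat 1%nat ltac:(lia)); assert (F2 := Hat 2%nat ltac:(lia));
  assert (F3 := Hat 3%nat ltac:(lia)); assert (F4 := Hat 4%nat ltac:(lia)); assert (F5 := Hat 5%nat ltac:(lia));
  assert (F6 := Hat 6%nat ltac:(lia)).
  unfold steep_margins in F0, F1, F2, F3, F4, F5, F6.
  assert (N1 := N_pos t ltac:(lra)); assert (R1 := r_pos t ltac:(lra)); assert (A1 := A_pos t ltac:(lra));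
  assert (W1 := W_range t ltac:(lra)); assert (E1 := V_eq t ltac:(lra)); assert (V1 := V_small t ltac:(lra)).
  assert (Hder : forall d, is_derive (steep_margins i) t (N t * d) -> 0 < d -> False).
  { intros d Hd Hpos; apply derive_at_first_zero in Hd; [nra|lra| |assumption].
    intros u Hu; apply Hb; [assumption|lra]. }
  assert (D1 := dr t ltac:(lra)); assert (D2 := dW t ltac:(lra)); assert (D3 := dA t ltac:(lra));
  assert (D4 := dV t ltac:(lra)); assert (D5 := dy t ltac:(lra)).
  clear Hb Hat Hnn.
  set (x := r t ^ 2) in *.
  assert (Hx : 0 < x <= 281 / 1000) by (unfold x; split; nra).
  assert (Hg : gam (r t) = x + 9 / 20 * x ^ 2) by (unfold gam, x; ring).
  assert (He : eta (r t) = r t * (2 + 9 / 5 * x)) by (unfold eta, x; ring).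
  assert (Ha : alp (r t) = 1 - 4 * x + 21 / 5 * x ^ 2) by (unfold alp, x; ring).
  rewrite Hg in Hgam; rewrite He in F0; rewrite Ha in F5.
  assert (HW68 : 68 / 100 < W t).
  { assert (HW2 : 4690 / 10000 <= W t ^ 2) by nra. nra. }
  set (g := 1 - W t) in *.
  assert (Hg32 : 0 < g < 32 / 100) by (unfold g; nra).
  assert (EV : r t * V t = g * (2 - g)) by (rewrite E1; unfold g; ring).
  assert (HVr : r t * (2 - x) < V t).
  { apply (Rmult_lt_reg_l (r t)); [assumption|]; rewrite EV.
    replace (r t * (r t * (2 - x))) with (x * (2 - x)) by (unfold x; ring); nra. }
  assert (HV17 : 17 / 10 * r t < V t).
  { apply Rle_lt_trans with (2 := HVr); rewrite (Rmult_comm (17 / 10)); apply Rmult_le_compat_l; lra. }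
  assert (HV0 : 0 < V t) by lra.
  assert (Hy0 : 0 < y t) by lra.
  assert (Hx2 : 0 <= x ^ 2) by apply pow2_ge_0.
  assert (HWA : 0 <= W t - A t).
  { assert (0 <= W t * (1 - W t)) by (apply Rmult_le_pos; unfold g in Hg32; lra); lra. }
  destruct i as [|[|[|[|[|[|[|i]]]]]]]; [| | | | | | |lia]; unfold steep_margins in Hz.
  + (* the slope: Phi < 0 gives y' >= w V / (r A) *)
    apply (Hder ((W t * V t - (1 - A t - V t ^ 2) * y t) / A t - (2 * r t + 27 / 5 * r t ^ 3))).
    { unfold steep_margins, eta; derive_by; simpl; field; lra. }
    assert (P1 : (x + 9 / 20 * x ^ 2) * (1 - (x + 9 / 20 * x ^ 2)) * (2 - (x + 9 / 20 * x ^ 2)) <= g * (1 - g) * (2 - g)).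
    { set (k := x + 9 / 20 * x ^ 2) in *; assert (0 < k) by (unfold k; lra).
      assert (0 <= (g - k) * (2 - 3 * (g + k) + (g ^ 2 + g * k + k ^ 2))); [|lra].
      assert (0 <= g ^ 2) by apply pow2_ge_0; assert (0 <= k ^ 2) by apply pow2_ge_0.
      assert (0 <= g * k) by (apply Rmult_le_pos; lra).
      apply Rmult_le_pos; lra. }
    assert (P2 := barrier_eta x Hx).
    assert (P3 : A t * (2 * x + 27 / 5 * x ^ 2) < W t * (r t * V t)).
    { rewrite EV; replace (W t) with (1 - g) by (unfold g; ring).
      assert (A t * (2 * x + 27 / 5 * x ^ 2) <= (1 - 4 * x + 21 / 5 * x ^ 2) * (2 * x + 27 / 5 * x ^ 2)).
      { apply Rmult_le_compat_r; lra. }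
      lra. }
    assert (P4 : A t * (2 * r t + 27 / 5 * r t ^ 3) < W t * V t).
    { apply (Rmult_lt_reg_l (r t)); [assumption|].
      replace (r t * (A t * (2 * r t + 27 / 5 * r t ^ 3))) with (A t * (2 * x + 27 / 5 * x ^ 2)) by (unfold x; ring).
      lra. }
    apply (Rmult_lt_reg_l (A t)); [assumption|].
    rewrite Rmult_0_r.
    replace (A t * ((W t * V t - (1 - A t - V t ^ 2) * y t) / A t - (2 * r t + 27 / 5 * r t ^ 3)))
      with (W t * V t + (V t ^ 2 + A t - 1) * y t - A t * (2 * r t + 27 / 5 * r t ^ 3)) by (field; lra).
    assert (0 <= (V t ^ 2 + A t - 1) * y t) by (apply Rmult_le_pos; lra); lra.
  + apply (Hder ((W t * V t - (1 - A t - V t ^ 2) * y t) / A t - (2 * W t * y t - V t))).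
    { unfold steep_margins; derive_by; field; lra. }
    assert (HyV : y t = V t) by lra; rewrite HyV.
    apply (Rmult_lt_reg_l (A t)); [assumption|]; rewrite Rmult_0_r.
    replace (A t * ((W t * V t - (1 - A t - V t ^ 2) * V t) / A t - (2 * W t * V t - V t)))
      with (V t * ((V t ^ 2 + A t - 1) + (W t - A t * (2 * W t - 1)))) by (field; lra).
    assert (A t * (2 * W t - 1) <= W t ^ 2 * (2 * W t - 1)) by (apply Rmult_le_compat_r; lra).
    assert (0 < W t - W t ^ 2 * (2 * W t - 1)).
    { replace (W t - W t ^ 2 * (2 * W t - 1)) with (W t * (1 - W t) * (1 + 2 * W t)) by ring.
      repeat apply Rmult_lt_0_compat; lra. }
    apply Rmult_lt_0_compat; lra.
  + (* r (A y)' = w V - 2 A y^3 *)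
    apply (Hder ((- r t * y t) * V t + W t * (2 * W t * y t - V t) - (W t * V t - 2 * A t * y t ^ 3))).
    { unfold steep_margins; derive_by; field; lra. }
    assert (HAy : W t * V t = A t * y t) by lra.
    replace ((- r t * y t) * V t + W t * (2 * W t * y t - V t) - (W t * V t - 2 * A t * y t ^ 3))
      with (y t * (2 * W t ^ 2 - r t * V t + 2 * A t * y t ^ 2) - 2 * (W t * V t)) by ring.
    rewrite HAy.
    replace (y t * (2 * W t ^ 2 - r t * V t + 2 * A t * y t ^ 2) - 2 * (A t * y t))
      with (y t * (2 * (W t ^ 2 - A t) + (2 * (A t * y t) * y t - r t * V t))) by ring.
    apply Rmult_lt_0_compat; [assumption|].
    assert (V t ^ 2 <= A t * y t * y t).
    { apply (Rmult_le_reg_l (A t)); [assumption|].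
      replace (A t * (A t * y t * y t)) with ((A t * y t) ^ 2) by ring; rewrite <- HAy.
      replace ((W t * V t) ^ 2) with (W t ^ 2 * V t ^ 2) by ring.
      apply Rmult_le_compat_r; [apply pow2_ge_0|lra]. }
    assert (r t * V t < 2 * V t * V t) by (apply Rmult_lt_compat_r; lra).
    lra.
  + apply (Hder (2 * W t * (- r t * y t) - (1 - A t - 2 * A t * y t ^ 2 - V t ^ 2))).
    { unfold steep_margins; derive_by; simpl; ring. }
    assert (HA : A t = W t ^ 2) by lra.
    replace (2 * W t * (- r t * y t) - (1 - A t - 2 * A t * y t ^ 2 - V t ^ 2))
      with (2 * (W t * y t) ^ 2 - 2 * r t * (W t * y t) + V t ^ 2 - r t * V t) by (rewrite E1, HA; ring).
    assert (0 <= (W t * y t - r t / 2) ^ 2) by apply pow2_ge_0.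
    assert (0 < (V t - 17 / 10 * r t) * V t) by (apply Rmult_lt_0_compat; lra).
    assert (0 < r t * (V t - 17 / 10 * r t)) by (apply Rmult_lt_0_compat; lra).
    lra.
  + apply (Hder (2 * V t * (2 * W t * y t - V t) + (1 - A t - 2 * A t * y t ^ 2 - V t ^ 2))).
    { unfold steep_margins; derive_by; simpl; ring. }
    assert (HA : 1 - A t = V t ^ 2) by lra.
    replace (2 * V t * (2 * W t * y t - V t) + (1 - A t - 2 * A t * y t ^ 2 - V t ^ 2))
      with (2 * (2 * W t * y t * V t - A t * y t ^ 2 - V t ^ 2)) by (rewrite HA; ring).
    assert (HV2 : 2 * g < V t ^ 2).
    { apply (Rmult_lt_reg_l x); [lra|].
      replace (x * V t ^ 2) with ((r t * V t) ^ 2) by (unfold x; ring); rewrite EV.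
      assert (2 < (2 - g) ^ 2).
      { assert (168 / 100 * (168 / 100) < (2 - g) * (2 - g)) by (apply Rmult_le_0_lt_compat; lra); lra. }
      assert (x * 2 < g * (2 - g) ^ 2) by (apply Rmult_le_0_lt_compat; lra).
      replace ((g * (2 - g)) ^ 2) with (g * (g * (2 - g) ^ 2)) by ring.
      apply Rle_lt_trans with (g * (x * 2)); [lra|]; apply Rmult_lt_compat_l; lra. }
    assert (H1 : 0 <= (y t - V t) * (W t * V t - A t * y t)) by (apply Rmult_le_pos; lra).
    assert (H2 : 0 <= (W t - A t) * (V t * (y t - V t))) by (apply Rmult_le_pos; [lra|apply Rmult_le_pos; lra]).
    assert (H3 : 0 < V t ^ 2 * (2 * W t - 1 - A t)).
    { apply Rmult_lt_0_compat; [apply pow_lt; assumption|]; unfold g in HV2; lra. }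
    lra.
  + apply (Hder (- 8 * x + 84 / 5 * x ^ 2 - (1 - A t - 2 * A t * y t ^ 2 - V t ^ 2))).
    { unfold steep_margins, alp, x; derive_by; simpl; field. }
    assert (P := barrier_alp x Hx).
    assert (HA : A t = 1 - 4 * x + 21 / 5 * x ^ 2) by lra.
    assert (Hy2 : x * (2 + 9 / 5 * x) ^ 2 <= y t ^ 2).
    { replace (x * (2 + 9 / 5 * x) ^ 2) with ((r t * (2 + 9 / 5 * x)) ^ 2) by (unfold x; ring).
      apply pow_incr; split; [|lra]; apply Rmult_le_pos; lra. }
    assert (HV2 : x * (1 + 9 / 20 * x) ^ 2 * (2 - x - 9 / 20 * x ^ 2) ^ 2 <= V t ^ 2).
    { replace (x * (1 + 9 / 20 * x) ^ 2 * (2 - x - 9 / 20 * x ^ 2) ^ 2)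
        with ((r t * (1 + 9 / 20 * x) * (2 - x - 9 / 20 * x ^ 2)) ^ 2) by (unfold x; ring).
      assert (x * x <= 1 * 1) by (apply Rmult_le_compat; lra).
      assert (0 <= x + 9 / 20 * x ^ 2 <= 2) by lra.
      apply pow_incr; split.
      - repeat apply Rmult_le_pos; lra.
      - apply (Rmult_le_reg_l (r t)); [assumption|]; rewrite EV.
        replace (r t * (r t * (1 + 9 / 20 * x) * (2 - x - 9 / 20 * x ^ 2)))
          with ((x + 9 / 20 * x ^ 2) * (2 - (x + 9 / 20 * x ^ 2))) by (unfold x; ring).
        assert (0 <= (g - (x + 9 / 20 * x ^ 2)) * (2 - g - (x + 9 / 20 * x ^ 2))) by (apply Rmult_le_pos; lra).
        lra. }
    assert (A t * (x * (2 + 9 / 5 * x) ^ 2) <= A t * y t ^ 2) by (apply Rmult_le_compat_l; lra).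
    rewrite HA in *; lra.
  + assert (Hr : r t = 53 / 100) by lra.
    assert (Hxr : x = 2809 / 10000) by (unfold x; rewrite Hr; field).
    rewrite Hxr in Hgam; rewrite Hr in EV.
    assert (0 <= (g - 316 / 1000) * (2 - g - 316 / 1000)) by (apply Rmult_le_pos; lra).
    lra.
Qed.

End Barrier.

(** Six doublings of [exp x <= 1 / (1 - x)] at [x = 53/6400]. *)
Lemma exp_053 : exp (53 / 100) <= 1704 / 1000.
Proof.
assert (H : forall x a, 0 <= a -> exp x <= a -> exp (x + x) <= a * a).
{ intros x a Ha Hx; rewrite exp_plus; assert (P := exp_pos x); apply Rmult_le_compat; lra. }
assert (H0 : exp (53 / 6400) <= 1008351 / 1000000).
{ assert (E := exp_ineq1_le (- (53 / 6400))).
  rewrite <- (Ropp_involutive (53 / 6400)), exp_Ropp.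
  rewrite <- (Rinv_inv (1008351 / 1000000)); apply Rinv_le_contravar; lra. }
assert (S : forall x y a b, 0 <= a -> exp x <= a -> y = x + x -> a * a <= b -> exp y <= b).
{ intros x y a b Ha Hx -> Hb; apply Rle_trans with (a * a); [now apply H | exact Hb]. }
assert (H1 : exp (53 / 3200) <= 1016772 / 1000000) by (eapply S; [|exact H0| |]; lra).
assert (H2 : exp (53 / 1600) <= 1033826 / 1000000) by (eapply S; [|exact H1| |]; lra).
assert (H3 : exp (53 / 800) <= 1068797 / 1000000) by (eapply S; [|exact H2| |]; lra).
assert (H4 : exp (53 / 400) <= 1142328 / 1000000) by (eapply S; [|exact H3| |]; lra).
assert (H5 : exp (53 / 200) <= 1304914 / 1000000) by (eapply S; [|exact H4| |]; lra).
eapply S; [|exact H5| |]; lra.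
Qed.

Section Trap.

Variables (L : R) (l W P N K : R -> R) (T : R).
Hypothesis orb : orbit L l W P N K.
Hypothesis T_pos : 0 < T.
Hypothesis always_good : forall t, 0 <= t <= T -> good W P N t.
Hypothesis W_T : W T = - / 5.
Hypothesis K0 : 1 < K 0.

Let r (t : R) : R := / l t.
Let A (t : R) : R := N t ^ 2.
Let V (t : R) : R := l t * (1 - W t ^ 2).
Let y (t : R) : R := - (P t * l t) / N t.

Hypothesis start_steep : steep (r 0) (W 0) (A 0) (V 0) (y 0).
Hypothesis start_gam : gam (r 0) < 1 - W 0.
Hypothesis start_r : r 0 < 53 / 100.
Hypothesis start_V : V 0 < 1001 / 1000.

Lemma trap_facts t : 0 <= t <= T -> in_range L l W P N K t /\ equations_at l W P N K t /\ constraint l W P N K t = 0.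
Proof.
intros Ht; apply (apriori L l W P N K orb T ltac:(lra)); [|assumption].
intros u Hu; apply always_good; lra.
Qed.

Lemma trap_W_decreasing s t : 0 <= s <= t -> t <= T -> W t <= W s.
Proof.
intros Hst HtT; apply Ropp_le_cancel.
apply (monotone_by_derive (fun t => - W t) (fun t => - P t)); [lra| | |].
- intros u Hu; destruct (trap_facts u ltac:(lra)) as [_ [[_ [D _]] _]]; derive_by; reflexivity.
- intros u Hu; assert (C := o_W_cont _ _ _ _ _ _ orb u); cauto.
- intros u Hu; destruct (always_good u ltac:(lra)) as [_ [? _]]; lra.
Qed.

Lemma trap_basic t : 0 <= t <= T -> 0 < N t /\ P t < 0 /\ 0 < l t /\ 0 < r t /\ 0 < A t /\ - / 5 <= W t < 1 /\
  r t * V t = 1 - W t ^ 2 /\ 0 < V t /\ r t * l t = 1.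
Proof.
intros Ht; destruct (always_good t Ht) as [HN [HP _]].
destruct (trap_facts t Ht) as [[[Hl _] [[_ HW] _]] _].
assert (HWT := trap_W_decreasing t T ltac:(lra) ltac:(lra)).
assert (0 < 1 - W t ^ 2) by nra.
repeat split; try assumption; try lra; unfold r, A, V.
- now apply Rinv_0_lt_compat.
- now apply pow_lt.
- field; lra.
- now apply Rmult_lt_0_compat.
- field; lra.
Qed.

Lemma trap_dr t : 0 <= t <= T -> is_derive r t (N t * r t).
Proof.
intros Ht; destruct (trap_basic t Ht) as [_ [_ [Hl _]]]; destruct (trap_facts t Ht) as [_ [[D1 _] _]].
unfold r; derive_by; [lra|]; field; lra.
Qed.

Lemma trap_dW t : 0 <= t <= T -> is_derive W t (N t * (- r t * y t)).
Proof.
intros Ht; destruct (trap_basic t Ht) as [HN [_ [Hl _]]]; destruct (trap_facts t Ht) as [_ [[_ [D2 _]] _]].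
eapply is_derive_eq; [exact D2|]; unfold r, y; field; lra.
Qed.

Lemma trap_dN t : 0 <= t <= T -> is_derive N t ((1 - N t ^ 2 - 2 * (l t ^ 2 * P t ^ 2) - V t ^ 2) / 2).
Proof.
intros Ht; destruct (trap_facts t Ht) as [_ [[_ [_ [_ [D4 _]]]] HC]].
eapply is_derive_eq; [exact D4|]; unfold V; unfold constraint in HC; lra.
Qed.

Lemma trap_dA t : 0 <= t <= T -> is_derive A t (N t * (1 - A t - 2 * A t * y t ^ 2 - V t ^ 2)).
Proof.
intros Ht; destruct (trap_basic t Ht) as [HN _]; assert (D := trap_dN t Ht).
unfold A, y; derive_by; simpl; field; lra.
Qed.

Lemma trap_dV t : 0 <= t <= T -> is_derive V t (N t * (2 * W t * y t - V t)).
Proof.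
intros Ht; destruct (trap_basic t Ht) as [HN _]; destruct (trap_facts t Ht) as [_ [[D1 [D2 _]] _]].
unfold V, y; derive_by; simpl; field; lra.
Qed.

Lemma trap_dy t : 0 <= t <= T ->
  is_derive y t (N t * ((W t * V t - (1 - A t - V t ^ 2) * y t) / A t)).
Proof.
intros Ht; destruct (trap_basic t Ht) as [HN [_ [Hl _]]];
destruct (trap_facts t Ht) as [_ [[D1 [D2 [D3 [D4 _]]]] HC]].
unfold y; derive_by; [lra|].
assert (HK : K t = (1 + N t ^ 2 + 2 * (l t ^ 2 * P t ^ 2) - l t ^ 2 * (1 - W t ^ 2) ^ 2) / (2 * N t)).
{ unfold constraint in HC; apply (Rmult_eq_reg_r (2 * N t)); [|lra].
  replace ((1 + N t ^ 2 + 2 * (l t ^ 2 * P t ^ 2) - l t ^ 2 * (1 - W t ^ 2) ^ 2) / (2 * N t) * (2 * N t))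
   with (1 + N t ^ 2 + 2 * (l t ^ 2 * P t ^ 2) - l t ^ 2 * (1 - W t ^ 2) ^ 2) by (field; lra); lra. }
rewrite HK; unfold A, V; simpl; field; lra.
Qed.

Lemma trap_margins s : 0 <= s <= T -> (forall t, 0 <= t <= s -> V t <= 1001 / 1000) ->
  r s < 53 / 100 /\ A s < W s ^ 2 /\ A s < alp (r s).
Proof.
intros Hs HV.
assert (H : forall i t, (i < 7)%nat -> 0 <= t <= s -> 0 < steep_margins r W A V y i t).
{ apply (steep_persists s N); try assumption; try lra; intros t Ht;
  destruct (trap_basic t ltac:(lra)) as [B1 [B2 [B3 [B4 [B5 [B6 [B7 B8]]]]]]]; try assumption.
  - apply trap_dr; lra.
  - apply trap_dW; lra.
  - apply trap_dA; lra.
  - apply trap_dV; lra.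
  - apply trap_dy; lra. }
assert (H3 := H 3%nat s ltac:(lia) ltac:(lra)); assert (H5 := H 5%nat s ltac:(lia) ltac:(lra));
assert (H6 := H 6%nat s ltac:(lia) ltac:(lra)); unfold steep_margins in *; lra.
Qed.

Lemma trap_V_continuous t : continuous V t.
Proof.
assert (C1 := o_l_cont _ _ _ _ _ _ orb t); assert (C2 := o_W_cont _ _ _ _ _ _ orb t); unfold V; cauto.
Qed.

(** Before [V] exceeds 1.001 the barriers hold and [r < 0.53], which is
    incompatible with [r V = 1 - W^2 = 24/25] at time [T]. *)
Lemma trap_entry : exists t1, 0 < t1 <= T /\ V t1 = 1001 / 1000 /\
  r t1 < 53 / 100 /\ A t1 < W t1 ^ 2 /\ A t1 < alp (r t1).
Proof.
destruct (Classical_Prop.classic (exists t, 0 <= t <= T /\ 1001 / 1000 <= V t)) as [[t [Ht HVt]]|Hn].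
- destruct (first_hit (fun t => - V t) (- (1001 / 1000)) t) as [t1 [Ht1 [HV1 Hb]]]; [lra| |lra|lra|].
  + intros u Hu; assert (C := trap_V_continuous u); cauto.
  + exists t1; split; [lra|]; split; [lra|]; apply trap_margins; [lra|].
    intros u Hu; destruct (Req_dec u t1) as [->|]; [lra|]; specialize (Hb u ltac:(lra)); lra.
- exfalso.
  destruct (trap_margins T ltac:(lra)) as [H1 _].
  + intros t Ht; destruct (Rle_dec (V t) (1001 / 1000)); [assumption|exfalso; apply Hn; exists t; lra].
  + destruct (trap_basic T ltac:(lra)) as [_ [_ [_ [H2 [_ [_ [H3 [H4 _]]]]]]]]; rewrite W_T in H3.
    apply Hn; exists T; split; [lra|].
    destruct (Rle_dec (1001 / 1000) (V T)); [assumption|exfalso]; nra.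
Qed.

(** [K' = 2 l^2 P^2 > 0] where [K = 1]. *)
Lemma trap_K t : 0 <= t <= T -> 1 < K t.
Proof.
intros Ht; assert (H : 0 < K t - 1); [|lra].
apply (stays_above (fun t => K t - 1) 0 T ltac:(lra)); [| |  |assumption].
- intros u Hu; assert (C := o_K_cont _ _ _ _ _ _ orb u); cauto.
- lra.
- intros u Hu Hp Hz; destruct (trap_facts u ltac:(lra)) as [_ [[_ [_ [_ [_ D]]]] _]].
  assert (D' : is_derive (fun t => K t - 1) u (1 + 2 * (l u ^ 2 * P u ^ 2) - K u ^ 2)) by (derive_by; ring).
  apply derive_at_first_zero in D'; [|lra|assumption|assumption].
  destruct (trap_basic u ltac:(lra)) as [_ [HP [Hl _]]].
  assert (0 < l u ^ 2 * P u ^ 2) by (apply Rmult_lt_0_compat; [apply pow_lt; lra|]; nra).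
  assert (HK : K u = 1) by lra; rewrite HK in D'; lra.
Qed.

(** While [V >= 1], the bound [N' <= - N] limits the growth of [r], since
    [r' = r N]. *)
Lemma trap_radius t1 t : 0 <= t1 <= t -> t <= T -> (forall u, t1 <= u <= t -> 1 <= V u) ->
  r t * exp (N t) <= r t1 * exp (N t1).
Proof.
intros Ht1 HtT HV; apply Ropp_le_cancel.
apply (monotone_by_derive (fun t => - (r t * exp (N t)))
  (fun t => r t * exp (N t) * (N t * (K t - 1) + (V t ^ 2 - 1)))); [lra| | |].
- intros u Hu; assert (D1 := trap_dr u ltac:(lra)); assert (D2 := trap_dN u ltac:(lra)).
  destruct (trap_facts u ltac:(lra)) as [_ [_ HC]]; unfold constraint in HC.
  derive_by; unfold V.
  replace (N u * (K u - 1)) with ((1 + N u ^ 2 + 2 * (l u ^ 2 * P u ^ 2) - l u ^ 2 * (1 - W u ^ 2) ^ 2) / 2 - N u) by lra.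
  field.
- intros u Hu; assert (D1 := is_derive_cont _ _ _ (trap_dr u ltac:(lra))).
  assert (D2 := trap_dN u ltac:(lra)).
  assert (D3 : continuous (fun t => exp (N t)) u) by (eapply is_derive_cont; dauto); cauto.
- intros u Hu; destruct (trap_basic u ltac:(lra)) as [HN [_ [_ [Hr _]]]].
  assert (HK := trap_K u ltac:(lra)); specialize (HV u ltac:(lra)); assert (E := exp_pos (N u)).
  apply Rmult_le_pos; [apply Rmult_le_pos; lra|].
  assert (0 <= N u * (K u - 1)) by (apply Rmult_le_pos; lra).
  assert (1 * 1 <= V u * V u) by (apply Rmult_le_compat; lra); lra.
Qed.

(** From [r <= exp (2 r - 1) / 2] and [N <= A + 1/4]: the exponent
    [2 r - 1 + alp r + 1/4] is at most 0.53 on the range of [r]. *)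
Lemma trap_radius_entry t1 : 0 <= t1 <= T -> r t1 < 53 / 100 -> A t1 < alp (r t1) ->
  r t1 * exp (N t1) <= 852 / 1000.
Proof.
intros Ht1 Hr HA; destruct (trap_basic t1 Ht1) as [HN [_ [_ [Hr0 _]]]].
assert (H1 : 2 * r t1 <= exp (2 * r t1 - 1)) by (generalize (exp_ineq1_le (2 * r t1 - 1)); lra).
assert (H2 : N t1 <= A t1 + / 4) by (unfold A; assert (0 <= (N t1 - / 2) ^ 2) by apply pow2_ge_0; lra).
assert (H3 : 2 * r t1 - 1 + N t1 <= 53 / 100).
{ unfold alp in HA; set (x := r t1) in *.
  assert (0 <= (x - 32 / 100) ^ 2) by apply pow2_ge_0.
  assert (0 <= (x - 32 / 100) ^ 2 * (53 / 100 - x)) by (apply Rmult_le_pos; lra).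
  assert (0 <= (x - 32 / 100) ^ 2 * (x * (53 / 100 - x))) by (apply Rmult_le_pos; [lra|apply Rmult_le_pos; lra]).
  nra. }
assert (H4 : exp (2 * r t1 - 1) * exp (N t1) <= 1704 / 1000).
{ rewrite <- exp_plus; eapply Rle_trans; [apply exp_mono; exact H3 | apply exp_053]. }
assert (E := exp_pos (N t1)); nra.
Qed.

(** At a return to [V = 1] the constraint bounds [y] below, and then [V' <= 0]
    forces [W] to be small, whereas [1 - W^2 = r] stays well below 1. *)
Lemma trap_V t1 : 0 < t1 <= T -> V t1 = 1001 / 1000 -> r t1 * exp (N t1) <= 852 / 1000 -> N t1 < 1 ->
  forall t, t1 <= t <= T -> 1 < V t.
Proof.
intros Ht1 HV1 Hrad HN1 t Ht; assert (H : 0 < V t - 1); [|lra].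
apply (stays_above (fun t => V t - 1) t1 T ltac:(lra)); [| | |assumption].
- intros u Hu; assert (C := trap_V_continuous u); cauto.
- lra.
- intros u Hu Hp Hz.
  assert (HVge : forall x, t1 <= x <= u -> 1 <= V x).
  { intros x Hx; destruct (Req_dec x u) as [->|]; [lra|]; specialize (Hp x ltac:(lra)); lra. }
  assert (R := trap_radius t1 u ltac:(lra) ltac:(lra) HVge).
  destruct (trap_basic u ltac:(lra)) as [HN [HP [Hl [Hr [_ [HW [HrV [_ Hrl]]]]]]]].
  assert (HNu : N u <= N t1).
  { apply Ropp_le_cancel.
    apply (monotone_by_derive (fun t => - N t) (fun t => - ((1 - N t ^ 2 - 2 * (l t ^ 2 * P t ^ 2) - V t ^ 2) / 2))); [lra| | |].
    - intros x Hx; assert (D := trap_dN x ltac:(lra)); derive_by; reflexivity.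
    - intros x Hx; assert (C := o_N_cont _ _ _ _ _ _ orb x); cauto.
    - intros x Hx; specialize (HVge x ltac:(lra)).
      assert (1 * 1 <= V x * V x) by (apply Rmult_le_compat; lra).
      assert (0 <= l x ^ 2 * P x ^ 2) by (apply Rmult_le_pos; apply pow2_ge_0).
      assert (0 <= N x ^ 2) by apply pow2_ge_0; lra. }
  assert (Hexp : 1 + N u <= exp (N u)) by apply exp_ineq1_le.
  assert (Hr1 : r u * (1 + N u) <= 852 / 1000) by nra.
  assert (HV : V u = 1) by lra; rewrite HV, Rmult_1_r in HrV.
  assert (D : is_derive (fun t => V t - 1) u (N u * (2 * W u * y u - V u))).
  { assert (D := trap_dV u ltac:(lra)); derive_by; ring. }
  apply derive_at_zero_after with (a := t1) in D; [|lra|assumption|lra].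
  assert (D' : 2 * W u * y u <= 1) by (rewrite HV in D; apply (Rmult_le_reg_l (N u)); lra).
  destruct (trap_facts u ltac:(lra)) as [_ [_ HC]]; unfold constraint in HC.
  assert (HK := trap_K u ltac:(lra)).
  assert (HQ : N u - N u ^ 2 / 2 <= l u ^ 2 * P u ^ 2).
  { assert (l u ^ 2 * (1 - W u ^ 2) ^ 2 = 1) by (transitivity (V u ^ 2); [unfold V; ring | rewrite HV; ring]).
    assert (0 <= (K u - 1) * N u) by (apply Rmult_le_pos; lra); lra. }
  assert (Hy : l u ^ 2 * P u ^ 2 = N u ^ 2 * y u ^ 2) by (unfold y; field; lra).
  assert (Hy0 : 0 < y u).
  { unfold y; apply Rdiv_lt_0_compat; [|lra].
    assert (0 < (- P u) * l u) by (apply Rmult_lt_0_compat; lra); lra. }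
  assert (HWpos : 0 < W u).
  { destruct (Rlt_dec 0 (W u)); [assumption|exfalso].
    assert (0 <= (W u + / 5) * (- W u)) by (apply Rmult_le_pos; lra).
    assert (0 <= r u * N u) by (apply Rmult_le_pos; lra); lra. }
  assert (HWy : 4 * (W u ^ 2 * y u ^ 2) <= 1).
  { assert ((2 * W u * y u) * (2 * W u * y u) <= 1 * 1).
    { assert (0 <= W u * y u) by (apply Rmult_le_pos; lra); apply Rmult_le_compat; lra. } lra. }
  assert (H1 : (4 - 2 * N u) * W u ^ 2 <= N u).
  { apply (Rmult_le_reg_l (N u)); [assumption|].
    assert (W u ^ 2 * (N u - N u ^ 2 / 2) <= W u ^ 2 * (N u ^ 2 * y u ^ 2)) by (apply Rmult_le_compat_l; [apply pow2_ge_0|lra]).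
    assert (N u ^ 2 * (4 * (W u ^ 2 * y u ^ 2)) <= N u ^ 2 * 1) by (apply Rmult_le_compat_l; [apply pow2_ge_0|lra]).
    lra. }
  assert (H2 : 148 / 1000 + N u <= (1 + N u) * W u ^ 2) by (replace (W u ^ 2) with (1 - r u) by lra; lra).
  assert (H3 : (4 - 2 * N u) * (148 / 1000 + N u) <= (1 + N u) * N u).
  { apply Rle_trans with ((4 - 2 * N u) * ((1 + N u) * W u ^ 2)).
    - apply Rmult_le_compat_l; lra.
    - replace ((4 - 2 * N u) * ((1 + N u) * W u ^ 2)) with ((1 + N u) * ((4 - 2 * N u) * W u ^ 2)) by ring.
      apply Rmult_le_compat_l; lra. }
  assert (0 <= N u * (1 - N u)) by (apply Rmult_le_pos; lra); lra.
Qed.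

(** The factor lost by [N] between [W = x] and [W = 1/5] is
    [exp (1.65 (x - 1/5))], the fourth power of [exp (0.4125 (x - 1/5))], which
    is bounded below by its tangent. *)
Lemma quartic_bound x : 68 / 100 <= x <= 1 -> x <= 335 / 1000 * (1 + 4125 / 10000 * (x - / 5)) ^ 4.
Proof.
intros Hx; set (z := 1 + 4125 / 10000 * (x - / 5)).
assert (Hz : 1198 / 1000 <= z <= 133 / 100) by (unfold z; lra).
assert (Hxz : x = (z - 1) * (10000 / 4125) + / 5) by (unfold z; field).
rewrite Hxz.
(* the tangent to z^4 near the point where the two sides are closest *)
assert (0 <= (z - 12185 / 10000) ^ 2 * (z ^ 2 + 2 * (12185 / 10000) * z + 3 * (12185 / 10000) ^ 2)).
{ apply Rmult_le_pos; [apply pow2_ge_0|]; assert (0 <= z ^ 2) by apply pow2_ge_0; lra. }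
lra.
Qed.

(** As long as [V > 1] and [r <= 0.852], [N exp (- 1.65 W)] decreases, so [N] is
    at most 0.335 when [W] reaches 1/5.  From there on [V^2 > 1.269] and
    [W - 1.17 N] increases, which keeps [W] above -1/5. *)
Lemma trapped : False.
Proof.
destruct trap_entry as [t1 [Ht1 [HV1 [Hr1 [HA1 HAa]]]]].
assert (HE := trap_radius_entry t1 ltac:(lra) Hr1 HAa).
destruct (trap_basic t1 ltac:(lra)) as [HN1 [_ [_ [Hr0 [_ [HW1 [HrV1 _]]]]]]].
assert (HW1' : 68 / 100 < W t1 /\ N t1 < W t1).
{ assert (HW2 : 469 / 1000 < W t1 ^ 2) by (rewrite HV1 in HrV1; lra).
  (* W is positive at t1: it lies in [-1/5, 1) and its square exceeds 1/25 *)
  assert (HWp : 0 < W t1) by (destruct (Rlt_dec 0 (W t1)); [assumption|exfalso; nra]).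
  split; [nra|]; unfold A in HA1; nra. }
destruct HW1' as [HW68 HNW].
assert (HV := trap_V t1 Ht1 HV1 HE ltac:(lra)).
assert (Hr : forall t, t1 <= t <= T -> r t <= 852 / 1000).
{ intros t Ht.
  assert (R := trap_radius t1 t ltac:(lra) ltac:(lra) ltac:(intros u Hu; left; apply HV; lra)).
  destruct (trap_basic t ltac:(lra)) as [HN [_ [_ [Hr _]]]].
  assert (Hexp : 1 + N t <= exp (N t)) by apply exp_ineq1_le; nra. }
destruct (first_hit W (/ 5) T) as [t2 [Ht2 [HW2 Hb2]]]; [lra| | |lra|].
{ intros u Hu; apply (o_W_cont _ _ _ _ _ _ orb). }
{ assert (M := trap_W_decreasing 0 t1 ltac:(lra) ltac:(lra)); lra. }
assert (Ht12 : t1 <= t2).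
{ destruct (Rle_dec t1 t2); [assumption|exfalso].
  assert (M := trap_W_decreasing t2 t1 ltac:(lra) ltac:(lra)); lra. }
assert (HP : forall t, 0 <= t <= T -> P t = - (- P t * l t) * r t).
{ intros t Ht; destruct (trap_basic t Ht) as [_ [_ [Hl _]]]; unfold r; field; lra. }
assert (HQ : forall t, l t ^ 2 * P t ^ 2 = (- P t * l t) ^ 2) by (intros; ring).
assert (HN2 : N t2 <= 335 / 1000).
{ assert (M : - (N t1 * exp (- (165 / 100) * W t1)) <= - (N t2 * exp (- (165 / 100) * W t2))).
  { apply (monotone_by_derive (fun t => - (N t * exp (- (165 / 100) * W t)))
     (fun t => exp (- (165 / 100) * W t) *
        - ((1 - N t ^ 2 - 2 * (l t ^ 2 * P t ^ 2) - V t ^ 2) / 2 - 165 / 100 * P t * N t))); [lra| | |].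
    - intros u Hu; assert (D1 := trap_dN u ltac:(lra)); destruct (trap_facts u ltac:(lra)) as [_ [[_ [D2 _]] _]].
      derive_by; field.
    - intros u Hu; assert (D1 := trap_dN u ltac:(lra)); destruct (trap_facts u ltac:(lra)) as [_ [[_ [D2 _]] _]].
      eapply is_derive_cont; dauto.
    - intros u Hu; apply Rmult_le_pos; [left; apply exp_pos|].
      assert (EP := HP u ltac:(lra)); rewrite HQ; set (q := - P u * l u) in *; rewrite EP.
      specialize (HV u ltac:(lra)); specialize (Hr u ltac:(lra)).
      destruct (trap_basic u ltac:(lra)) as [HN [HPu [Hl [Hru _]]]].
      assert (Hq : 0 <= q) by (unfold q; apply Rmult_le_pos; lra).
      assert (1 * 1 <= V u * V u) by (apply Rmult_le_compat; lra).
      assert (q * N u * r u <= q * N u * (852 / 1000)) by (apply Rmult_le_compat_l; [apply Rmult_le_pos; lra|lra]).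
      assert (0 <= (q - 7029 / 10000 * N u) ^ 2) by apply pow2_ge_0.
      assert (0 <= N u ^ 2) by apply pow2_ge_0.
      lra. }
  rewrite HW2 in M.
  assert (E1 : N t1 * exp (- (165 / 100) * W t1) * exp (165 / 100 * W t1) = N t1).
  { rewrite Rmult_assoc, <- exp_plus.
    replace (- (165 / 100) * W t1 + 165 / 100 * W t1) with 0 by ring; rewrite exp_0; ring. }
  assert (E2 : N t2 * exp (- (165 / 100) * / 5) * exp (165 / 100 * W t1)
             = N t2 * exp (4125 / 10000 * (W t1 - / 5)) ^ 4).
  { simpl; rewrite Rmult_1_r, Rmult_assoc, <- !exp_plus; do 2 f_equal; field. }
  assert (H1 : N t2 * exp (4125 / 10000 * (W t1 - / 5)) ^ 4 <= N t1).
  { rewrite <- E1, <- E2; apply Rmult_le_compat_r; [left; apply exp_pos|lra]. }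
  assert (H2 : (1 + 4125 / 10000 * (W t1 - / 5)) ^ 4 <= exp (4125 / 10000 * (W t1 - / 5)) ^ 4).
  { apply pow_incr; split; [lra|apply exp_ineq1_le]. }
  assert (H3 := quartic_bound (W t1) ltac:(lra)).
  destruct (trap_basic t2 ltac:(lra)) as [HN2 _].
  set (a := (1 + 4125 / 10000 * (W t1 - / 5)) ^ 4) in *.
  assert (Ha : 0 < a) by (unfold a; apply pow_lt; lra).
  assert (N t2 * a <= N t2 * exp (4125 / 10000 * (W t1 - / 5)) ^ 4) by (apply Rmult_le_compat_l; lra).
  apply (Rmult_le_reg_r a); lra. }
assert (M : W t2 - 117 / 100 * N t2 <= W T - 117 / 100 * N T).
{ apply (monotone_by_derive (fun t => W t - 117 / 100 * N t)
    (fun t => P t - 117 / 100 * ((1 - N t ^ 2 - 2 * (l t ^ 2 * P t ^ 2) - V t ^ 2) / 2))); [lra| | |].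
  - intros u Hu; assert (D1 := trap_dN u ltac:(lra)); destruct (trap_facts u ltac:(lra)) as [_ [[_ [D2 _]] _]].
    derive_by; field.
  - intros u Hu; assert (C1 := o_W_cont _ _ _ _ _ _ orb u); assert (C2 := o_N_cont _ _ _ _ _ _ orb u); cauto.
  - intros u Hu; assert (EP := HP u ltac:(lra)); rewrite HQ; set (q := - P u * l u) in *; rewrite EP.
    specialize (Hr u ltac:(lra)).
    destruct (trap_basic u ltac:(lra)) as [HN [HPu [Hl [Hru [_ [HWu [HrV [HVu _]]]]]]]].
    assert (HWle := trap_W_decreasing t2 u ltac:(lra) ltac:(lra)).
    assert (HW25 : 0 <= (/ 5 + W u) * (/ 5 - W u)) by (apply Rmult_le_pos; lra).
    assert (HV2 : 1269 / 1000 <= V u ^ 2).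
    { assert (H1 : 24 / 25 <= 852 / 1000 * V u) by (apply Rle_trans with (r u * V u); [lra|apply Rmult_le_compat_r; lra]).
      assert (H2 : 1126 / 1000 <= V u) by lra.
      assert (H3 : (1126760 / 1000000) * (1126760 / 1000000) <= V u * V u) by (apply Rmult_le_compat; lra).
      lra. }
    assert (0 <= (q - r u * (100 / 234)) ^ 2) by apply pow2_ge_0.
    assert (r u * r u <= 852 / 1000 * (852 / 1000)) by (apply Rmult_le_compat; lra).
    assert (0 <= N u ^ 2) by apply pow2_ge_0.
    lra. }
destruct (trap_basic T ltac:(lra)) as [HNT _].
rewrite W_T, HW2 in M; lra.
Qed.

End Trap.

(** * Shooting *)

Lemma positive_min (f : R -> R) (S : R) : 0 <= S -> (forall t, continuous f t) ->
  (forall t, 0 <= t <= S -> 0 < f t) -> exists m, 0 < m /\ forall t, 0 <= t <= S -> m <= f t.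
Proof.
intros HS Hc Hp.
destruct (continuity_ab_min f 0 S HS) as [x [Hx1 Hx2]].
- intros t Ht; apply continuity_pt_filterlim, Hc.
- exists (f x); split; [now apply Hp | assumption].
Qed.

(** With [x = rs^2], the expansion of the data is [v = -1 - x/2], [z = -2 - 2 x]
    and [a = -4 + 3.2 x], up to errors that are small multiples of [x]. *)
Lemma steep_start (rs q p b : R) : 0 < rs <= / 10 ->
  Rabs (q + 3 + 5 / 2 * rs ^ 2) <= / 100 * rs ^ 2 -> Rabs (p + rs) <= / 100 * rs ->
  Rabs (b - 148 / 15 * rs ^ 2) <= / 100 * rs ^ 2 ->
  steep rs (w_of rs q p) (A_of rs q b) (/ rs * (1 - w_of rs q p ^ 2)) (- dw_of rs q p) /\
  gam rs < 1 - w_of rs q p /\ / rs * (1 - w_of rs q p ^ 2) < 1001 / 1000 /\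
  0 < 2 * A_of rs q b * dw_of rs q p ^ 2 - ((1 - w_of rs q p ^ 2) / rs) ^ 2.
Proof.
intros Hr Hq Hp Hb; apply Rabs_le_between in Hq, Hp, Hb.
assert (Hrp : - (101 / 100) * rs ^ 2 <= rs * p <= - (99 / 100) * rs ^ 2) by (split; nra).
unfold w_of, dw_of, A_of.
set (k := - v_of rs q p).
assert (Hv : v_of rs q p = - k) by (unfold k; ring); rewrite Hv.
set (z := z_of rs q p); set (a := a_of q b).
assert (Hx : 0 < rs ^ 2 <= / 100) by (split; nra).
assert (Hk : 1 + 493 / 1000 * rs ^ 2 <= k <= 1 + 507 / 1000 * rs ^ 2) by (unfold k, v_of; lra).
assert (Hz : -2 - 201 / 100 * rs ^ 2 <= z <= -2 - 199 / 100 * rs ^ 2) by (unfold z, z_of; lra).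
assert (Ha : -4 + 313 / 100 * rs ^ 2 <= a <= -4 + 327 / 100 * rs ^ 2).
{ unfold a, a_of; set (x := rs ^ 2) in *.
  assert (H1 : 0 <= (- q - (3 + 249 / 100 * x)) * (- q + (3 + 249 / 100 * x))) by (apply Rmult_le_pos; lra).
  assert (H2 : 0 <= ((3 + 251 / 100 * x) + q) * ((3 + 251 / 100 * x) - q)) by (apply Rmult_le_pos; lra).
  assert (H3 : 0 <= x * x <= / 100 * x) by (split; [apply Rmult_le_pos; lra|apply Rmult_le_compat_r; lra]).
  split; lra. }
set (s := k * (2 - rs ^ 2 * k)).
assert (HV : / rs * (1 - (1 + rs ^ 2 * - k) ^ 2) = rs * s) by (unfold s; field; lra).
assert (HV' : (1 - (1 + rs ^ 2 * - k) ^ 2) / rs = rs * s) by (unfold s; field; lra).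
rewrite HV, HV'.
assert (Hs : 2 - 3 / 100 * rs ^ 2 <= s <= 2 + 2 / 100 * rs ^ 2).
{ unfold s; set (x := rs ^ 2) in *.
  assert (H3 : 0 <= x * x <= / 100 * x) by (split; [apply Rmult_le_pos; lra|apply Rmult_le_compat_r; lra]).
  assert (Hk2 : 1 <= k <= 101 / 100) by lra.
  assert (H4 : 1 + 986 / 1000 * x <= k * k <= 1 + 102 / 100 * x).
  { split; [|]; nra. }
  split; nra. }
assert (HA : 1 - 4 * rs ^ 2 <= 1 + rs ^ 2 * a <= 1 - 396 / 100 * rs ^ 2) by (split; nra).
unfold steep, eta, gam, alp.
set (x := rs ^ 2) in *.
assert (Hxx : 0 < x * x <= / 100 * x) by (split; [apply Rmult_lt_0_compat; lra|apply Rmult_le_compat_r; lra]).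
replace (rs ^ 3) with (rs * x) by (unfold x; ring); replace (rs ^ 4) with (x * x) by (unfold x; ring).
repeat split.
- nra.
- nra.
- replace ((1 + x * a) * - (rs * z)) with (rs * ((1 + x * a) * - z)) by ring.
  replace ((1 + x * - k) * (rs * s)) with (rs * ((1 + x * - k) * s)) by ring.
  apply Rmult_lt_compat_l; [lra|].
  assert ((1 + x * a) * - z <= (1 - 396 / 100 * x) * (2 + 201 / 100 * x)) by (apply Rmult_le_compat; lra).
  assert (x * k <= x * (101 / 100)) by (apply Rmult_le_compat_l; lra).
  assert ((1 - 101 / 100 * x) * (2 - 3 / 100 * x) <= (1 + x * - k) * s) by (apply Rmult_le_compat; lra).
  nra.
- assert (x * k <= x * (101 / 100)) by (apply Rmult_le_compat_l; lra).
  assert (0 <= (x * k) ^ 2) by apply pow2_ge_0; lra.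
- replace ((rs * s) ^ 2) with (x * s ^ 2) by (unfold x; ring).
  assert (H : 0 < x * (s ^ 2 + a)); [|lra].
  apply Rmult_lt_0_compat; [lra|].
  assert ((2 - 3 / 100 * x) * (2 - 3 / 100 * x) <= s * s) by (apply Rmult_le_compat; lra).
  lra.
- assert (x * a <= x * (-4 + 327 / 100 * x)) by (apply Rmult_le_compat_l; lra); lra.
- assert (x * (1 + 493 / 1000 * x) <= x * k) by (apply Rmult_le_compat_l; lra); lra.
- nra.
- replace ((rs * s) ^ 2) with (x * s ^ 2) by (unfold x; ring).
  replace ((rs * z) ^ 2) with (x * z ^ 2) by (unfold x; ring).
  assert (H : 0 < x * (2 * (1 + x * a) * z ^ 2 - s ^ 2)); [|lra].
  apply Rmult_lt_0_compat; [lra|].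
  assert (s * s <= (201 / 100) * (201 / 100)) by (apply Rmult_le_compat; lra).
  assert (2 * 2 <= (- z) * (- z)) by (apply Rmult_le_compat; lra).
  assert ((96 / 100) * 4 <= (1 + x * a) * z ^ 2) by (apply Rmult_le_compat; lra).
  lra.
Qed.

Section Shooting.

Variables (rs : R) (q p b : R -> R -> R).
Hypothesis Hrs : 0 < rs <= / 10.
Hypothesis Hloc : forall lam, 0 <= lam <= 2 -> local_solution lam rs (q lam) (p lam) (b lam).
Hypothesis Hcont : forall lam0 d, 0 <= lam0 <= 2 -> 0 < d -> exists e, 0 < e /\
  forall lam, 0 <= lam <= 2 -> Rabs (lam - lam0) < e ->
     close_on d (start rs (q lam rs) (p lam rs) (b lam rs))
                (start rs (q lam0 rs) (p lam0 rs) (b lam0 rs)).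
Hypothesis Hflat : q 0 rs = 0 /\ p 0 rs = 0 /\ b 0 rs = 0.
Hypothesis Hsteep : Rabs (q 2 rs + 3 + 5 / 2 * rs ^ 2) <= / 100 * rs ^ 2 /\
   Rabs (p 2 rs + rs) <= / 100 * rs /\
   Rabs (b 2 rs - 148 / 15 * rs ^ 2) <= / 100 * rs ^ 2.

Variables (Y : (nat -> R) -> nat -> R -> R) (LL B : R).
Hypothesis LL_pos : 0 < LL.
Hypothesis HY : truncated_solution 5 (fun _ => O) flow_field (15 * / rs + 1) Y LL B.

Let c (lam : R) : nat -> R := start rs (q lam rs) (p lam rs) (b lam rs).

Lemma shoot_orbit lam : 0 < lam <= 2 ->
  orbit (/ rs) (Y (c lam) 0%nat) (Y (c lam) 1%nat) (Y (c lam) 2%nat) (Y (c lam) 3%nat) (Y (c lam) 4%nat).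
Proof.
intros Hl.
destruct HY as [Hc [H0 [_ [_ [Hd _]]]]].
assert (sol := Hloc lam ltac:(lra)).
set (w := w_of rs (q lam rs) (p lam rs)); set (dw := dw_of rs (q lam rs) (p lam rs));
set (A := A_of rs (q lam rs) (b lam rs)).
assert (HA : 9 / 10 <= A <= 101 / 100) by (apply (local_A_bound lam rs _ _ _ ltac:(lra) sol); lra).
assert (Hw1 : w < 1) by (apply (local_w_lt_1 lam rs _ _ _ ltac:(lra) sol); lra).
assert (Hv : Rabs (v_of rs (q lam rs) (p lam rs)) <= 14 / 10) by (apply (local_v_bound lam rs _ _ _ ltac:(lra) sol); lra).
assert (Hz : Rabs (z_of rs (q lam rs) (p lam rs)) <= 3) by (apply (local_z_bound lam rs _ _ _ ltac:(lra) sol); lra).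
assert (Hdw : dw < 0) by (apply (local_dw_neg lam rs _ _ _ ltac:(lra) sol); lra).
assert (HE : 0 < rs ^ 2 * A * dw ^ 2 - (1 - w ^ 2) ^ 2 / 2).
{ apply (local_energy_pos lam rs _ _ _ ltac:(lra) sol); lra. }
apply Rabs_le_between in Hv, Hz.
assert (Hdw2 : - (3 / 10) <= dw) by (unfold dw, dw_of; nra).
assert (Hrr : 0 < rs ^ 2 <= / 100) by (split; nra).
assert (Hw0 : 1 - 14 / 10 * rs ^ 2 <= w) by (unfold w, w_of; nra).
assert (HN : 94 / 100 <= sqrt A <= 101 / 100).
{ split.
  - rewrite <- (sqrt_pow2 (94 / 100)) by lra; apply sqrt_le_1_alt; lra.
  - rewrite <- (sqrt_pow2 (101 / 100)) by lra; apply sqrt_le_1_alt; lra. }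
assert (HNN : sqrt A * sqrt A = A) by (apply sqrt_sqrt; lra).
assert (HV : 0 <= ((1 - w ^ 2) / rs) ^ 2 <= 8 / 100).
{ split; [apply pow2_ge_0|].
  assert (H1 : 0 <= (1 - w ^ 2) / rs) by (apply Rdiv_le_0_compat; nra).
  assert (H2 : (1 - w ^ 2) / rs <= 28 / 100).
  { apply (Rmult_le_reg_r rs); [lra|].
    replace ((1 - w ^ 2) / rs * rs) with ((1 - w) * (1 + w)) by (field; lra).
    assert ((1 - w) * (1 + w) <= 14 / 10 * rs ^ 2 * 2) by (apply Rmult_le_compat; lra).
    assert (rs ^ 2 <= / 10 * rs) by nra; lra. }
  assert ((1 - w ^ 2) / rs * ((1 - w ^ 2) / rs) <= 28 / 100 * (28 / 100)) by (apply Rmult_le_compat; lra).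
  lra. }
assert (Hdd : 0 <= A * dw ^ 2 <= 101 / 100 * (9 / 100)).
{ assert (0 <= dw ^ 2 <= 9 / 100) by (split; nra).
  split; [apply Rmult_le_pos; lra | apply Rmult_le_compat; lra]. }
assert (S0 : Y (c lam) 0%nat 0 = / rs) by (rewrite H0; [reflexivity|lia]).
assert (S1 : Y (c lam) 1%nat 0 = w) by (rewrite H0; [reflexivity|lia]).
assert (S2 : Y (c lam) 2%nat 0 = rs * sqrt A * dw) by (rewrite H0; [reflexivity|lia]).
assert (S3 : Y (c lam) 3%nat 0 = sqrt A) by (rewrite H0; [reflexivity|lia]).
assert (S4 : Y (c lam) 4%nat 0 = (1 + A + 2 * A * dw ^ 2 - ((1 - w ^ 2) / rs) ^ 2) / (2 * sqrt A))
  by (rewrite H0; [reflexivity|lia]).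
split.
- rewrite <- (Rinv_inv 10); apply Rinv_le_contravar; lra.
- intros; apply Hc; lia.
- intros; apply Hc; lia.
- intros; apply Hc; lia.
- intros; apply Hc; lia.
- intros; apply Hc; lia.
- intros t B0 B1 B2 B3 B4.
  assert (Hb : forall j, (j < 5)%nat -> Rabs (Y (c lam) j t) <= 15 * / rs + 1).
  { intros j Hj; destruct j as [|[|[|[|[|j]]]]]; try assumption; lia. }
  refine (conj _ (conj _ (conj _ (conj _ _)))).
  + exact (Hd (c lam) 0%nat t ltac:(lia) eq_refl Hb).
  + exact (Hd (c lam) 1%nat t ltac:(lia) eq_refl Hb).
  + exact (Hd (c lam) 2%nat t ltac:(lia) eq_refl Hb).
  + exact (Hd (c lam) 3%nat t ltac:(lia) eq_refl Hb).
  + exact (Hd (c lam) 4%nat t ltac:(lia) eq_refl Hb).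
- exact S0.
- rewrite S1; lra.
- rewrite S2; assert (0 < rs * sqrt A <= / 10 * (101 / 100)) by (split; [apply Rmult_lt_0_compat|apply Rmult_le_compat]; lra); nra.
- rewrite S3; lra.
- rewrite S4; split.
  + apply (Rmult_lt_reg_r (2 * sqrt A)); [lra|].
    replace ((1 + A + 2 * A * dw ^ 2 - ((1 - w ^ 2) / rs) ^ 2) / (2 * sqrt A) * (2 * sqrt A))
      with (1 + A + 2 * (A * dw ^ 2) - ((1 - w ^ 2) / rs) ^ 2) by (field; lra); lra.
  + apply (Rmult_lt_reg_r (2 * sqrt A)); [lra|].
    replace ((1 + A + 2 * A * dw ^ 2 - ((1 - w ^ 2) / rs) ^ 2) / (2 * sqrt A) * (2 * sqrt A))
      with (1 + A + 2 * (A * dw ^ 2) - ((1 - w ^ 2) / rs) ^ 2) by (field; lra); lra.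
- unfold constraint; rewrite S0, S1, S2, S3, S4.
  transitivity ((A - sqrt A * sqrt A) * (1 + 2 * dw ^ 2)); [field; lra | rewrite HNN; ring].
- unfold energy; rewrite S1, S2.
  replace ((rs * sqrt A * dw) ^ 2) with (rs ^ 2 * (sqrt A * sqrt A) * dw ^ 2) by ring; now rewrite HNN.
Qed.

Definition low (lam : R) : Prop := exits_low (Y (c lam) 1%nat) (Y (c lam) 2%nat) (Y (c lam) 3%nat).
Definition other (lam : R) : Prop := exits_other (Y (c lam) 1%nat) (Y (c lam) 2%nat) (Y (c lam) 3%nat).

Lemma low_other_disjoint lam : low lam -> other lam -> False.
Proof.
intros [S1 [HS1 [HW H1]]] [S2 [HS2 [Hor H2]]].
destruct (Rle_dec S1 S2) as [Hle|Hle].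
- specialize (H2 S1 ltac:(lra)); lra.
- destruct (H1 S2 ltac:(lra)); destruct Hor; lra.
Qed.

Lemma flow_close lam0 S d : 0 <= lam0 <= 2 -> 0 <= S -> 0 < d -> exists e, 0 < e /\
  forall lam, 0 <= lam <= 2 -> Rabs (lam - lam0) < e ->
  forall i t, (i < 5)%nat -> 0 <= t <= S -> Rabs (Y (c lam) i t - Y (c lam0) i t) < d.
Proof.
intros Hl HS Hd.
destruct HY as [_ [_ [_ [_ [_ [Hdep _]]]]]].
assert (HE := exp_pos (2 * LL * S)).
pose (d' := d / (4 * exp (2 * LL * S))).
assert (Hd' : 0 < d') by (apply Rdiv_lt_0_compat; lra).
destruct (Hcont lam0 d' Hl Hd') as [e [He H]].
exists e; split; [assumption|]; intros lam Hlam Hlt i t Hi Ht.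
eapply Rle_lt_trans; [apply (Hdep (c lam) (c lam0) d'); [assumption|lra|now apply H]|].
rewrite Rabs_pos_eq by lra.
assert (exp (2 * LL * t) <= exp (2 * LL * S)) by (apply exp_mono; nra).
apply Rle_lt_trans with (2 * d' * exp (2 * LL * S)); [apply Rmult_le_compat_l; lra|].
unfold d'; replace (2 * (d / (4 * exp (2 * LL * S))) * exp (2 * LL * S)) with (d / 2) by (field; lra); lra.
Qed.

(** On a compact time interval the strict inequalities hold with a positive
    margin, which [flow_close] preserves. *)
Lemma low_open lam0 : 0 <= lam0 <= 2 -> low lam0 -> exists e, 0 < e /\
  forall lam, 0 <= lam <= 2 -> Rabs (lam - lam0) < e -> low lam.
Proof.
intros Hl [S [HS [HW H]]].
destruct HY as [Hc _].
destruct (positive_min (Y (c lam0) 3%nat) S ltac:(lra)) as [m1 [Hm1 H1]].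
{ intros; apply Hc; lia. } { intros; now apply H. }
destruct (positive_min (fun t => - Y (c lam0) 2%nat t) S ltac:(lra)) as [m2 [Hm2 H2]].
{ intros t; assert (C := Hc (c lam0) 2%nat t ltac:(lia)); cauto. } { intros t Ht; destruct (H t Ht); lra. }
pose (d := Rmin (-1 - Y (c lam0) 1%nat S) (Rmin m1 m2)).
assert (L1 : d <= -1 - Y (c lam0) 1%nat S) by apply Rmin_l.
assert (L2 : d <= Rmin m1 m2) by apply Rmin_r.
assert (L3 := Rmin_l m1 m2); assert (L4 := Rmin_r m1 m2).
destruct (flow_close lam0 S d Hl ltac:(lra) ltac:(unfold d; repeat apply Rmin_pos; lra)) as [e [He Hd]].
exists e; split; [assumption|]; intros lam Hlam Hlt; exists S; split; [assumption|]; split.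
- specialize (Hd lam Hlam Hlt 1%nat S ltac:(lia) ltac:(lra)); apply Rabs_def2 in Hd; lra.
- intros t Ht; assert (D2 := Hd lam Hlam Hlt 2%nat t ltac:(lia) Ht).
  assert (D3 := Hd lam Hlam Hlt 3%nat t ltac:(lia) Ht); apply Rabs_def2 in D2, D3.
  specialize (H1 t Ht); specialize (H2 t Ht); cbv beta in H2; lra.
Qed.

Lemma other_open lam0 : 0 <= lam0 <= 2 -> other lam0 -> exists e, 0 < e /\
  forall lam, 0 <= lam <= 2 -> Rabs (lam - lam0) < e -> other lam.
Proof.
intros Hl [S [HS [Hor H]]].
destruct HY as [Hc _].
destruct (positive_min (fun t => Y (c lam0) 1%nat t + 1) S ltac:(lra)) as [m1 [Hm1 H1]].
{ intros t; assert (C := Hc (c lam0) 1%nat t ltac:(lia)); cauto. } { intros t Ht; specialize (H t Ht); lra. }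
assert (Hm2 : exists m2, 0 < m2 /\ (m2 <= - Y (c lam0) 3%nat S \/ m2 <= Y (c lam0) 2%nat S)).
{ destruct Hor; [exists (- Y (c lam0) 3%nat S) | exists (Y (c lam0) 2%nat S)]; lra. }
destruct Hm2 as [m2 [Hm2 Hor2]].
assert (L3 := Rmin_l m1 m2); assert (L4 := Rmin_r m1 m2).
destruct (flow_close lam0 S (Rmin m1 m2) Hl ltac:(lra) ltac:(apply Rmin_pos; lra)) as [e [He Hd]].
exists e; split; [assumption|]; intros lam Hlam Hlt; exists S; split; [assumption|]; split.
- assert (D2 := Hd lam Hlam Hlt 2%nat S ltac:(lia) ltac:(lra)).
  assert (D3 := Hd lam Hlam Hlt 3%nat S ltac:(lia) ltac:(lra)); apply Rabs_def2 in D2, D3.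
  destruct Hor2; [left|right]; lra.
- intros t Ht; assert (D1 := Hd lam Hlam Hlt 1%nat t ltac:(lia) Ht); apply Rabs_def2 in D1.
  specialize (H1 t Ht); cbv beta in H1; lra.
Qed.

(** With parameter zero the orbit is flat space with [w = 1]. *)
Lemma flat_orbit t : 0 <= t -> Y (c 0) 0%nat t = / rs * exp (- t) /\ Y (c 0) 1%nat t = 1 /\
  Y (c 0) 3%nat t = 1 /\ Y (c 0) 4%nat t = 1.
Proof.
intros Ht.
destruct HY as [_ [_ [_ [_ [_ [_ Hu]]]]]].
assert (HL : 10 <= / rs) by (rewrite <- (Rinv_inv 10); apply Rinv_le_contravar; lra).
pose (x := fun (i : nat) (t : R) => match i with
  | O => / rs * exp (- t) | 2%nat => 0 | _ => 1 end).
assert (H : forall i u, (i < 5)%nat -> 0 <= u <= t -> x i u = Y (c 0) i u).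
{ apply Hu.
  - intros i u Hi; destruct i as [|[|[|i]]]; [|apply cconst|apply cconst|apply cconst].
    eapply is_derive_cont; unfold x; dauto.
  - intros i u Hi Hu'; assert (E : 0 < exp (- u) <= 1).
    { split; [apply exp_pos|rewrite <- exp_0; apply exp_mono; lra]. }
    destruct i as [|[|[|i]]]; unfold x.
    + rewrite Rabs_pos_eq by (apply Rmult_le_pos; lra).
      assert (/ rs * exp (- u) <= / rs * 1) by (apply Rmult_le_compat_l; lra); lra.
    + rewrite Rabs_R1; lra.
    + rewrite Rabs_R0; lra.
    + rewrite Rabs_R1; lra.
  - intros i u Hi Hu'.
    assert (Hz : forall (g : R -> R), (forall v, 0 <= v <= u -> g v = 0) -> avg_int 0 g u = 0).
    { intros g Hg; rewrite (avg_int_ext 0 g (fun _ => 0) u ltac:(lra) Hg); unfold avg_int.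
      rewrite (RInt_ext (V := R_CompleteNormedModule) _ (fun _ => 0)) by (intros; apply Rmult_0_r).
      rewrite (RInt_const (V := R_CompleteNormedModule)); change ((u - 0) * 0 / 1 = 0); field. }
    destruct Hflat as [F1 [F2 F3]].
    assert (Hw : w_of rs (q 0 rs) (p 0 rs) = 1) by (rewrite F1, F2; unfold w_of, v_of; field).
    assert (Hdw : dw_of rs (q 0 rs) (p 0 rs) = 0) by (rewrite F1, F2; unfold dw_of, z_of; field).
    assert (HA : A_of rs (q 0 rs) (b 0 rs) = 1) by (rewrite F1, F3; unfold A_of, a_of; field).
    unfold c, start; rewrite Hw, Hdw, HA.
    destruct i as [|[|[|[|[|i]]]]]; [| | | | |lia]; unfold start_of; rewrite ?sqrt_1.
    + unfold avg_int; rewrite (is_RInt_unique (V := R_CompleteNormedModule) _ _ _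
        (minus (/ rs * exp (- u)) (/ rs * exp (- 0)))).
      * unfold x; rewrite Ropp_0, exp_0.
        change (/ rs * exp (- u) = / rs + (/ rs * exp (- u) - / rs * 1) / 1); field; lra.
      * apply (is_RInt_derive (V := R_CompleteNormedModule) (fun u => / rs * exp (- u))).
        -- intros v _; eapply is_derive_eq; [dauto|]; simpl; field; lra.
        -- intros v _; eapply is_derive_cont; unfold x, flow_field; dauto.
    + rewrite Hz; [unfold x; ring|]; intros v Hv; unfold x, flow_field; ring.
    + rewrite Hz; [unfold x; ring|]; intros v Hv; unfold x, flow_field; ring.
    + rewrite Hz; [unfold x; ring|]; intros v Hv; unfold x, flow_field; ring.
    + rewrite Hz; [unfold x; field; lra|]; intros v Hv; unfold x, flow_field; ring. }
repeat split.
- rewrite <- (H 0%nat) by (lia || lra); reflexivity.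
- rewrite <- (H 1%nat) by (lia || lra); reflexivity.
- rewrite <- (H 3%nat) by (lia || lra); reflexivity.
- rewrite <- (H 4%nat) by (lia || lra); reflexivity.
Qed.

(** On a long interval the orbit stays close to flat space with [w = 1], and at
    its end the radius is large. *)
Lemma small_low : exists e, 0 < e <= 2 /\ forall lam, 0 < lam < e -> low lam.
Proof.
pose (S := 200 / rs).
assert (HS : 0 <= S) by (apply Rdiv_le_0_compat; lra).
destruct (flow_close 0 S (/ 200) ltac:(lra) HS ltac:(lra)) as [e [He H]].
exists (Rmin e 2); assert (L1 := Rmin_l e 2); assert (L2 := Rmin_r e 2).
split; [split; [apply Rmin_pos; lra|assumption]|]; intros lam Hlam.
specialize (H lam ltac:(lra) ltac:(rewrite Rminus_0_r, Rabs_pos_eq; lra)).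
apply (near_flat_exits_low (/ rs) (Y (c lam) 0%nat) _ _ _ (Y (c lam) 4%nat) S (shoot_orbit lam ltac:(lra)) HS).
- intros t Ht; destruct (flat_orbit t ltac:(lra)) as [E0 [E1 [E3 E4]]].
  assert (D1 := H 1%nat t ltac:(lia) Ht); assert (D3 := H 3%nat t ltac:(lia) Ht); assert (D4 := H 4%nat t ltac:(lia) Ht).
  rewrite E1 in D1; rewrite E3 in D3; rewrite E4 in D4; lra.
- destruct (flat_orbit S HS) as [E0 _].
  assert (D0 := H 0%nat S ltac:(lia) ltac:(lra)); rewrite E0 in D0; apply Rabs_def2 in D0.
  assert (E : / rs * exp (- S) <= / 200); [|lra].
  rewrite exp_Ropp.
  assert (X := exp_ineq1_le S).
  apply (Rmult_le_reg_r (exp S)); [apply exp_pos|].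
  replace (/ rs * / exp S * exp S) with (/ rs) by (field; split; [apply Rgt_not_eq, exp_pos | lra]).
  assert (S = 200 * / rs) by reflexivity; lra.
Qed.

(** Parameter 2 starts inside all barriers, and [trapped] applies up to the
    first time at which [w = -1/5]. *)
Lemma two_confined t : 0 <= t ->
  (forall u, 0 <= u <= t -> 0 < Y (c 2) 3%nat u /\ Y (c 2) 2%nat u < 0) -> Y (c 2) 1%nat t <= - / 5 -> False.
Proof.
intros Ht Hpos HWt.
assert (orb := shoot_orbit 2 ltac:(lra)).
destruct HY as [Hc [H0 _]].
destruct (first_hit (Y (c 2) 1%nat) (- / 5) t Ht) as [T [HT [HWT Hb]]].
{ intros; apply Hc; lia. }
{ generalize (o_W0 _ _ _ _ _ _ orb); lra. }
{ assumption. }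
assert (Hgood : forall u, 0 <= u <= T -> good (Y (c 2) 1%nat) (Y (c 2) 2%nat) (Y (c 2) 3%nat) u).
{ intros u Hu; destruct (Hpos u ltac:(lra)).
  assert (- / 5 <= Y (c 2) 1%nat u) by (destruct (Req_dec u T) as [->|]; [lra|left; apply Hb; lra]).
  unfold good; lra. }
destruct Hsteep as [T1 [T2 T3]].
destruct (steep_start rs _ _ _ Hrs T1 T2 T3) as [G1 [G2 [G3 G4]]].
assert (sol := Hloc 2 ltac:(lra)).
assert (HA : 9 / 10 <= A_of rs (q 2 rs) (b 2 rs) <= 101 / 100) by (apply (local_A_bound 2 rs _ _ _ ltac:(lra) sol); lra).
set (w := w_of rs (q 2 rs) (p 2 rs)) in *; set (dw := dw_of rs (q 2 rs) (p 2 rs)) in *;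
set (A := A_of rs (q 2 rs) (b 2 rs)) in *.
assert (HN : 0 < sqrt A) by (apply sqrt_lt_R0; lra).
assert (HNN : sqrt A * sqrt A = A) by (apply sqrt_sqrt; lra).
assert (S0 : Y (c 2) 0%nat 0 = / rs) by (rewrite H0; [reflexivity|lia]).
assert (S1 : Y (c 2) 1%nat 0 = w) by (rewrite H0; [reflexivity|lia]).
assert (S2 : Y (c 2) 2%nat 0 = rs * sqrt A * dw) by (rewrite H0; [reflexivity|lia]).
assert (S3 : Y (c 2) 3%nat 0 = sqrt A) by (rewrite H0; [reflexivity|lia]).
assert (S4 : Y (c 2) 4%nat 0 = (1 + A + 2 * A * dw ^ 2 - ((1 - w ^ 2) / rs) ^ 2) / (2 * sqrt A))
  by (rewrite H0; [reflexivity|lia]).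
assert (Hy0 : - (rs * sqrt A * dw * / rs) / sqrt A = - dw) by (field; lra).
assert (HA0 : sqrt A ^ 2 = A) by (rewrite <- HNN at 2; ring).
apply (trapped (/ rs) (Y (c 2) 0%nat) (Y (c 2) 1%nat) (Y (c 2) 2%nat) (Y (c 2) 3%nat) (Y (c 2) 4%nat) T
  orb ltac:(lra) Hgood HWT); rewrite ?S0, ?S1, ?S2, ?S3, ?Rinv_inv, ?Hy0, ?HA0; try assumption; try lra.
rewrite S4; apply (Rmult_lt_reg_r (2 * sqrt A)); [lra|].
replace ((1 + A + 2 * A * dw ^ 2 - ((1 - w ^ 2) / rs) ^ 2) / (2 * sqrt A) * (2 * sqrt A))
  with (1 + A + 2 * A * dw ^ 2 - ((1 - w ^ 2) / rs) ^ 2) by (field; lra).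
assert (0 <= (sqrt A - 1) ^ 2) by apply pow2_ge_0; lra.
Qed.

(** Exiting through [w = -1] and staying in the good region for ever both carry
    [w] below -1/5. *)
Lemma two_other : other 2.
Proof.
assert (orb := shoot_orbit 2 ltac:(lra)).
destruct (Classical_Prop.classic (other 2)) as [|Hno]; [assumption|exfalso].
destruct (Classical_Prop.classic (low 2)) as [[S [HS [HW H]]]|Hnl].
- apply (two_confined S); [lra|assumption|lra].
- assert (Hg := good_forever _ _ _ _ _ _ orb Hnl Hno).
  destruct (W_tends_m1 _ _ _ _ _ _ orb Hg (/ 5) ltac:(lra)) as [S [HS H]].
  specialize (H S ltac:(lra)); apply Rabs_def2 in H.
  apply (two_confined S); [lra| |lra].
  intros u Hu; destruct (Hg u ltac:(lra)) as [? [? _]]; split; assumption.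
Qed.

(** The supremum of the initial interval of parameters exiting through
    [w = -1] belongs to neither open set. *)
Lemma critical_parameter : exists lam, 0 < lam < 2 /\
  forall t, 0 <= t -> good (Y (c lam) 1%nat) (Y (c lam) 2%nat) (Y (c lam) 3%nat) t.
Proof.
destruct small_low as [e0 [He0 Hlow0]].
pose (E := fun x => 0 <= x <= 2 /\ forall mu, 0 < mu < x -> low mu).
destruct (completeness E) as [lam [Hub Hlub]].
- exists 2; intros x [Hx _]; lra.
- exists e0; split; [lra|]; exact Hlow0.
- assert (Hlam : 0 < lam <= 2).
  { split; [apply Rlt_le_trans with e0; [lra|apply Hub; split; [lra|exact Hlow0]]|].
    apply Hlub; intros x [Hx _]; lra. }
  assert (Hbelow : forall mu, 0 < mu < lam -> low mu).
  { intros mu Hmu; destruct (Classical_Prop.classic (low mu)) as [|Hn]; [assumption|exfalso].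
    assert (lam <= mu); [|lra]; apply Hlub; intros x [Hx1 Hx2].
    destruct (Rle_dec x mu); [assumption|exfalso]; apply Hn, Hx2; lra. }
  assert (Hno : ~ other lam).
  { intros Ho; destruct (other_open lam ltac:(lra) Ho) as [e [He H]].
    pose (mu := lam - Rmin (lam / 2) (e / 2)).
    assert (L1 := Rmin_l (lam / 2) (e / 2)); assert (L2 := Rmin_r (lam / 2) (e / 2)).
    assert (L3 : 0 < Rmin (lam / 2) (e / 2)) by (apply Rmin_pos; lra).
    apply (low_other_disjoint mu); [apply Hbelow; unfold mu; lra|].
    apply H; [unfold mu; lra|]; unfold mu; apply Rabs_def1; lra. }
  assert (Hlam2 : lam < 2).
  { destruct (Req_dec lam 2) as [->|]; [exfalso; apply Hno, two_other|lra]. }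
  assert (Hnl : ~ low lam).
  { intros Hl; destruct (low_open lam ltac:(lra) Hl) as [e [He H]].
    pose (x := lam + Rmin (2 - lam) e).
    assert (L1 := Rmin_l (2 - lam) e); assert (L2 := Rmin_r (2 - lam) e).
    assert (L3 : 0 < Rmin (2 - lam) e) by (apply Rmin_pos; lra).
    assert (x <= lam); [|unfold x in *; lra].
    apply Hub; split; [unfold x; lra|]; intros mu Hmu.
    destruct (Rlt_dec mu lam); [apply Hbelow; lra|].
    apply H; [unfold x in Hmu; lra|]; apply Rabs_def1; unfold x in Hmu; lra. }
  exists lam; split; [lra|].
  exact (good_forever _ _ _ _ _ _ (shoot_orbit lam ltac:(lra)) Hnl Hno).
Qed.

End Shooting.

Lemma connecting_orbit_exists : exists lam rs (q p b l W P N K : R -> R),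
  0 < lam < 2 /\ 0 < rs <= / 10 /\ local_solution lam rs q p b /\
  orbit (/ rs) l W P N K /\ (forall t, 0 <= t -> good W P N t) /\
  W 0 = w_of rs (q rs) (p rs) /\
  P 0 = rs * sqrt (A_of rs (q rs) (b rs)) * dw_of rs (q rs) (p rs) /\
  N 0 = sqrt (A_of rs (q rs) (b rs)).
Proof.
destruct local_family_exists as [rs [q [p [b [Hrs [Hloc [Hcont [Hflat Hsteep]]]]]]]].
assert (HM : 0 <= 15 * / rs + 1) by (assert (0 < / rs) by (apply Rinv_0_lt_compat; lra); lra).
destruct (truncated_solution_exists 5 (fun _ => O) flow_field (15 * / rs + 1) HM) as [Y [LL [B [HL [HB HY]]]]].
{ intros i Hi; now apply flow_field_lipschitz. }
destruct (critical_parameter rs q p b Hrs Hloc Hcont Hflat Hsteep Y LL B HL HY) as [lam [Hlam Hgood]].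
assert (orb := shoot_orbit rs q p b Hrs Hloc Y LL B HY lam ltac:(lra)).
exists lam, rs, (q lam), (p lam), (b lam).
do 5 eexists; split; [exact Hlam|]; split; [exact Hrs|]; split; [apply Hloc; lra|].
split; [exact orb|]; split; [exact Hgood|].
destruct HY as [_ [H0 _]]; repeat split; (rewrite H0; [reflexivity|lia]).
Qed.

(** * Smooth functions on the closed half line *)

(** The derivative relative to [D], in a form without division. *)
Definition slope (D : R -> Prop) (f : R -> R) (x a : R) : Prop :=
  forall e, 0 < e -> exists d, 0 < d /\ forall y, D y -> Rabs (y - x) < d ->
    Rabs (f y - f x - a * (y - x)) <= e * Rabs (y - x).

Lemma slope_D_in D f df x : slope D f x (df x) <-> D_in f df D x.
Proof.
unfold D_in, limit1_in, limit_in, D_x; simpl; unfold Rdist; split; intros H e He.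
- destruct (H (e / 2) ltac:(lra)) as [d [Hd Hy]]; exists d; split; [assumption|].
  intros y [[HDy Hne] Hlt].
  assert (Hp : 0 < Rabs (y - x)) by (apply Rabs_pos_lt; lra).
  replace ((f y - f x) / (y - x) - df x) with ((f y - f x - df x * (y - x)) / (y - x)) by (field; lra).
  unfold Rdiv; rewrite Rabs_mult, Rabs_inv.
  apply (Rmult_lt_reg_r (Rabs (y - x))); [assumption|].
  replace (Rabs (f y - f x - df x * (y - x)) * / Rabs (y - x) * Rabs (y - x))
    with (Rabs (f y - f x - df x * (y - x))) by (field; lra).
  specialize (Hy y HDy Hlt); nra.
- destruct (H e He) as [d [Hd Hy]]; exists d; split; [assumption|]; intros y HDy Hlt.
  destruct (Req_dec y x) as [->|Hne].
  + rewrite !Rminus_diag, Rmult_0_r, Rminus_0_r, Rabs_R0; lra.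
  + specialize (Hy y (conj (conj HDy (not_eq_sym Hne)) Hlt)).
    replace (f y - f x - df x * (y - x)) with (((f y - f x) / (y - x) - df x) * (y - x)) by (field; lra).
    rewrite Rabs_mult; apply Rmult_le_compat_r; [apply Rabs_pos|lra].
Qed.

Lemma slope_of_derive D f x a : is_derive f x a -> slope D f x a.
Proof.
intros Hd e He; apply is_derive_Reals in Hd; destruct (Hd e He) as [d H].
exists d; split; [apply cond_pos|]; intros y _ Hy.
destruct (Req_dec y x) as [->|Hne].
- rewrite !Rminus_diag, Rmult_0_r, Rminus_0_r, Rabs_R0; lra.
- specialize (H (y - x) ltac:(lra) Hy); replace (x + (y - x)) with y in H by ring.
  replace (f y - f x - a * (y - x)) with (((f y - f x) / (y - x) - a) * (y - x)) by (field; lra).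
  rewrite Rabs_mult; apply Rmult_le_compat_r; [apply Rabs_pos|lra].
Qed.

Lemma derive_of_slope f x a : 0 < x -> slope half_line f x a -> is_derive f x a.
Proof.
intros Hx H; apply is_derive_Reals; intros e He.
destruct (H (e / 2) ltac:(lra)) as [d [Hd Hy]].
assert (Hm : 0 < Rmin d x) by (apply Rmin_pos; assumption).
exists (mkposreal _ Hm); simpl; intros h Hh Hlt.
assert (L1 := Rmin_l d x); assert (L2 := Rmin_r d x).
specialize (Hy (x + h)); replace (x + h - x) with h in Hy by ring.
apply Rabs_def2 in Hlt as Hlt'.
specialize (Hy ltac:(unfold half_line; lra) ltac:(apply Rabs_def1; lra)).
replace ((f (x + h) - f x) / h - a) with ((f (x + h) - f x - a * h) / h) by (field; lra).
assert (Hp : 0 < Rabs h) by (apply Rabs_pos_lt; lra).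
unfold Rdiv; rewrite Rabs_mult, Rabs_inv.
apply (Rmult_lt_reg_r (Rabs h)); [assumption|].
replace (Rabs (f (x + h) - f x - a * h) * / Rabs h * Rabs h)
  with (Rabs (f (x + h) - f x - a * h)) by (field; lra); nra.
Qed.

Lemma slope_ext D f g x a : D x -> (forall y, D y -> f y = g y) -> slope D f x a -> slope D g x a.
Proof.
intros HDx Hfg H e He; destruct (H e He) as [d [Hd Hy]]; exists d; split; [assumption|].
intros y HDy Hlt; rewrite <- !Hfg by assumption; now apply Hy.
Qed.

Lemma slope_plus D f g x a b : slope D f x a -> slope D g x b -> slope D (fun y => f y + g y) x (a + b).
Proof.
intros Hf Hg; apply (slope_D_in D (fun y => f y + g y) (fun _ => a + b)).
apply (Dadd D (fun _ => a) (fun _ => b) f g x); now apply slope_D_in.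
Qed.

Lemma slope_mult D f g x a b : slope D f x a -> slope D g x b ->
  slope D (fun y => f y * g y) x (a * g x + f x * b).
Proof.
intros Hf Hg; apply (slope_D_in D (fun y => f y * g y) (fun y => a * g y + f y * b)).
apply (Dmult D (fun _ => a) (fun _ => b) f g x); now apply slope_D_in.
Qed.

Lemma slope_const D c x : slope D (fun _ => c) x 0.
Proof. apply slope_of_derive, dconst. Qed.

Definition cont_at (D : R -> Prop) (f : R -> R) (x : R) : Prop :=
  forall e, 0 < e -> exists d, 0 < d /\ forall y, D y -> Rabs (y - x) < d -> Rabs (f y - f x) < e.

Lemma slope_cont D f x a : slope D f x a -> cont_at D f x.
Proof.
intros H e He; destruct (H 1 ltac:(lra)) as [d [Hd Hy]].
assert (Ha := Rabs_pos a).
exists (Rmin d (e / (2 + Rabs a))).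
assert (L1 := Rmin_l d (e / (2 + Rabs a))); assert (L2 := Rmin_r d (e / (2 + Rabs a))).
split; [apply Rmin_pos; [assumption|apply Rdiv_lt_0_compat; lra]|]; intros y HDy Hlt.
specialize (Hy y HDy ltac:(lra)).
assert (Hlt2 : Rabs (y - x) < e / (2 + Rabs a)) by lra.
apply Rlt_div_r in Hlt2; [|lra].
replace (f y - f x) with ((f y - f x - a * (y - x)) + a * (y - x)) by ring.
eapply Rle_lt_trans; [apply Rabs_triang|]; rewrite Rabs_mult.
assert (0 <= Rabs (y - x)) by apply Rabs_pos; nra.
Qed.

Lemma slope_comp D f h x a b : slope D f x a -> is_derive h (f x) b -> slope D (fun y => h (f y)) x (b * a).
Proof.
intros Hf Hh e He.
assert (Hb := Rabs_pos b); assert (Ha := Rabs_pos a).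
pose (e1 := e / (2 * (Rabs a + 1))); assert (He1 : 0 < e1) by (apply Rdiv_lt_0_compat; lra).
pose (e2 := Rmin 1 (e / (2 * (Rabs b + 1)))).
assert (He2 : 0 < e2) by (apply Rmin_pos; [lra|apply Rdiv_lt_0_compat; lra]).
assert (M1 := Rmin_l 1 (e / (2 * (Rabs b + 1)))); assert (M2 := Rmin_r 1 (e / (2 * (Rabs b + 1)))); fold e2 in M1, M2.
destruct (slope_of_derive (fun _ => True) h (f x) b Hh e1 He1) as [d1 [Hd1 H1]].
destruct (Hf e2 He2) as [d2 [Hd2 H2]].
destruct (slope_cont D f x a Hf d1 Hd1) as [d3 [Hd3 H3]].
exists (Rmin d2 d3); split; [apply Rmin_pos; assumption|]; intros y HDy Hlt.
assert (L1 := Rmin_l d2 d3); assert (L2 := Rmin_r d2 d3).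
specialize (H2 y HDy ltac:(lra)); specialize (H1 (f y) I (H3 y HDy ltac:(lra))).
assert (Hp : 0 <= Rabs (y - x)) by apply Rabs_pos.
assert (Hfy : Rabs (f y - f x) <= (Rabs a + 1) * Rabs (y - x)).
{ replace (f y - f x) with ((f y - f x - a * (y - x)) + a * (y - x)) by ring.
  eapply Rle_trans; [apply Rabs_triang|]; rewrite Rabs_mult; nra. }
replace (h (f y) - h (f x) - b * a * (y - x)) with
  ((h (f y) - h (f x) - b * (f y - f x)) + b * (f y - f x - a * (y - x))) by ring.
eapply Rle_trans; [apply Rabs_triang|]; rewrite Rabs_mult.
assert (B1 : e1 * Rabs (f y - f x) <= e / 2 * Rabs (y - x)).
{ apply Rle_trans with (e1 * ((Rabs a + 1) * Rabs (y - x))); [apply Rmult_le_compat_l; lra|].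
  right; unfold e1; field; lra. }
assert (B2 : Rabs b * Rabs (f y - f x - a * (y - x)) <= e / 2 * Rabs (y - x)).
{ apply Rle_trans with ((Rabs b + 1) * (e / (2 * (Rabs b + 1)) * Rabs (y - x))).
  - apply Rmult_le_compat; [lra|apply Rabs_pos|lra|]; nra.
  - right; field; lra. }
lra.
Qed.

(** At the end point, a factor [r] provides the derivative. *)
Lemma slope_at_0 (f g : R -> R) : (forall r, 0 <= r -> f r = f 0 + r * g r) ->
  cont_at half_line g 0 -> slope half_line f 0 (g 0).
Proof.
intros Hf Hg e He; destruct (Hg e He) as [d [Hd Hy]]; exists d; split; [assumption|]; intros y HDy Hlt.
specialize (Hy y HDy Hlt); rewrite (Hf y HDy).
replace (f 0 + y * g y - f 0 - g 0 * (y - 0)) with ((g y - g 0) * (y - 0)) by ring.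
rewrite Rabs_mult; apply Rmult_le_compat_r; [apply Rabs_pos|lra].
Qed.

Lemma continuous_of_cont_at f x : 0 < x -> cont_at half_line f x -> continuous f x.
Proof.
intros Hx H; apply continuous_eps; intros e He; destruct (H e He) as [d [Hd Hy]].
exists (Rmin d x); assert (L1 := Rmin_l d x); assert (L2 := Rmin_r d x).
split; [apply Rmin_pos; assumption|]; intros y Hlt; apply Rabs_def2 in Hlt as Hlt'.
apply Hy; [unfold half_line; lra|lra].
Qed.

Lemma cont_at_of_continuous D f x : continuous f x -> cont_at D f x.
Proof.
intros H e He; destruct (proj1 (continuous_eps f x) H e He) as [d [Hd Hy]].
exists d; split; [assumption|]; intros y _; apply Hy.
Qed.

Lemma cont_half_extends f : (forall x, 0 <= x -> cont_at half_line f x) ->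
  forall x, continuous (fun r => f (Rmax 0 r)) x.
Proof.
intros H x; apply continuous_eps; intros e He.
destruct (H (Rmax 0 x) (Rmax_l 0 x) e He) as [d [Hd Hy]].
exists d; split; [assumption|]; intros y Hlt; apply Hy; [apply Rmax_l|].
eapply Rle_lt_trans; [|exact Hlt].
unfold Rmax; repeat destruct Rle_dec; unfold Rabs; repeat destruct Rcase_abs; lra.
Qed.

(** [n] times continuously differentiable on the half line. *)
Fixpoint Ck (n : nat) (f : R -> R) : Prop :=
  match n with
  | O => forall x, 0 <= x -> cont_at half_line f x
  | S n => exists f', is_deriv_half_line f f' /\ Ck n f'
  end.

Lemma deriv_ext f g f' g' : (forall r, 0 <= r -> f r = g r) -> (forall r, 0 <= r -> f' r = g' r) ->
  is_deriv_half_line f f' -> is_deriv_half_line g g'.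
Proof.
intros Hfg Hfg' H r Hr; apply slope_D_in; apply slope_ext with f; [exact Hr|exact Hfg|].
rewrite <- Hfg' by exact Hr; apply slope_D_in; now apply H.
Qed.

Lemma Ck_ext n f g : (forall r, 0 <= r -> f r = g r) -> Ck n f -> Ck n g.
Proof.
intros Hfg; destruct n as [|n].
- intros H x Hx e He; destruct (H x Hx e He) as [d [Hd Hy]]; exists d; split; [assumption|].
  intros y HDy Hlt; rewrite <- !Hfg by assumption; now apply Hy.
- intros [f' [H1 H2]]; exists f'; split; [|assumption]; now apply deriv_ext with f f'.
Qed.

Lemma Ck_pred n f : Ck (S n) f -> Ck n f.
Proof.
revert f; induction n as [|n IH]; intros f [f' [H1 H2]].
- intros x Hx; apply slope_cont with (f' x); now apply slope_D_in, H1.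
- exists f'; split; [assumption|now apply IH].
Qed.

Lemma Ck_0 n f : Ck n f -> Ck 0 f.
Proof. induction n as [|n IH]; [auto|]; intros H; now apply IH, Ck_pred. Qed.

Lemma Ck_const n c : Ck n (fun _ => c).
Proof.
revert c; induction n as [|n IH]; intros c.
- intros x _ e He; exists 1; split; [lra|]; intros; rewrite Rminus_diag, Rabs_R0; exact He.
- exists (fun _ => 0); split; [|apply IH]; intros r Hr; apply slope_D_in, slope_const.
Qed.

Lemma Ck_id n : Ck n (fun r => r).
Proof.
destruct n as [|n].
- intros x _ e He; exists e; split; [assumption|]; intros; assumption.
- exists (fun _ => 1); split; [|apply Ck_const]; intros r Hr.
  apply slope_D_in, slope_of_derive, did.
Qed.

Lemma Ck_plus n f g : Ck n f -> Ck n g -> Ck n (fun r => f r + g r).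
Proof.
revert f g; induction n as [|n IH]; intros f g Hf Hg.
- intros x Hx e He; destruct (Hf x Hx (e / 2) ltac:(lra)) as [d1 [Hd1 H1]];
  destruct (Hg x Hx (e / 2) ltac:(lra)) as [d2 [Hd2 H2]].
  exists (Rmin d1 d2); split; [apply Rmin_pos; assumption|]; intros y HDy Hlt.
  assert (L1 := Rmin_l d1 d2); assert (L2 := Rmin_r d1 d2).
  specialize (H1 y HDy ltac:(lra)); specialize (H2 y HDy ltac:(lra)).
  apply Rabs_def2 in H1, H2; apply Rabs_def1; lra.
- destruct Hf as [f' [F1 F2]]; destruct Hg as [g' [G1 G2]].
  exists (fun r => f' r + g' r); split; [|now apply IH]; intros r Hr.
  apply slope_D_in, (slope_plus _ f g); apply slope_D_in; [now apply F1|now apply G1].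
Qed.

Lemma Ck_mult n f g : Ck n f -> Ck n g -> Ck n (fun r => f r * g r).
Proof.
revert f g; induction n as [|n IH]; intros f g Hf Hg.
- intros x Hx e He.
  assert (A1 := Rabs_pos (f x)); assert (A2 := Rabs_pos (g x)).
  pose (k := e / (Rabs (f x) + Rabs (g x) + 2)).
  assert (Hk : 0 < k) by (apply Rdiv_lt_0_compat; lra).
  pose (m := Rmin 1 k); assert (Hm : 0 < m) by (apply Rmin_pos; lra).
  assert (M1 : m <= 1) by apply Rmin_l; assert (M2 : m <= k) by apply Rmin_r.
  destruct (Hf x Hx m Hm) as [d1 [Hd1 H1]]; destruct (Hg x Hx m Hm) as [d2 [Hd2 H2]].
  exists (Rmin d1 d2); split; [apply Rmin_pos; assumption|]; intros y HDy Hlt.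
  assert (L1 := Rmin_l d1 d2); assert (L2 := Rmin_r d1 d2).
  specialize (H1 y HDy ltac:(lra)); specialize (H2 y HDy ltac:(lra)).
  replace (f y * g y - f x * g x) with
    ((f y - f x) * (g y - g x) + ((f y - f x) * g x + f x * (g y - g x))) by ring.
  eapply Rle_lt_trans; [apply Rabs_triang|].
  eapply Rle_lt_trans; [apply Rplus_le_compat_l, Rabs_triang|]; rewrite !Rabs_mult.
  assert (P1 := Rabs_pos (f y - f x)); assert (P2 := Rabs_pos (g y - g x)).
  assert (Rabs (f y - f x) * Rabs (g y - g x) <= m * 1) by (apply Rmult_le_compat; lra).
  assert (Rabs (f y - f x) * Rabs (g x) <= m * Rabs (g x)) by (apply Rmult_le_compat_r; lra).
  assert (Rabs (f x) * Rabs (g y - g x) <= Rabs (f x) * m) by (apply Rmult_le_compat_l; lra).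
  assert (k * (Rabs (f x) + Rabs (g x) + 2) = e) by (unfold k; field; lra).
  assert (m * (Rabs (f x) + Rabs (g x) + 1) < e) by nra.
  lra.
- assert (Hf0 := Ck_pred n f Hf); assert (Hg0 := Ck_pred n g Hg).
  destruct Hf as [f' [F1 F2]]; destruct Hg as [g' [G1 G2]].
  exists (fun r => f' r * g r + f r * g' r); split; [|apply Ck_plus; now apply IH]; intros r Hr.
  apply slope_D_in, (slope_mult _ f g); apply slope_D_in; [now apply F1|now apply G1].
Qed.

Lemma Ck_opp n f : Ck n f -> Ck n (fun r => - f r).
Proof.
intros H; apply Ck_ext with (fun r => (-1) * f r); [intros; ring|].
apply (Ck_mult n (fun _ => -1)); [apply Ck_const | exact H].
Qed.

Lemma Ck_minus n f g : Ck n f -> Ck n g -> Ck n (fun r => f r - g r).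
Proof. intros Hf Hg; apply (Ck_plus n f (fun r => - g r)); [exact Hf | now apply Ck_opp]. Qed.

Lemma Ck_pow n f k : Ck n f -> Ck n (fun r => f r ^ k).
Proof. intros H; induction k as [|k IH]; [exact (Ck_const n 1) | exact (Ck_mult n f _ H IH)]. Qed.

Lemma Ck_inv n f : (forall r, 0 <= r -> f r <> 0) -> Ck n f -> Ck n (fun r => / f r).
Proof.
intros Hnz; induction n as [|n IH]; intros Hf.
- intros x Hx e He.
  assert (C := cont_half_extends f Hf x).
  assert (Hx0 : Rmax 0 x = x) by (apply Rmax_right; lra).
  assert (Ci := cinv (fun r => f (Rmax 0 r)) x C ltac:(cbv beta; rewrite Hx0; now apply Hnz)).
  destruct (proj1 (continuous_eps _ x) Ci e He) as [d [Hd Hy]]; cbv beta in Hy; rewrite Hx0 in Hy.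
  exists d; split; [assumption|]; intros y HDy Hlt; specialize (Hy y Hlt).
  now rewrite (Rmax_right 0 y) in Hy by exact HDy.
- assert (Hi := IH (Ck_pred n f Hf)).
  destruct Hf as [f' [F1 F2]].
  exists (fun r => - (/ f r * / f r) * f' r); split.
  + intros r Hr; apply slope_D_in.
    apply (slope_comp _ f Rinv); [apply slope_D_in; now apply F1|].
    assert (D := dinv (fun t => t) (f r) 1 (did (f r)) (Hnz r Hr)); cbv beta in D.
    eapply is_derive_eq; [exact D|]; field; now apply Hnz.
  + apply Ck_mult; [apply Ck_opp; now apply Ck_mult | exact F2].
Qed.

Ltac ck_auto :=
  match goal with
  | |- Ck _ (fun _ => ?c) => apply (Ck_const _ c)
  | |- Ck _ (fun r => r) => apply Ck_id
  | |- Ck _ (fun x => @?f x + @?g x) => apply (Ck_plus _ f g); ck_auto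
  | |- Ck _ (fun x => @?f x - @?g x) => apply (Ck_minus _ f g); ck_auto
  | |- Ck _ (fun x => @?f x * @?g x) => apply (Ck_mult _ f g); ck_auto
  | |- Ck _ (fun x => - @?f x) => apply (Ck_opp _ f); ck_auto
  | |- Ck _ (fun x => @?f x ^ ?k) => apply (Ck_pow _ f k); ck_auto
  | _ => eassumption
  end.

Lemma deriv_unique f f1 f2 : is_deriv_half_line f f1 -> is_deriv_half_line f f2 ->
  forall r, 0 <= r -> f1 r = f2 r.
Proof.
intros H1 H2 r Hr.
apply (single_limit (fun x => (f x - f r) / (x - r)) (D_x half_line r) (f1 r) (f2 r) r).
- intros e He; exists (r + e / 2); split; [|unfold Rdist; rewrite Rabs_pos_eq; lra].
  unfold D_x, half_line; split; lra.
- now apply H1.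
- now apply H2.
Qed.

(** Derivatives on the half line are unique, so the derivative obtained from
    [Ck 1] is itself in every class, and the choice can be iterated. *)
Lemma smooth_of_Ck f : (forall n, Ck n f) -> smooth_half_line f.
Proof.
intros Hf.
assert (Hstep : forall g, (forall n, Ck n g) -> exists g', is_deriv_half_line g g' /\ forall n, Ck n g').
{ intros g Hg; destruct (Hg 1%nat) as [g' [G1 _]]; exists g'; split; [assumption|]; intros n.
  destruct (Hg (S n)) as [g'' [H1 H2]]; apply Ck_ext with g''; [|assumption].
  now apply (deriv_unique g). }
pose (next := fun s : {g : R -> R | forall n, Ck n g} =>
  constructive_indefinite_description _ (Hstep (proj1_sig s) (proj2_sig s))).
pose (seq := fix seq (n : nat) : {g : R -> R | forall n, Ck n g} := match n with
  | O => exist _ f Hf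
  | S n => exist _ (proj1_sig (next (seq n))) (proj2 (proj2_sig (next (seq n)))) end).
exists (fun n => proj1_sig (seq n)); split; [reflexivity|]; intros n; simpl.
exact (proj1 (proj2_sig (next (seq n)))).
Qed.

(** Bounded solutions of [r u' + a u = r g] are one degree smoother than [g]:
    [u' - g / (a + 1)] solves an equation of the same kind with exponent
    [a + 1] and a multiple of [g'] on the right. *)
Lemma singular_gain n : forall (a : nat) (u g : R -> R), Ck n g ->
  (forall r, 0 <= r -> cont_at half_line u r) -> (a = O \/ u 0 = 0) ->
  (forall r, 0 < r -> is_derive u r (g r - INR a * u r / r)) -> Ck (S n) u.
Proof.
assert (Hbase : forall (a : nat) (u g : R -> R), Ck 0 g ->
  (forall r, 0 <= r -> cont_at half_line u r) -> (a = O \/ u 0 = 0) ->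
  (forall r, 0 < r -> is_derive u r (g r - INR a * u r / r)) ->
  let u' := fun r => if Rlt_dec 0 r then g r - INR a * u r / r else g 0 / (INR a + 1) in
  is_deriv_half_line u u' /\ Ck 0 u').
{ intros a u g Hg Hu H0 Hd u'.
  assert (Ha : 0 <= INR a) by apply pos_INR.
  assert (Hu'0 : u' 0 = g 0 / (INR a + 1)) by (unfold u'; destruct (Rlt_dec 0 0); [lra|reflexivity]).
  assert (Hu'p : forall r, 0 < r -> u' r = g r - INR a * u r / r) by (intros r Hr; unfold u'; destruct (Rlt_dec 0 r); [reflexivity|lra]).
  assert (Hexp : forall e, 0 < e -> exists d, 0 < d /\ forall r, 0 < r < d ->
     Rabs (g r - g 0) <= e /\ Rabs (u r - u 0 - g 0 / (INR a + 1) * r) <= e * r).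
  { intros e He; destruct (Hg 0 (Rle_refl 0) e He) as [d [Hd0 Hy]].
    exists (d / 2); split; [lra|]; intros r Hr.
    assert (Hg' : forall t, 0 < t <= d / 2 -> Rabs (g t - g 0) <= e).
    { intros t Ht; left; apply Hy; [unfold half_line; lra|rewrite Rminus_0_r, Rabs_pos_eq; lra]. }
    split; [apply Hg'; lra|].
    assert (E := singular_expansion a 0 (fun t => u (Rmax 0 t) - u 0) g (g 0) e (d / 2)).
    cbv beta in E; rewrite (Rmax_right 0 0 (Rle_refl 0)), Rminus_diag in E.
    specialize (E eq_refl).
    specialize (E ltac:(intros t; assert (C := cont_half_extends u Hu t); cauto)).
    specialize (E ltac:(intros t Ht; apply (is_derive_ext_loc (fun t => u t - u 0));
      [ exists (mkposreal t (proj1 Ht)); intros v Hv; apply Rabs_def2 in Hv; simpl in Hv;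
        unfold minus, plus, opp in Hv; simpl in Hv; rewrite Rmax_right by lra; reflexivity
      | assert (D := Hd t (proj1 Ht)); derive_by; rewrite Rmax_right by lra;
        destruct H0 as [->|H0]; [simpl; field; lra | rewrite H0; field; lra] ])).
    specialize (E ltac:(intros t Ht; rewrite pow_O, !Rmult_1_r; now apply Hg') r ltac:(lra)).
    rewrite Rmax_right in E by lra.
    replace (INR (a + 0 + 1)) with (INR a + 1) in E by (rewrite !plus_INR; simpl; ring).
    rewrite Nat.add_0_l, pow_1 in E.
    eapply Rle_trans; [exact E|]; apply Rmult_le_compat_r; [lra|].
    apply Rle_div_l; [lra|]; nra. }
  split.
  - intros r Hr; apply slope_D_in; destruct (Rle_lt_or_eq_dec 0 r Hr) as [Hp|<-].
    + rewrite Hu'p by assumption; now apply slope_of_derive, Hd.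
    + rewrite Hu'0; intros e He; destruct (Hexp e He) as [d [Hd0 H]]; exists d; split; [assumption|].
      intros y HDy Hlt; rewrite !Rminus_0_r in *; destruct (Rle_lt_or_eq_dec 0 y HDy) as [Hp|<-].
      * rewrite (Rabs_pos_eq y) in * by lra; apply H; lra.
      * rewrite Rmult_0_r, Rminus_diag, Rminus_0_r, Rabs_R0; lra.
  - intros r Hr; destruct (Rle_lt_or_eq_dec 0 r Hr) as [Hp|<-].
    + assert (C1 := continuous_of_cont_at g r Hp (Hg r Hr)); assert (C2 := continuous_of_cont_at u r Hp (Hu r Hr)).
      assert (C3 : continuous (fun r => / r) r) by (apply (cinv (fun r => r)); [cauto|lra]).
      assert (C : continuous (fun r => g r - INR a * u r / r) r) by (unfold Rdiv; cauto).
      intros e He; destruct (proj1 (continuous_eps _ r) C e He) as [d [Hd0 H]].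
      exists (Rmin d r); split; [apply Rmin_pos; assumption|]; intros y HDy Hlt.
      assert (L1 := Rmin_l d r); assert (L2 := Rmin_r d r); apply Rabs_def2 in Hlt as Hlt'.
      rewrite !Hu'p by lra; apply H; lra.
    + intros e He; destruct (Hexp (e / (2 * (INR a + 2))) ltac:(apply Rdiv_lt_0_compat; lra)) as [d [Hd0 H]].
      exists d; split; [assumption|]; intros y HDy Hlt; rewrite Rminus_0_r in Hlt; rewrite Hu'0.
      destruct (Rle_lt_or_eq_dec 0 y HDy) as [Hyp|<-]; [|rewrite Hu'0, Rminus_diag, Rabs_R0; lra].
      rewrite Rabs_pos_eq in Hlt by lra; rewrite Hu'p by lra; destruct (H y ltac:(lra)) as [H1 H2].
      assert (Hau : INR a * u y = INR a * (u y - u 0)).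
      { destruct H0 as [->|H0]; [simpl; ring | rewrite H0; ring]. }
      rewrite Hau.
      replace (g y - INR a * (u y - u 0) / y - g 0 / (INR a + 1)) with
        ((g y - g 0) - INR a * ((u y - u 0 - g 0 / (INR a + 1) * y) * / y)) by (field; lra).
      assert (H3 : Rabs ((u y - u 0 - g 0 / (INR a + 1) * y) * / y) <= e / (2 * (INR a + 2))).
      { rewrite Rabs_mult, Rabs_inv, (Rabs_pos_eq y) by lra.
        apply (Rmult_le_reg_r y); [assumption|].
        rewrite Rmult_assoc, Rinv_l, Rmult_1_r by lra; exact H2. }
      eapply Rle_lt_trans; [apply Rabs_triang|]; rewrite Rabs_Ropp, Rabs_mult, (Rabs_pos_eq (INR a)) by assumption.
      apply Rle_lt_trans with ((INR a + 2) * (e / (2 * (INR a + 2)))).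
      * set (k := e / (2 * (INR a + 2))) in *; assert (0 < k) by (apply Rdiv_lt_0_compat; lra).
        assert (INR a * Rabs ((u y - u 0 - g 0 / (INR a + 1) * y) * / y) <= INR a * k) by (apply Rmult_le_compat_l; assumption).
        lra.
      * replace ((INR a + 2) * (e / (2 * (INR a + 2)))) with (e / 2) by (field; lra); lra. }
induction n as [|n IH]; intros a u g Hg Hu H0 Hd.
- destruct (Hbase a u g Hg Hu H0 Hd) as [H1 H2]; eexists; split; [exact H1|exact H2].
- destruct (Hbase a u g (Ck_0 _ _ Hg) Hu H0 Hd) as [H1 H2].
  set (u' := fun r => if Rlt_dec 0 r then g r - INR a * u r / r else g 0 / (INR a + 1)) in *.
  exists u'; split; [assumption|].
  assert (Ha : 0 <= INR a) by apply pos_INR.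
  assert (Hw : Ck (S n) (fun r => u' r - / (INR a + 1) * g r)).
  { assert (Hg0 := Ck_0 _ _ Hg).
    destruct Hg as [g' [G1 G2]].
    apply (IH (S a) _ (fun r => INR a / (INR a + 1) * g' r)).
    - apply (Ck_mult n (fun _ => INR a / (INR a + 1))); [apply Ck_const|exact G2].
    - assert (C : Ck 0 (fun r => u' r - / (INR a + 1) * g r)) by ck_auto; exact C.
    - right; unfold u'; destruct (Rlt_dec 0 0); [lra|]; field; lra.
    - intros r Hr.
      apply (is_derive_ext_loc (fun r => (g r - INR a * u r / r) - / (INR a + 1) * g r)).
      + exists (mkposreal r Hr); intros v Hv; apply Rabs_def2 in Hv; simpl in Hv.
        unfold minus, plus, opp in Hv; simpl in Hv.
        unfold u'; destruct (Rlt_dec 0 v); [reflexivity|lra].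
      + assert (D1 := Hd r Hr).
        assert (D2 : is_derive g r (g' r)).
        { apply derive_of_slope; [assumption|]; apply slope_D_in, G1; lra. }
        derive_by; [lra|]; unfold u'; destruct (Rlt_dec 0 r); [|lra].
        rewrite S_INR; field; lra. }
  apply Ck_ext with (fun r => (u' r - / (INR a + 1) * g r) + / (INR a + 1) * g r); [intros; ring|].
  ck_auto.
Qed.

(** * Assembling the solution as a function of the radius *)

(** At the matching radius the two pieces supply the slopes on either side. *)
Lemma glue_slope (f1 f2 : R -> R) (rs r a : R) : 0 <= r -> f1 rs = f2 rs ->
  (r <= rs -> is_derive f1 r a) -> (rs <= r -> slope (fun x => rs <= x) f2 r a) ->
  slope half_line (fun x => if Rle_dec x rs then f1 x else f2 x) r a.
Proof.
intros Hr Heq H1 H2 e He.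
assert (V2 : forall x, rs <= x -> (if Rle_dec x rs then f1 x else f2 x) = f2 x).
{ intros x Hx; destruct (Rle_dec x rs); [|reflexivity]; now replace x with rs by lra. }
assert (V1 : forall x, x <= rs -> (if Rle_dec x rs then f1 x else f2 x) = f1 x).
{ intros x Hx; destruct (Rle_dec x rs); [reflexivity|lra]. }
destruct (Rlt_dec r rs) as [Hlt|Hge].
- destruct (slope_of_derive (fun _ => True) f1 r a (H1 ltac:(lra)) e He) as [d [Hd H]].
  exists (Rmin d (rs - r)); assert (L1 := Rmin_l d (rs - r)); assert (L2 := Rmin_r d (rs - r)).
  split; [apply Rmin_pos; lra|]; intros y _ Hy; apply Rabs_def2 in Hy as Hy'.
  rewrite !V1 by lra; apply H; [exact I|lra].
- destruct (H2 ltac:(lra) e He) as [d2 [Hd2 H2']].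
  destruct (Req_dec r rs) as [Hrs|Hne].
  + destruct (slope_of_derive (fun _ => True) f1 r a (H1 ltac:(lra)) e He) as [d1 [Hd1 H1']].
    exists (Rmin d1 d2); assert (L1 := Rmin_l d1 d2); assert (L2 := Rmin_r d1 d2).
    split; [apply Rmin_pos; lra|]; intros y _ Hy.
    destruct (Rle_dec rs y).
    * rewrite !V2 by lra; apply H2'; lra.
    * rewrite !V1 by lra; apply H1'; [exact I|lra].
  + exists (Rmin d2 (r - rs)); assert (L1 := Rmin_l d2 (r - rs)); assert (L2 := Rmin_r d2 (r - rs)).
    split; [apply Rmin_pos; lra|]; intros y _ Hy; apply Rabs_def2 in Hy as Hy'.
    rewrite !V2 by lra; apply H2'; lra.
Qed.

Lemma is_lim_of_tends f c : tends f c -> is_lim f p_infty c.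
Proof.
intros H; apply is_lim_spec; intros e; destruct (H e (cond_pos e)) as [T [_ HT]].
exists T; intros x Hx; apply HT; lra.
Qed.

Section Assembly.

Variables (lam rs : R) (q p b l W P N K : R -> R).
Hypothesis Hrs : 0 < rs <= / 10.
Hypothesis sol : local_solution lam rs q p b.
Hypothesis orb : orbit (/ rs) l W P N K.
Hypothesis Hgood : forall t, 0 <= t -> good W P N t.
Hypothesis HW0 : W 0 = w_of rs (q rs) (p rs).
Hypothesis HP0 : P 0 = rs * sqrt (A_of rs (q rs) (b rs)) * dw_of rs (q rs) (p rs).
Hypothesis HN0 : N 0 = sqrt (A_of rs (q rs) (b rs)).

Lemma asm_facts t : 0 <= t -> 0 < N t /\ 0 < l t /\ equations_at l W P N K t /\ constraint l W P N K t = 0.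
Proof.
intros Ht; destruct (global_facts _ _ _ _ _ _ orb Hgood t Ht) as [[[Hl _] _] [E C]].
destruct (Hgood t Ht); repeat split; try assumption; apply E.
Qed.

Lemma l_strictly_decreasing s t : 0 <= s < t -> l t < l s.
Proof.
intros Hst; apply Ropp_lt_cancel.
apply (strict_monotone_by_derive (fun t => - l t) (fun t => N t * l t)); [lra| | |].
- intros u Hu; destruct (asm_facts u ltac:(lra)) as [_ [_ [[D _] _]]]; derive_by; ring.
- intros u Hu; assert (C := o_l_cont _ _ _ _ _ _ orb u); cauto.
- intros u Hu; destruct (asm_facts u ltac:(lra)) as [H1 [H2 _]]; now apply Rmult_lt_0_compat.
Qed.

Lemma l_injective s t : 0 <= s -> 0 <= t -> l s = l t -> s = t.
Proof.
intros Hs Ht H; destruct (Rtotal_order s t) as [Hlt|[|Hlt]]; [|assumption|].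
- assert (M := l_strictly_decreasing s t ltac:(lra)); lra.
- assert (M := l_strictly_decreasing t s ltac:(lra)); lra.
Qed.

(** The time as a function of the radius: the inverse of [1 / l]. *)
Lemma tau_exists : exists tau : R -> R, forall r, rs <= r -> 0 <= tau r /\ l (tau r) = / r.
Proof.
apply (functional_choice (fun r t => rs <= r -> 0 <= t /\ l t = / r)).
intros r; destruct (Rle_dec rs r) as [Hr|Hr]; [|exists 0; intros; lra].
destruct (Req_dec r rs) as [->|Hne].
{ exists 0; intros _; split; [lra|]; apply (o_l0 _ _ _ _ _ _ orb). }
destruct (l_tends_0 _ _ _ _ _ _ orb Hgood (/ r)) as [T [HT H]]; [apply Rinv_0_lt_compat; lra|].
specialize (H T (Rle_refl T)); rewrite Rminus_0_r in H; apply Rabs_def2 in H.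
destruct (first_hit l (/ r) T HT) as [t [Ht [Hlt _]]].
- intros; apply (o_l_cont _ _ _ _ _ _ orb).
- rewrite (o_l0 _ _ _ _ _ _ orb); apply Rinv_lt_contravar; nra.
- lra.
- exists t; intros _; split; [lra|assumption].
Qed.

Section Radius.

Variable tau : R -> R.
Hypothesis Htau : forall r, rs <= r -> 0 <= tau r /\ l (tau r) = / r.

Lemma tau_at_start : tau rs = 0.
Proof.
destruct (Htau rs (Rle_refl rs)) as [H1 H2]; apply l_injective; [assumption|lra|].
now rewrite H2, (o_l0 _ _ _ _ _ _ orb).
Qed.

Lemma tau_ge r T : 0 <= T -> rs <= r -> / l T <= r -> T <= tau r.
Proof.
intros HT Hr H; destruct (Htau r Hr) as [H1 H2].
destruct (Rle_dec T (tau r)) as [|Hn]; [assumption|exfalso].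
assert (M := l_strictly_decreasing (tau r) T ltac:(lra)).
destruct (asm_facts T HT) as [_ [HlT _]].
rewrite H2 in M; assert (l T * r < 1).
{ apply (Rmult_lt_reg_r (/ r)); [apply Rinv_0_lt_compat; lra|].
  replace (l T * r * / r) with (l T) by (field; lra); lra. }
assert (1 <= l T * r); [|lra].
apply (Rmult_le_compat_l (l T)) in H; [|lra]; replace (l T * / l T) with 1 in H by (field; lra); lra.
Qed.

Lemma tau_le r T : 0 <= T -> rs <= r -> r <= / l T -> tau r <= T.
Proof.
intros HT Hr H; destruct (Htau r Hr) as [H1 H2].
destruct (Rle_dec (tau r) T) as [|Hn]; [assumption|exfalso].
assert (M := l_strictly_decreasing T (tau r) ltac:(lra)).
destruct (asm_facts T HT) as [_ [HlT _]].
rewrite H2 in M.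
apply Rinv_le_contravar in H; [|lra]; rewrite Rinv_inv in H; lra.
Qed.

Lemma tau_cont r : rs <= r -> cont_at (fun x => rs <= x) tau r.
Proof.
intros Hr e He; destruct (Htau r Hr) as [H1 H2].
set (t0 := tau r) in *.
assert (Hr0 : r = / l t0) by (rewrite H2, Rinv_inv; reflexivity).
assert (Hmono : forall s t, 0 <= s < t -> / l s < / l t).
{ intros s t Hst; assert (M := l_strictly_decreasing s t Hst); destruct (asm_facts t ltac:(lra)) as [_ [Hl _]].
  apply Rinv_lt_contravar; [|assumption]; apply Rmult_lt_0_compat; lra. }
assert (Hup := Hmono t0 (t0 + e / 2) ltac:(lra)).
assert (Hlow : exists d, 0 < d /\ forall y, rs <= y -> r - d < y -> t0 - e / 2 <= tau y).
{ destruct (Rle_dec (e / 2) t0) as [Hle|Hgt].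
  - assert (M := Hmono (t0 - e / 2) t0 ltac:(lra)); exists (r - / l (t0 - e / 2)); split; [lra|].
    intros y Hy1 Hy2; apply tau_ge; [lra|assumption|lra].
  - exists 1; split; [lra|]; intros y Hy _; destruct (Htau y Hy); lra. }
destruct Hlow as [d [Hd Hl]].
exists (Rmin d (/ l (t0 + e / 2) - r)).
assert (L1 := Rmin_l d (/ l (t0 + e / 2) - r)); assert (L2 := Rmin_r d (/ l (t0 + e / 2) - r)).
split; [apply Rmin_pos; lra|]; intros y Hy Hlt; apply Rabs_def2 in Hlt.
specialize (Hl y Hy ltac:(lra)).
assert (Hu := tau_le y (t0 + e / 2) ltac:(lra) Hy ltac:(lra)).
apply Rabs_def1; lra.
Qed.

(** The inverse function theorem, one-sided at the starting radius. *)
Lemma tau_slope r : rs <= r -> slope (fun x => rs <= x) tau r (/ (N (tau r) * r)).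
Proof.
intros Hr e He; destruct (Htau r Hr) as [H1 H2].
set (t0 := tau r) in *.
destruct (asm_facts t0 H1) as [HN [Hl [[D1 _] _]]].
assert (Hr0 : r = / l t0) by (rewrite H2, Rinv_inv; reflexivity).
pose (k := N t0 * r); assert (Hk : 0 < k) by (apply Rmult_lt_0_compat; lra).
assert (DR : is_derive (fun t => / l t) t0 k).
{ derive_by; [lra|]; unfold k; rewrite Hr0; field; lra. }
pose (e1 := Rmin (k / 2) (e * k ^ 2 / 2)).
assert (Hk2 : 0 < k ^ 2) by (apply pow_lt; lra).
assert (He1 : 0 < e1) by (apply Rmin_pos; [lra|apply Rdiv_lt_0_compat; [nra|lra]]).
assert (M1 : e1 <= k / 2) by apply Rmin_l; assert (M2 : e1 <= e * k ^ 2 / 2) by apply Rmin_r.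
destruct (slope_of_derive (fun _ => True) _ t0 k DR e1 He1) as [d1 [Hd1 HR]].
destruct (tau_cont r Hr d1 Hd1) as [d [Hd Hc]].
exists d; split; [assumption|]; intros y Hy Hlt.
specialize (HR (tau y) I (Hc y Hy Hlt)).
destruct (Htau y Hy) as [_ Hy2]; cbv beta in HR; rewrite Hy2, Rinv_inv, <- Hr0 in HR.
fold t0; set (dt := tau y - t0) in *; set (dr := y - r) in *.
assert (Hdt : Rabs dt <= 2 / k * Rabs dr).
{ assert (T := Rabs_triang dr (- (dr - k * dt))); rewrite Rabs_Ropp in T.
  replace (dr + - (dr - k * dt)) with (k * dt) in T by ring.
  rewrite Rabs_mult, (Rabs_pos_eq k) in T by lra.
  assert (P1 := Rabs_pos dt).
  assert (e1 * Rabs dt <= k / 2 * Rabs dt) by (apply Rmult_le_compat_r; assumption).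
  apply (Rmult_le_reg_l (k / 2)); [lra|].
  replace (k / 2 * (2 / k * Rabs dr)) with (Rabs dr) by (field; lra); lra. }
replace (dt - / (N t0 * r) * dr) with (- (/ k * (dr - k * dt))) by (unfold k; field; split; lra).
rewrite Rabs_Ropp, Rabs_mult, (Rabs_pos_eq (/ k)) by (left; now apply Rinv_0_lt_compat).
apply (Rmult_le_reg_l k); [assumption|].
replace (k * (/ k * Rabs (dr - k * dt))) with (Rabs (dr - k * dt)) by (field; lra).
eapply Rle_trans; [exact HR|].
apply Rle_trans with (e * k ^ 2 / 2 * (2 / k * Rabs dr)).
- apply Rmult_le_compat; [lra|apply Rabs_pos|assumption|assumption].
- right; field; lra.
Qed.

Lemma slope_along (F : R -> R) r dF : rs <= r -> is_derive F (tau r) dF ->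
  slope (fun x => rs <= x) (fun x => F (tau x)) r (dF * / (N (tau r) * r)).
Proof. intros Hr HF; apply slope_comp; [now apply tau_slope|assumption]. Qed.

Definition w_sol (r : R) : R := if Rle_dec r rs then w_of r (q r) (p r) else W (tau r).
Definition dw_sol (r : R) : R := if Rle_dec r rs then dw_of r (q r) (p r)
  else P (tau r) * l (tau r) / N (tau r).
Definition A_sol (r : R) : R := if Rle_dec r rs then A_of r (q r) (b r) else N (tau r) ^ 2.

Lemma start_A_pos : 0 < A_of rs (q rs) (b rs).
Proof. assert (H := local_A_bound lam rs q p b ltac:(lra) sol rs ltac:(lra)); lra. Qed.

Lemma outer_values r : rs <= r ->
  w_sol r = W (tau r) /\ dw_sol r = P (tau r) * l (tau r) / N (tau r) /\ A_sol r = N (tau r) ^ 2.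
Proof.
intros Hr; unfold w_sol, dw_sol, A_sol; destruct (Rle_dec r rs); [|repeat split; reflexivity].
replace r with rs by lra; rewrite tau_at_start, HW0, HP0, HN0, (o_l0 _ _ _ _ _ _ orb).
assert (HA := start_A_pos); assert (Hs : 0 < sqrt (A_of rs (q rs) (b rs))) by now apply sqrt_lt_R0.
repeat split; [field; lra | rewrite pow2_sqrt; lra].
Qed.

Lemma inner_values r : r <= rs ->
  w_sol r = w_of r (q r) (p r) /\ dw_sol r = dw_of r (q r) (p r) /\ A_sol r = A_of r (q r) (b r).
Proof.
intros Hr; unfold w_sol, dw_sol, A_sol; destruct (Rle_dec r rs); [repeat split; reflexivity|lra].
Qed.

Lemma A_sol_pos r : 0 <= r -> 0 < A_sol r.
Proof.
intros Hr; destruct (Rle_dec r rs) as [Hle|Hgt].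
- destruct (inner_values r Hle) as [_ [_ ->]].
  assert (H := local_A_bound lam rs q p b ltac:(lra) sol r ltac:(lra)); lra.
- destruct (outer_values r ltac:(lra)) as [_ [_ ->]]; destruct (Htau r ltac:(lra)) as [Ht _].
  destruct (asm_facts _ Ht) as [HN _]; now apply pow_lt.
Qed.

Lemma w_sol_derive r : 0 < r -> is_derive w_sol r (dw_sol r).
Proof.
intros Hr; apply derive_of_slope; [assumption|]; apply glue_slope; [lra| | |].
- destruct (outer_values rs (Rle_refl rs)) as [E _]; destruct (inner_values rs (Rle_refl rs)) as [E' _].
  now rewrite <- E, <- E'.
- intros Hle; destruct (inner_values r Hle) as [_ [-> _]].
  apply (local_w_derive lam rs q p b sol); lra.
- intros Hge; destruct (outer_values r Hge) as [_ [-> _]]; destruct (Htau r Hge) as [Ht Hl].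
  destruct (asm_facts _ Ht) as [HN [_ [[_ [D2 _]] _]]].
  replace (P (tau r) * l (tau r) / N (tau r)) with (P (tau r) * / (N (tau r) * r)) by (rewrite Hl; field; lra).
  now apply slope_along.
Qed.

Lemma K_by_constraint t : 0 <= t ->
  K t = (1 + N t ^ 2 + 2 * (l t ^ 2 * P t ^ 2) - l t ^ 2 * (1 - W t ^ 2) ^ 2) / (2 * N t).
Proof.
intros Ht; destruct (asm_facts t Ht) as [HN [_ [_ HC]]]; unfold constraint in HC.
apply (Rmult_eq_reg_r (2 * N t)); [|lra].
replace ((1 + N t ^ 2 + 2 * (l t ^ 2 * P t ^ 2) - l t ^ 2 * (1 - W t ^ 2) ^ 2) / (2 * N t) * (2 * N t))
  with (1 + N t ^ 2 + 2 * (l t ^ 2 * P t ^ 2) - l t ^ 2 * (1 - W t ^ 2) ^ 2) by (field; lra); lra.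
Qed.

Lemma dw_sol_derive r : 0 < r -> is_derive dw_sol r (ddw_rhs w_sol dw_sol A_sol r).
Proof.
intros Hr; apply derive_of_slope; [assumption|]; apply glue_slope; [lra| | |].
- destruct (outer_values rs (Rle_refl rs)) as [_ [E _]]; destruct (inner_values rs (Rle_refl rs)) as [_ [E' _]].
  now rewrite <- E, <- E'.
- intros Hle; eapply is_derive_eq; [apply (local_dw_derive lam rs q p b ltac:(lra) sol); lra|].
  destruct (inner_values r Hle) as [E1 [E2 E3]]; unfold ddw_rhs, Phi; now rewrite E1, E2, E3.
- intros Hge; destruct (outer_values r Hge) as [E1 [E2 E3]]; destruct (Htau r Hge) as [Ht Hl].
  destruct (asm_facts _ Ht) as [HN [Hlp [[D1 [D2 [D3 [D4 D5]]]] _]]].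
  set (t0 := tau r) in *.
  assert (D : is_derive (fun t => P t * l t / N t) t0
    (((((2 * N t0 - K t0) * P t0 - W t0 * (1 - W t0 ^ 2)) * l t0 + P t0 * - (N t0 * l t0)) * N t0
      - P t0 * l t0 * ((K t0 - N t0) * N t0 - 2 * (l t0 ^ 2 * P t0 ^ 2))) / N t0 ^ 2)).
  { derive_by; [lra|reflexivity]. }
  apply (slope_along _ r) in D; [|assumption].
  assert (Hr0 : r = / l t0) by (rewrite Hl, Rinv_inv; reflexivity).
  match type of D with slope _ _ _ ?a => replace (ddw_rhs w_sol dw_sol A_sol r) with a; [exact D|] end.
  unfold ddw_rhs, Phi; rewrite E1, E2, E3; fold t0.
  rewrite (K_by_constraint t0 Ht), Hr0; field; lra.
Qed.

Lemma A_sol_derive r : 0 < r -> is_derive A_sol r (dA_rhs w_sol dw_sol A_sol r).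
Proof.
intros Hr; apply derive_of_slope; [assumption|]; apply glue_slope; [lra| | |].
- destruct (outer_values rs (Rle_refl rs)) as [_ [_ E]]; destruct (inner_values rs (Rle_refl rs)) as [_ [_ E']].
  now rewrite <- E, <- E'.
- intros Hle; eapply is_derive_eq; [apply (local_A_derive lam rs q p b ltac:(lra) sol); lra|].
  destruct (inner_values r Hle) as [E1 [E2 E3]]; unfold dA_rhs; now rewrite E1, E2, E3.
- intros Hge; destruct (outer_values r Hge) as [E1 [E2 E3]]; destruct (Htau r Hge) as [Ht Hl].
  destruct (asm_facts _ Ht) as [HN [Hlp [[D1 [D2 [D3 [D4 D5]]]] _]]].
  set (t0 := tau r) in *.
  assert (D : is_derive (fun t => N t ^ 2) t0 (2 * N t0 * ((K t0 - N t0) * N t0 - 2 * (l t0 ^ 2 * P t0 ^ 2)))).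
  { derive_by; simpl; ring. }
  apply (slope_along _ r) in D; [|assumption].
  assert (Hr0 : r = / l t0) by (rewrite Hl, Rinv_inv; reflexivity).
  match type of D with slope _ _ _ ?a => replace (dA_rhs w_sol dw_sol A_sol r) with a; [exact D|] end.
  unfold dA_rhs; rewrite E1, E2, E3; fold t0.
  rewrite (K_by_constraint t0 Ht), Hr0; field; lra.
Qed.

(** The regular coordinates of the origin, now on the whole half line. *)
Definition q_sol (r : R) : R := if Rlt_dec 0 r then dw_sol r / r + (w_sol r - 1) / r ^ 2 else q 0.
Definition p_sol (r : R) : R := if Rlt_dec 0 r then (dw_sol r / r - 2 * ((w_sol r - 1) / r ^ 2)) / r else 0.
Definition b_sol (r : R) : R :=
  if Rlt_dec 0 r then (A_sol r - 1) / r ^ 2 + 4 / 9 * (dw_sol r / r + (w_sol r - 1) / r ^ 2) ^ 2 else 0.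

Lemma sol_coordinates r : 0 <= r ->
  w_sol r = w_of r (q_sol r) (p_sol r) /\ dw_sol r = dw_of r (q_sol r) (p_sol r) /\
  A_sol r = A_of r (q_sol r) (b_sol r).
Proof.
intros Hr; destruct (Rle_lt_or_eq_dec 0 r Hr) as [Hp|<-].
- unfold q_sol, p_sol, b_sol; destruct (Rlt_dec 0 r); [|lra].
  unfold w_of, dw_of, A_of, v_of, z_of, a_of; repeat split; field; lra.
- destruct (inner_values 0 ltac:(lra)) as [-> [-> ->]]; unfold w_of, dw_of, A_of; repeat split; ring.
Qed.

Lemma inner_coordinates r : 0 <= r <= rs -> q_sol r = q r /\ p_sol r = p r /\ b_sol r = b r.
Proof.
intros Hr; unfold q_sol, p_sol, b_sol; destruct (Rlt_dec 0 r) as [Hp|Hn].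
- destruct (inner_values r ltac:(lra)) as [-> [-> ->]].
  unfold w_of, dw_of, A_of, v_of, z_of, a_of; repeat split; field; lra.
- replace r with 0 by lra; rewrite (ls_p0 _ _ _ _ _ sol), (ls_b0 _ _ _ _ _ sol); auto.
Qed.

Lemma derive_if_pos (f : R -> R) c r a : 0 < r -> is_derive f r a ->
  is_derive (fun r => if Rlt_dec 0 r then f r else c) r a.
Proof.
intros Hr; apply is_derive_ext_loc; exists (mkposreal r Hr); intros v Hv.
apply Rabs_def2 in Hv; simpl in Hv; unfold minus, plus, opp in Hv; simpl in Hv.
destruct (Rlt_dec 0 v); [reflexivity|lra].
Qed.

Lemma sol_equations r : 0 < r ->
  is_derive q_sol r (r * k_of r (q_sol r) (p_sol r) (b_sol r)) /\
  is_derive p_sol r (k_of r (q_sol r) (p_sol r) (b_sol r) - 4 * p_sol r / r) /\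
  is_derive b_sol r (g_of r (q_sol r) (p_sol r) (b_sol r) - 3 * b_sol r / r).
Proof.
intros Hr; destruct (sol_coordinates r ltac:(lra)) as [E1 [E2 E3]].
assert (HA := A_sol_pos r ltac:(lra)); rewrite E3 in HA; unfold A_of in HA.
assert (D1 := w_sol_derive r Hr); assert (D2 := dw_sol_derive r Hr); assert (D3 := A_sol_derive r Hr).
assert (Hr2 : r ^ 2 <> 0) by (apply pow_nonzero; lra).
unfold ddw_rhs, Phi in D2; unfold dA_rhs in D3; rewrite E1, E2, E3 in D2, D3; rewrite E2 in D1.
unfold w_of, dw_of, A_of in *.
refine (conj _ (conj _ _)).
- apply (derive_if_pos (fun r => dw_sol r / r + (w_sol r - 1) / r ^ 2) (q 0)); [assumption|].
  derive_by; [lra|assumption|].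
  rewrite E1, E2; set (Q := q_sol r) in *; set (PP := p_sol r) in *; set (BB := b_sol r) in *.
  unfold k_of, k_num; unfold v_of, z_of in *; set (a := a_of Q BB) in *; simpl in *; field; lra.
- apply (derive_if_pos (fun r => (dw_sol r / r - 2 * ((w_sol r - 1) / r ^ 2)) / r) 0); [assumption|].
  derive_by; [lra|assumption|lra|].
  rewrite E1, E2; set (Q := q_sol r) in *; set (PP := p_sol r) in *; set (BB := b_sol r) in *.
  unfold k_of, k_num; unfold v_of, z_of in *; set (a := a_of Q BB) in *; simpl in *; field; lra.
- apply (derive_if_pos (fun r => (A_sol r - 1) / r ^ 2 + 4 / 9 * (dw_sol r / r + (w_sol r - 1) / r ^ 2) ^ 2) 0);
    [assumption|]; derive_by; [assumption|lra|assumption|].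
  rewrite E1, E2, E3; set (Q := q_sol r) in *; set (PP := p_sol r) in *; set (BB := b_sol r) in *.
  unfold g_of, b_rhs, k_of, k_num; unfold v_of, z_of, a_of in *; simpl in *; field; lra.
Qed.

Lemma coordinates_cont r : 0 <= r ->
  cont_at half_line q_sol r /\ cont_at half_line p_sol r /\ cont_at half_line b_sol r.
Proof.
intros Hr; destruct (Rle_lt_or_eq_dec 0 r Hr) as [Hp|<-].
- destruct (sol_equations r Hp) as [D1 [D2 D3]].
  split; [|split]; apply cont_at_of_continuous; eapply is_derive_cont; eassumption.
- assert (Hloc : forall f g : R -> R, (forall r, 0 <= r <= rs -> f r = g r) -> continuous g 0 -> cont_at half_line f 0).
  { intros f g Hfg Hc e He; destruct (cont_at_of_continuous half_line g 0 Hc e He) as [d [Hd H]].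
    exists (Rmin d rs); assert (L1 := Rmin_l d rs); assert (L2 := Rmin_r d rs).
    split; [apply Rmin_pos; lra|]; intros y HDy Hlt; rewrite Rminus_0_r in Hlt.
    unfold half_line in HDy; rewrite Rabs_pos_eq in Hlt by assumption.
    rewrite !Hfg by lra; apply H; [exact HDy|rewrite Rminus_0_r, Rabs_pos_eq; lra]. }
  split; [|split]; eapply Hloc; try (intros; apply inner_coordinates; assumption).
  + apply (ls_q_cont _ _ _ _ _ sol).
  + apply (ls_p_cont _ _ _ _ _ sol).
  + apply (ls_b_cont _ _ _ _ _ sol).
Qed.

Lemma late T : 0 <= T -> exists R1, 1 <= R1 /\ forall r, R1 <= r -> rs <= r /\ T <= tau r.
Proof.
intros HT; exists (Rmax 1 (/ l T)); assert (L1 := Rmax_l 1 (/ l T)); assert (L2 := Rmax_r 1 (/ l T)).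
split; [assumption|]; intros r Hr; split; [lra|]; apply tau_ge; lra.
Qed.

Lemma lim_at_radius (f F : R -> R) c : (forall r, rs <= r -> f r = F (tau r)) -> tends F c ->
  is_lim f p_infty c.
Proof.
intros Hf H; apply is_lim_of_tends; intros e He; destruct (H e He) as [T [HT HF]].
destruct (late T HT) as [R1 [HR1 HR]]; exists R1; split; [lra|]; intros r Hr.
destruct (HR r Hr) as [H1 H2]; rewrite Hf by assumption; now apply HF.
Qed.

Lemma dw_decay : exists R1, 1 <= R1 /\ forall r, R1 <= r -> Rabs (dw_sol r) <= 20 / r.
Proof.
destruct (N_eventually _ _ _ _ _ _ orb Hgood) as [T [HT HN]]; destruct (late T HT) as [R1 [HR1 HR]].
exists R1; split; [assumption|]; intros r Hr; destruct (HR r Hr) as [H1 H2].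
destruct (outer_values r H1) as [_ [-> _]]; destruct (Htau r H1) as [H3 ->].
destruct (global_facts _ _ _ _ _ _ orb Hgood _ H3) as [[_ [_ [HP _]]] _]; specialize (HN _ H2).
assert (Hr0 : 0 < / r) by (apply Rinv_0_lt_compat; lra).
replace (P (tau r) * / r / N (tau r)) with (- (- P (tau r) / N (tau r) * / r)) by (field; lra).
rewrite Rabs_Ropp, Rabs_pos_eq.
- apply Rmult_le_compat_r; [lra|]; apply Rle_div_l; lra.
- apply Rmult_le_pos; [|lra]; apply Rdiv_le_0_compat; lra.
Qed.

Lemma regular_coordinates_exist : exists q p b : R -> R,
  (forall r, 0 <= r -> cont_at half_line q r) /\ (forall r, 0 <= r -> cont_at half_line p r) /\
  (forall r, 0 <= r -> cont_at half_line b r) /\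
  q 0 = - 3 * lam / 2 /\ p 0 = 0 /\ b 0 = 0 /\
  (forall r, 0 <= r -> 0 < A_of r (q r) (b r)) /\
  (forall r, 0 < r -> is_derive q r (r * k_of r (q r) (p r) (b r))) /\
  (forall r, 0 < r -> is_derive p r (k_of r (q r) (p r) (b r) - 4 * p r / r)) /\
  (forall r, 0 < r -> is_derive b r (g_of r (q r) (p r) (b r) - 3 * b r / r)) /\
  (exists R1, 1 <= R1 /\ forall r, R1 <= r -> Rabs (dw_of r (q r) (p r)) <= 20 / r) /\
  is_lim (fun r => w_of r (q r) (p r)) p_infty (-1) /\
  is_lim (fun r => A_of r (q r) (b r)) p_infty 1 /\
  (exists m : R, is_lim (fun r => r * (1 - A_of r (q r) (b r))) p_infty m).
Proof.
exists q_sol, p_sol, b_sol.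
destruct (inner_coordinates 0 ltac:(lra)) as [E1 [E2 E3]].
assert (Hout : forall r, rs <= r -> W (tau r) = w_of r (q_sol r) (p_sol r) /\
  N (tau r) ^ 2 = A_of r (q_sol r) (b_sol r)).
{ intros r Hr; destruct (sol_coordinates r ltac:(lra)) as [<- [_ <-]]; destruct (outer_values r Hr) as [-> [_ ->]]; auto. }
refine (conj _ (conj _ (conj _ (conj _ (conj _ (conj _ (conj _ (conj _ (conj _ (conj _ (conj _ (conj _ (conj _ _))))))))))))).
- intros; now apply coordinates_cont.
- intros; now apply coordinates_cont.
- intros; now apply coordinates_cont.
- rewrite E1; apply (ls_q0 _ _ _ _ _ sol).
- rewrite E2; apply (ls_p0 _ _ _ _ _ sol).
- rewrite E3; apply (ls_b0 _ _ _ _ _ sol).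
- intros r Hr; destruct (sol_coordinates r Hr) as [_ [_ <-]]; now apply A_sol_pos.
- intros; now apply sol_equations.
- intros; now apply sol_equations.
- intros; now apply sol_equations.
- destruct dw_decay as [R1 [HR1 H]]; exists R1; split; [assumption|]; intros r Hr.
  destruct (sol_coordinates r ltac:(lra)) as [_ [<- _]]; now apply H.
- apply (lim_at_radius _ W); [intros r Hr; symmetry; now apply Hout|].
  apply (W_tends_m1 _ _ _ _ _ _ orb Hgood).
- apply (lim_at_radius _ (fun t => N t ^ 2)); [intros r Hr; symmetry; now apply Hout|].
  assert (HN := N_tends_1 _ _ _ _ _ _ orb Hgood).
  intros e He; destruct (HN (Rmin 1 (e / 3)) ltac:(apply Rmin_pos; lra)) as [T [HT H]].
  assert (L1 := Rmin_l 1 (e / 3)); assert (L2 := Rmin_r 1 (e / 3)).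
  exists T; split; [assumption|]; intros t Ht; specialize (H t Ht); apply Rabs_def2 in H.
  apply Rabs_def1; nra.
- destruct (mass_tends _ _ _ _ _ _ orb Hgood) as [m Hm]; exists m.
  apply (lim_at_radius _ (fun t => (1 - N t ^ 2) / l t)); [|assumption].
  intros r Hr; destruct (Hout r Hr) as [_ <-]; destruct (Htau r Hr) as [_ ->]; field; lra.
Qed.

End Radius.

End Assembly.

(** * Smoothness, the lapse function and the equations *)

Section Regular.

Variables (lam : R) (q p b : R -> R).
Hypothesis q_cont : forall r, 0 <= r -> cont_at half_line q r.
Hypothesis p_cont : forall r, 0 <= r -> cont_at half_line p r.
Hypothesis b_cont : forall r, 0 <= r -> cont_at half_line b r.
Hypothesis q0 : q 0 = - 3 * lam / 2.
Hypothesis p0 : p 0 = 0.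
Hypothesis b0 : b 0 = 0.
Hypothesis A_pos : forall r, 0 <= r -> 0 < A_of r (q r) (b r).
Hypothesis q_derive : forall r, 0 < r -> is_derive q r (r * k_of r (q r) (p r) (b r)).
Hypothesis p_derive : forall r, 0 < r -> is_derive p r (k_of r (q r) (p r) (b r) - 4 * p r / r).
Hypothesis b_derive : forall r, 0 < r -> is_derive b r (g_of r (q r) (p r) (b r) - 3 * b r / r).

Let v (r : R) : R := v_of r (q r) (p r).
Let z (r : R) : R := z_of r (q r) (p r).
Let a (r : R) : R := a_of (q r) (b r).
Let s (r : R) : R := v r * (2 + r ^ 2 * v r).
Let w (r : R) : R := w_of r (q r) (p r).
Let dw (r : R) : R := dw_of r (q r) (p r).
Let A (r : R) : R := A_of r (q r) (b r).
Let ddw (r : R) : R := (r ^ 2 * (a r + s r ^ 2) * z r + (1 + r ^ 2 * v r) * s r) * / A r.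
Let dA (r : R) : R := r * (- s r ^ 2 - 2 * z r ^ 2 * A r - a r).

(** Each round of [singular_gain] gains one derivative on all three coordinates. *)
Lemma coordinates_Ck n : Ck n q /\ Ck n p /\ Ck n b.
Proof.
induction n as [|n [Hq [Hp Hb]]]; [now repeat split|].
assert (Hv : Ck n v) by (unfold v, v_of, Rdiv; ck_auto).
assert (Hz : Ck n z) by (unfold z, z_of, Rdiv; ck_auto).
assert (Ha : Ck n a) by (unfold a, a_of, Rdiv; ck_auto).
assert (Hi : Ck n (fun r => / A r)).
{ apply Ck_inv; [intros r Hr; assert (H := A_pos r Hr); fold (A r) in H; lra|].
  unfold A, A_of; fold a; ck_auto. }
assert (Hk : Ck n (fun r => k_of r (q r) (p r) (b r))).
{ apply Ck_ext with (fun r => k_num r (v r) (z r) (a r) * / A r); [reflexivity|].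
  unfold k_num; ck_auto. }
assert (Hg : Ck n (fun r => g_of r (q r) (p r) (b r))).
{ apply Ck_ext with (fun r => b_rhs r (q r) (p r) (v r) (z r) (a r) (k_of r (q r) (p r) (b r))); [reflexivity|].
  unfold b_rhs, Rdiv; ck_auto. }
assert (Hk' : Ck n (fun r => r * k_of r (q r) (p r) (b r))) by ck_auto.
split; [|split].
- apply (singular_gain n 0 q _ Hk' q_cont (or_introl eq_refl)); intros r Hr.
  eapply is_derive_eq; [now apply q_derive|]; simpl; field; lra.
- apply (singular_gain n 4 p _ Hk p_cont (or_intror p0)); intros r Hr.
  eapply is_derive_eq; [now apply p_derive|]; simpl; field; lra.
- apply (singular_gain n 3 b _ Hg b_cont (or_intror b0)); intros r Hr.
  eapply is_derive_eq; [now apply b_derive|]; simpl; field; lra.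
Qed.

Lemma v_Ck n : Ck n v.
Proof. destruct (coordinates_Ck n) as [Hq [Hp Hb]]; unfold v, v_of, Rdiv; ck_auto. Qed.

Lemma z_Ck n : Ck n z.
Proof. destruct (coordinates_Ck n) as [Hq [Hp Hb]]; unfold z, z_of, Rdiv; ck_auto. Qed.

Lemma a_Ck n : Ck n a.
Proof. destruct (coordinates_Ck n) as [Hq [Hp Hb]]; unfold a, a_of, Rdiv; ck_auto. Qed.

Lemma w_Ck n : Ck n w.
Proof. assert (H := v_Ck n); unfold w, w_of; fold v; ck_auto. Qed.

Lemma A_Ck n : Ck n A.
Proof. assert (H := a_Ck n); unfold A, A_of; fold a; ck_auto. Qed.

Lemma w_deriv : is_deriv_half_line w dw.
Proof.
intros r Hr; apply slope_D_in; destruct (Rle_lt_or_eq_dec 0 r Hr) as [Hp|<-].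
- apply slope_of_derive; assert (D1 := q_derive r Hp); assert (D2 := p_derive r Hp).
  unfold w, w_of, v_of, dw, dw_of, z_of; derive_by; [lra|]; simpl; field; lra.
- replace (dw 0) with (0 * v 0) by (unfold dw, dw_of; ring).
  apply (slope_at_0 w (fun r => r * v r)).
  + intros r _; unfold w, w_of; fold (v r); ring.
  + assert (H := v_Ck 0); assert (C : Ck 0 (fun r => r * v r)) by ck_auto; apply C; lra.
Qed.

Lemma dw_deriv : is_deriv_half_line dw ddw.
Proof.
intros r Hr; apply slope_D_in; destruct (Rle_lt_or_eq_dec 0 r Hr) as [Hp|<-].
- apply slope_of_derive; assert (D1 := q_derive r Hp); assert (D2 := p_derive r Hp).
  assert (HA := A_pos r Hr); unfold A_of in HA.
  unfold dw, dw_of, z_of; derive_by; [lra|].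
  unfold ddw, s, v, z, a, A, A_of, k_of, k_num, v_of, z_of in *; set (aa := a_of (q r) (b r)) in *.
  simpl in *; field; lra.
- replace (ddw 0) with (z 0).
  + apply (slope_at_0 dw z).
    * intros r _; unfold dw, dw_of; fold (z r); ring.
    * apply (z_Ck 0); lra.
  + unfold ddw, z, s, v, v_of, z_of, A, A_of; field; lra.
Qed.

Lemma A_deriv : is_deriv_half_line A dA.
Proof.
intros r Hr; apply slope_D_in; destruct (Rle_lt_or_eq_dec 0 r Hr) as [Hp|<-].
- apply slope_of_derive; assert (D1 := q_derive r Hp); assert (D2 := b_derive r Hp).
  assert (HA := A_pos r Hr); unfold A_of, a_of in HA.
  unfold A, A_of, a_of; derive_by.
  unfold dA, s, v, z, a, A, A_of, g_of, b_rhs, k_of, k_num, v_of, z_of, a_of in *.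
  simpl in *; field; lra.
- replace (dA 0) with (0 * a 0) by (unfold dA; ring).
  apply (slope_at_0 A (fun r => r * a r)).
  + intros r _; unfold A, A_of; fold (a r); ring.
  + assert (H := a_Ck 0); assert (C : Ck 0 (fun r => r * a r)) by ck_auto; apply C; lra.
Qed.

(** The third equation reads [(log (T * sqrt A))' = - 2 r z^2]. *)
Let flux (r : R) : R := 2 * Rmax 0 r * z (Rmax 0 r) ^ 2.
Let G (r : R) : R := RInt flux 0 r.

Lemma flux_cont r : continuous flux r.
Proof.
assert (C1 : continuous (fun r => z (Rmax 0 r)) r) by (apply cont_half_extends; intros; now apply (z_Ck 0)).
assert (C2 : continuous (fun r => Rmax 0 r) r).
{ apply (cont_half_extends (fun r => r)); intros; apply (Ck_id 0); assumption. }
unfold flux; cauto.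
Qed.

Lemma G_derive r : is_derive G r (flux r).
Proof.
apply (is_derive_RInt flux G 0 r).
- exists (mkposreal 1 Rlt_0_1); intros y _; apply (RInt_correct flux 0 y), (ex_RInt_continuous flux).
  intros; apply flux_cont.
- apply flux_cont.
Qed.

Lemma flux_eq r : 0 <= r -> flux r = 2 * r * z r ^ 2.
Proof. intros Hr; unfold flux; now rewrite Rmax_right. Qed.

Lemma G_mono r1 r2 : 0 <= r1 <= r2 -> G r1 <= G r2.
Proof.
intros H; apply (monotone_by_derive G flux); [lra| | |].
- intros; apply G_derive.
- intros t _; apply (is_derive_cont G t (flux t)), G_derive.
- intros t Ht; rewrite flux_eq by lra; assert (0 <= z t ^ 2) by apply pow2_ge_0; nra.
Qed.

Hypothesis decay : exists R1, 1 <= R1 /\ forall r, R1 <= r -> Rabs (dw r) <= 20 / r.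

(** [w' = O(1/r)] bounds the flux [2 w'^2 / r] by [800 / r^2], so that
    [G + 800 / r] decreases while [G] increases. *)
Lemma G_tends : exists Ginf, tends G Ginf.
Proof.
destruct decay as [R1 [HR1 Hd]].
destruct (tends_decreasing (fun r => - G r) (- (G R1 + 800 / R1))) as [c Hc].
- intros r1 r2 H; assert (M := G_mono r1 r2 H); lra.
- assert (Hb : forall t, R1 <= t -> G t + 800 / t <= G R1 + 800 / R1).
  { intros t Ht.
    assert (M : - (G R1 + 800 * / R1) <= - (G t + 800 * / t)); [|unfold Rdiv; lra].
    apply (monotone_by_derive (fun r => - (G r + 800 * / r)) (fun r => - (flux r - 800 / r ^ 2))); [lra| | |].
    - intros r Hr; assert (D := G_derive r); derive_by; [lra|field; lra].
    - intros r Hr; assert (C := is_derive_cont G r (flux r) (G_derive r)).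
      assert (C' : continuous (fun r => / r) r) by (apply (cinv (fun r => r)); [cauto|lra]); cauto.
    - intros r Hr; rewrite flux_eq by lra; specialize (Hd r ltac:(lra)).
      assert (H2 : dw r ^ 2 <= (20 / r) ^ 2) by (rewrite <- (pow2_abs (dw r)); apply pow_incr; split; [apply Rabs_pos|assumption]).
      unfold dw, dw_of in H2; fold (z r) in H2.
      assert (E : 2 * r * z r ^ 2 <= 800 / r ^ 2); [|lra].
      apply Rle_trans with (2 * (r * z r) ^ 2).
      + assert (0 <= z r ^ 2) by apply pow2_ge_0; replace ((r * z r) ^ 2) with (r * (r * z r ^ 2)) by ring.
        assert (0 <= r * z r ^ 2) by nra; nra.
      + replace (800 / r ^ 2) with (2 * (20 / r) ^ 2) by (field; lra); lra. }
  intros t Ht; destruct (Rle_dec R1 t) as [H|H].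
  + specialize (Hb t H); assert (0 < 800 / t) by (apply Rdiv_lt_0_compat; lra); lra.
  + assert (M := G_mono t R1 ltac:(lra)); assert (0 < 800 / R1) by (apply Rdiv_lt_0_compat; lra); lra.
- exists (- c); intros e He; destruct (proj1 Hc e He) as [T [HT H]]; exists T; split; [assumption|].
  intros t Ht; specialize (H t Ht); rewrite <- Rabs_Ropp; replace (- (G t - - c)) with (- G t - c) by ring; assumption.
Qed.

Hypothesis w_lim : is_lim w p_infty (-1).
Hypothesis A_lim : is_lim A p_infty 1.
Hypothesis mass_lim : exists m : R, is_lim (fun r => r * (1 - A r)) p_infty m.

Lemma dw_lim : is_lim dw p_infty 0.
Proof.
destruct decay as [R1 [HR1 Hd]]; apply is_lim_spec; intros e; assert (He := cond_pos e).
exists (Rmax R1 (20 / e)); intros r Hr.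
assert (M1 := Rmax_l R1 (20 / e)); assert (M2 := Rmax_r R1 (20 / e)).
rewrite Rminus_0_r; eapply Rle_lt_trans; [apply Hd; lra|].
apply Rlt_div_l; [lra|]; assert (H : 20 / e < r) by lra; apply Rlt_div_l in H; lra.
Qed.

Section Lapse.

Variable Ginf : R.
Hypothesis G_lim : tends G Ginf.

Let T (r : R) : R := exp (Ginf - G r) * / sqrt (A r).
Let H (r : R) : R := 2 * r * z r ^ 2 + dA r * / (2 * A r).
Let dT (r : R) : R := - H r * T r.

Lemma T_pos r : 0 <= r -> 0 < T r.
Proof.
intros Hr; apply Rmult_lt_0_compat; [apply exp_pos|]; now apply Rinv_0_lt_compat, sqrt_lt_R0, A_pos.
Qed.

Lemma T_deriv : is_deriv_half_line T dT.
Proof.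
intros r Hr; assert (HA := A_pos r Hr); fold (A r) in HA.
assert (Hs := sqrt_lt_R0 _ HA).
assert (S1 : slope half_line A r (dA r)) by now apply slope_D_in, A_deriv.
assert (D2 : is_derive (fun y => / sqrt y) (A r) (- (/ (2 * sqrt (A r))) / sqrt (A r) ^ 2)).
{ derive_by; [assumption|lra|field; lra]. }
assert (S2 := slope_comp _ _ _ _ _ _ S1 D2).
assert (D3 : is_derive (fun x => exp (Ginf - G x)) r (exp (Ginf - G r) * - (flux r))).
{ assert (D := G_derive r); derive_by; ring. }
assert (S3 := slope_mult _ _ _ _ _ _ (slope_of_derive half_line _ _ _ D3) S2).
apply slope_D_in.
match type of S3 with slope _ _ _ ?c => replace (dT r) with c; [exact S3|] end.
unfold dT, H, T; rewrite flux_eq by assumption.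
assert (EA : A r = sqrt (A r) ^ 2) by (rewrite pow2_sqrt; lra).
set (d := dA r); set (c := sqrt (A r)) in *; set (e := exp (Ginf - G r)).
clearbody d c e; rewrite EA; field; lra.
Qed.

Lemma H_Ck n : Ck n H.
Proof.
assert (H1 := v_Ck n); assert (H2 := z_Ck n); assert (H3 := a_Ck n); assert (H4 := A_Ck n).
assert (H5 : Ck n (fun r => / (2 * A r))).
{ apply Ck_inv; [intros r Hr; assert (HA := A_pos r Hr); fold (A r) in HA; lra|ck_auto]. }
unfold H, dA, s; ck_auto.
Qed.

(** The equation [T' = - H T] gives one derivative at a time. *)
Lemma T_Ck n : Ck n T.
Proof.
induction n as [|n IH].
- intros r Hr; apply (slope_cont _ _ _ (dT r)); now apply slope_D_in, T_deriv.
- exists dT; split; [apply T_deriv|]; assert (HH := H_Ck n); unfold dT; ck_auto.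
Qed.

Lemma T_lim : is_lim T p_infty 1.
Proof.
assert (L1 : is_lim (fun r => exp (Ginf - G r)) p_infty (exp 0)).
{ apply (is_lim_comp_continuous (fun r => Ginf - G r) exp p_infty 0).
  - apply is_lim_of_tends; intros e He; destruct (G_lim e He) as [R1 [HR1 HG]]; exists R1; split; [assumption|].
    intros t Ht; specialize (HG t Ht); rewrite <- Rabs_Ropp; replace (- (Ginf - G t - 0)) with (G t - Ginf) by ring; assumption.
  - apply (ex_derive_continuous exp 0); exists (exp 0); apply is_derive_exp. }
assert (L2 : is_lim (fun r => / sqrt (A r)) p_infty (/ sqrt 1)).
{ apply (is_lim_comp_continuous A (fun y => / sqrt y) p_infty 1); [assumption|].
  apply (cinv sqrt 1); [apply (csqrt (fun y => y) 1); cauto | rewrite sqrt_1; lra]. }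
replace (Finite 1) with (Finite (exp 0 * / sqrt 1)) by (rewrite exp_0, sqrt_1; f_equal; field).
apply (is_lim_mult _ _ p_infty (exp 0) (/ sqrt 1)); [assumption|assumption|exact I].
Qed.

Lemma einstein_yang_mills r : 0 < r ->
  r ^ 2 * A r * ddw r + Phi A w r * dw r + w r * (1 - w r ^ 2) = 0 /\
  r * dA r + (2 * dw r ^ 2 + 1) * A r = 1 - (1 - w r ^ 2) ^ 2 / r ^ 2 /\
  2 * r * A r * dT r + (2 * dw r ^ 2 * A r + Phi A w r / r) * T r = 0.
Proof.
intros Hr; assert (HA := A_pos r ltac:(lra)); fold (A r) in HA.
unfold dT, H, dA, ddw, Phi; set (TT := T r).
assert (EA : A r = 1 + r ^ 2 * a r) by reflexivity.
rewrite EA in *; unfold dw, dw_of, w, w_of, s; fold (v r) (z r).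
repeat split; field; lra.
Qed.

Lemma regular_solution_witness : exists w A T w' w'' A' T' : R -> R,
    (smooth_half_line w /\ smooth_half_line A /\ smooth_half_line T) /\
    (is_deriv_half_line w w' /\ is_deriv_half_line w' w'' /\
     is_deriv_half_line A A' /\ is_deriv_half_line T T') /\
    (forall r : R, 0 <= r -> 0 < A r /\ 0 < T r) /\
    (forall r : R, 0 < r ->
       r ^ 2 * A r * w'' r + Phi A w r * w' r + w r * (1 - w r ^ 2) = 0 /\
       r * A' r + (2 * w' r ^ 2 + 1) * A r = 1 - (1 - w r ^ 2) ^ 2 / r ^ 2 /\
       2 * r * A r * T' r + (2 * w' r ^ 2 * A r + Phi A w r / r) * T r = 0) /\
    (w 0 = 1 /\ w' 0 = 0 /\ w'' 0 = - lam /\ A 0 = 1 /\ T' 0 = 0) /\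
    (is_lim w p_infty (-1) /\ is_lim w' p_infty 0) /\
    (exists m : R, is_lim (fun r => r * (1 - A r)) p_infty m) /\
    (is_lim A p_infty 1 /\ is_lim T p_infty 1).
Proof.
exists w, A, T, dw, ddw, dA, dT.
refine (conj (conj _ (conj _ _)) (conj (conj _ (conj _ (conj _ _))) (conj _ (conj _ (conj _ (conj _ (conj _ _))))))).
- apply smooth_of_Ck, w_Ck.
- apply smooth_of_Ck, A_Ck.
- apply smooth_of_Ck, T_Ck.
- exact w_deriv.
- exact dw_deriv.
- exact A_deriv.
- exact T_deriv.
- intros r Hr; split; [now apply A_pos|now apply T_pos].
- exact einstein_yang_mills.
- assert (HA0 : A 0 = 1) by (unfold A, A_of; ring).
  repeat split; [unfold w, w_of; ring|unfold dw, dw_of; ring| |assumption|].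
  + unfold ddw; rewrite HA0; unfold s, v, v_of; rewrite p0, q0; field.
  + unfold dT, H, dA; ring.
- split; [exact w_lim|exact dw_lim].
- exact mass_lim.
- split; [exact A_lim|exact T_lim].
Qed.

End Lapse.

End Regular.

Theorem mainTheorem1 :
  exists lambda : R, 0 < lambda < 2 /\
  exists w A T w' w'' A' T' : R -> R,
    (smooth_half_line w /\ smooth_half_line A /\ smooth_half_line T) /\
    (is_deriv_half_line w w' /\ is_deriv_half_line w' w'' /\
     is_deriv_half_line A A' /\ is_deriv_half_line T T') /\
    (forall r : R, 0 <= r -> 0 < A r /\ 0 < T r) /\
    (forall r : R, 0 < r ->
       r ^ 2 * A r * w'' r + Phi A w r * w' r + w r * (1 - w r ^ 2) = 0 /\
       r * A' r + (2 * w' r ^ 2 + 1) * A r = 1 - (1 - w r ^ 2) ^ 2 / r ^ 2 /\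
       2 * r * A r * T' r + (2 * w' r ^ 2 * A r + Phi A w r / r) * T r = 0) /\
    (w 0 = 1 /\ w' 0 = 0 /\ w'' 0 = - lambda /\ A 0 = 1 /\ T' 0 = 0) /\
    (is_lim w p_infty (-1) /\ is_lim w' p_infty 0) /\
    (exists m : R, is_lim (fun r => r * (1 - A r)) p_infty m) /\
    (is_lim A p_infty 1 /\ is_lim T p_infty 1).
Proof.
destruct connecting_orbit_exists as
  [lam [rs [q [p [b [l [W [P [N [K [Hlam [Hrs [sol [orb [Hgood [HW0 [HP0 HN0]]]]]]]]]]]]]]]]].
destruct (tau_exists rs l W P N K Hrs orb Hgood) as [tau Htau].
destruct (regular_coordinates_exist lam rs q p b l W P N K Hrs sol orb Hgood HW0 HP0 HN0 tau Htau)
  as [qs [ps [bs [Hq [Hp [Hb [q0 [p0 [b0 [HA [Dq [Dp [Db [decay [Lw [LA Lm]]]]]]]]]]]]]]]].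
exists lam; split; [exact Hlam|].
destruct (G_tends qs ps bs Hq Hp Hb p0 b0 HA Dq Dp Db decay) as [Ginf HG].
exact (regular_solution_witness lam qs ps bs Hq Hp Hb q0 p0 b0 HA Dq Dp Db decay Lw LA Lm Ginf HG).
Qed.
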